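(* Fix an integer $e\geq 2$ and set $f=\binom{e+1}{2}-2$. Let $X$ be an algebraic variety, let $\mathcal{E},\mathcal{F}$ be vector bundles on $X$ of ranks $e$ and $f$ respectively, and let $\phi:\mathrm{Sym}^2(\mathcal{E})\rightarrow \mathcal{F}$ be a morphism of vector bundles. The class of the virtual divisor $$\mathfrak{Dp}:=\Bigl\{x\in X: \mathrm{Ker}(\phi(x)) \ \text{is a degenerate pencil}\Bigr\}$$ equals $$[\mathfrak{Dp}]=(e-1)\Bigl(e\,c_1(\mathcal{F})-(e^2+e-4)\,c_1(\mathcal{E})\Bigr)\in H^2(X,\mathbb Q).$$
   Context: For a vector space $V$, a pencil of quadrics (a line) $\ell\subseteq \mathbf{P}(\mathrm{Sym}^2(V))$ is called degenerate if its intersection with the discriminant divisor $D(V)\subseteq \mathbf{P}(\mathrm{Sym}^2(V))$ of singular quadrics is non-reduced. Virtual class: let $\overline{\Phi}\subseteq \mathrm{Hom}(\mathrm{Sym}^2\mathbb C^e,\mathbb C^f)$ be the closure of the set of linear maps $\psi$ with $\dim \mathrm{Ker}(\psi)=2$ such that the line $\mathbf{P}(\mathrm{Ker}(\psi))$ is tangent to the smooth locus (symmetric matrices of corank exactly $1$) of the discriminant hypersurface. It is a $GL_e(\mathbb C)\times GL_f(\mathbb C)$-invariant hypersurface, hence has an equivariant fundamental class which is a polynomial in the universal Chern classes. The class $[\mathfrak{Dp}]$ is the value of that polynomial on the Chern classes of $\mathcal{E}$ and $\mathcal{F}$. It is the class of the actual degeneracy locus (with natural multiplicities) when that locus has codimension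 $1$. *)

(* Defs.v *)
From HB Require Import structures.
From mathcomp Require Import all_boot all_order all_algebra.
From mathcomp Require Import all_classical all_reals all_analysis.
From mathcomp Require Import complex ring lra.
From mathcomp Require Import -(notations) mpoly.

Set Implicit Arguments.
Unset Strict Implicit.
Unset Printing Implicit Defensive.

Import Order.TTheory GRing.Theory Num.Theory numFieldNormedType.Exports.

Local Open Scope classical_set_scope.
Local Open Scope ring_scope.
Local Open Scope quotient_scope.

(** * Cech cohomology in degree 2 with rational coefficients

    Open covers are indexed by the points of the space ([U x] is a neighborhood
    of [x]).  Such covers are cofinal among all open covers, and between two of
    them, [V x `<=` U x] for all [x], there is a canonical refinement map, so
    the colimit over covers amounts to identifying cochains that agree on the
    overlaps of some cover.  For a paracompact Hausdorff locally contractible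
    space (for instance the analytic space of a variety) the result is the
    singular cohomology group H^2(T, Q). *)

Section CechH2.
Variable T : topologicalType.

Definition pointed_cover (U : T -> set T) := forall x, open_nbhs x (U x).

Definition locally_constant_on (D : set T) (f : T -> rat) :=
  forall p, D p -> \forall q \near p, f q = f p.

(* [c x y z p] is the value at the point [p] of the component of the cochain
   on U_x n U_y n U_z. *)
Definition cochain2 := T -> T -> T -> T -> rat.
HB.instance Definition _ := GRing.Zmodule.on cochain2.

Definition is_cocycle2 (c : cochain2) := exists U, [/\ pointed_cover U,
  forall x y z, locally_constant_on (U x `&` U y `&` U z) (c x y z) &
  forall x y z w p, (U x `&` U y `&` U z `&` U w) p ->
    c y z w p - c x z w p + c x y w p - c x y z p = 0].

Definition is_coboundary2 (c : cochain2) := exists U, pointed_cover U /\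
  exists b : T -> T -> T -> rat,
    (forall x y, locally_constant_on (U x `&` U y) (b x y)) /\
    (forall x y z p, (U x `&` U y `&` U z) p ->
       c x y z p = b y z p - b x z p + b x y p).

Lemma pointed_coverI U V : pointed_cover U -> pointed_cover V ->
  pointed_cover (fun x => U x `&` V x).
Proof.
by move=> hU hV x; split; [apply: openI; [case: (hU x)|case: (hV x)]
  |split; [case: (hU x)|case: (hV x)]].
Qed.

Lemma locally_constant_onB D D' D'' f g : D'' `<=` D -> D'' `<=` D' ->
  locally_constant_on D f -> locally_constant_on D' g ->
  locally_constant_on D'' (fun p => f p - g p).
Proof.
move=> sD sD' hf hg p Dp.
have := hf p (sD _ Dp); have := hg p (sD' _ Dp).
by apply: filterS2 => q -> ->.
Qed.

Lemma locally_constant_on0 D : locally_constant_on D (fun=> 0).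
Proof. by move=> p _; apply: nearW. Qed.

Lemma pointed_coverT : pointed_cover (fun=> setT).
Proof. by move=> x; split=> //; exact: openT. Qed.

Definition cocycle2 : {pred cochain2} := fun c => `[< is_cocycle2 c >].

Lemma cochain20E x y z p : (0 : cochain2) x y z p = 0.
Proof. by []. Qed.

Lemma cochain2BE (c d : cochain2) x y z p :
  (c - d) x y z p = c x y z p - d x y z p.
Proof. by []. Qed.

Lemma cocycle2_zmod_closed : zmod_closed cocycle2.
Proof.
split=> [|c d /asboolP[U [hU cU dU]] /asboolP[V [hV cV dV]]].
  apply/asboolP; exists (fun=> setT); split; first exact: pointed_coverT.
  - by move=> x y z; exact: locally_constant_on0.
  - by move=> x y z w p _; rewrite !cochain20E; lra.
apply/asboolP; exists (fun x => U x `&` V x); split.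
- exact: pointed_coverI.
- move=> x y z; apply: (locally_constant_onB _ _ (cU x y z) (cV x y z)).
  + by move=> p [[[? ?] [? ?]] [? ?]].
  + by move=> p [[[? ?] [? ?]] [? ?]].
- move=> x y z w p [[[[? ?] [? ?]] [? ?]] [? ?]].
  have eU : (U x `&` U y `&` U z `&` U w) p by [].
  have eV : (V x `&` V y `&` V z `&` V w) p by [].
  have := dU _ _ _ _ _ eU; have := dV _ _ _ _ _ eV.
  by rewrite !cochain2BE; lra.
Qed.

HB.instance Definition _ :=
  GRing.isZmodClosed.Build cochain2 cocycle2 cocycle2_zmod_closed.

Record Z2 := CechCocycle { cocycle_val : cochain2; _ : cocycle_val \in cocycle2 }.
HB.instance Definition _ := [isSub for cocycle_val].
HB.instance Definition _ := [Choice of Z2 by <:].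
HB.instance Definition _ := [SubChoice_isSubZmodule of Z2 by <:].

Definition coboundary2 : {pred Z2} := fun c => `[< is_coboundary2 (val c) >].

Lemma coboundary2_zmod_closed : zmod_closed coboundary2.
Proof.
split=> [|c d /asboolP[U [hU [b [bU eU]]]] /asboolP[V [hV [b' [bV eV]]]]].
  apply/asboolP; exists (fun=> setT); split; first exact: pointed_coverT.
  exists (fun _ _ _ => 0); split; first by move=> x y; exact: locally_constant_on0.
  by move=> x y z p _; rewrite raddf0 cochain20E; lra.
apply/asboolP; exists (fun x => U x `&` V x); split; first exact: pointed_coverI.
exists (fun x y p => b x y p - b' x y p); split.
  move=> x y; apply: (locally_constant_onB _ _ (bU x y) (bV x y)).
  + by move=> p [[? ?] [? ?]].
  + by move=> p [[? ?] [? ?]].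
move=> x y z p [[[? ?] [? ?]] [? ?]].
have hu : (U x `&` U y `&` U z) p by [].
have hv : (V x `&` V y `&` V z) p by [].
transitivity (val c x y z p - val d x y z p); first by [].
by rewrite (eU _ _ _ _ hu) (eV _ _ _ _ hv); ring.
Qed.

HB.instance Definition _ :=
  GRing.isZmodClosed.Build Z2 coboundary2 coboundary2_zmod_closed.

Definition H2 : zmodType := Quotient.quot coboundary2.
Definition H2_class (c : Z2) : H2 := \pi_(Quotient.quot coboundary2) c.

End CechH2.

(** * Polynomial functions and Zariski closed sets *)

(* [p : polyfun V] is a polynomial in the coordinates of the basis [vbasis {:V}]. *)
Notation polyfun V := (mpoly (\dim {:V}) _).

Section Zariski.
Variables (K : fieldType) (V : vectType K).

Definition peval (p : polyfun V) (v : V) : K :=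
  meval (fun i => coord (vbasis {:V}) i v) p.

Definition vanishes_on (Z : set V) (p : polyfun V) := forall v, Z v -> peval p v = 0.

Definition zariski_closure (Z : set V) : set V :=
  [set v | forall p, vanishes_on Z p -> peval p v = 0].

Definition zariski_closed (Z : set V) := zariski_closure Z = Z.

End Zariski.

(** * Complex algebraic varieties

    A (reduced, separated, not necessarily irreducible) variety is a set with a
    finite atlas whose charts identify pieces of it with closed subsets of affine
    spaces. *)

(* This type of complex numbers comes with its metric topology. *)
Definition Complex (R : realType) : numClosedFieldType := R[i].

Section Variety.
Variable R : realType.
Local Notation C := (Complex R).

(* [f], as a function of the coordinates [h], is on [D] locally a quotient of
   polynomials. *)
Definition regular_wrt (T : Type) (n : nat) (h : T -> 'rV[C]_n) (D : set T)
    (f : T -> C) :=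
  forall x, D x -> exists p q : polyfun ('rV[C]_n), peval q (h x) != 0 /\
    forall y, D y -> peval q (h y) != 0 -> f y = peval p (h y) / peval q (h y).

Record variety := Variety {
  point :> Type;
  nb_charts : nat;
  chart_dim : 'I_nb_charts -> nat;
  chart_dom : 'I_nb_charts -> set point;
  chart : forall a, point -> 'rV[C]_(chart_dim a);
  chart_cover : forall x, exists a, chart_dom a x;
  chart_inj : forall a x y, chart_dom a x -> chart_dom a y ->
    chart a x = chart a y -> x = y;
  chart_closed : forall a, zariski_closed (chart a @` chart_dom a);
  overlap_open : forall a b,
    zariski_closed (chart a @` (chart_dom a `\` chart_dom b));
  transition_regular : forall a b (k : 'I_(chart_dim b)),
    regular_wrt (chart a) (chart_dom a `&` chart_dom b)
      (fun x => chart b x ord0 k);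
  chart_separated : forall a b, zariski_closed
    [set row_mx (chart a x) (chart b x) | x in chart_dom a `&` chart_dom b]
}.

Definition zariski_open (X : variety) (U : set X) :=
  forall a, zariski_closed (chart a @` (chart_dom a `\` U)).

Definition regular_on (X : variety) (U : set X) (f : X -> C) :=
  forall a, regular_wrt (chart a) (chart_dom a `&` U) f.

(* The classical topology of a variety. *)
Definition analytic (X : variety) : Type := X.
HB.instance Definition _ X := gen_eqMixin (analytic X).
HB.instance Definition _ X := gen_choiceMixin (analytic X).

Section Analytic.
Variable X : variety.

Definition analytic_open : set_system (analytic X) := [set U |
  forall a, exists O : set 'rV[C]_(chart_dim a),
    open O /\ chart_dom a `&` U = chart_dom a `&` chart a @^-1` O].

Lemma analytic_openT : analytic_open setT.
Proof. by move=> a; exists setT; split; [exact: openT|]. Qed.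

Lemma analytic_openI : setI_closed analytic_open.
Proof.
move=> U V hU hV a; have [A [oA eA]] := hU a; have [B [oB eB]] := hV a.
exists (A `&` B); split; first exact: openI.
transitivity ((chart_dom a `&` U) `&` (chart_dom a `&` V)); first exact: setIIr.
by rewrite eA eB preimage_setI; apply/esym/setIIr.
Qed.

Lemma analytic_open_bigU (I : Type) (f : I -> set (analytic X)) :
  (forall i, analytic_open (f i)) -> analytic_open (\bigcup_i f i).
Proof.
move=> hf a; have [A hA] := choice (fun i => hf i a).
exists (\bigcup_i A i); split; first by apply: bigcup_open => i _; case: (hA i).
rewrite preimage_bigcup !setI_bigcupr; apply: eq_bigcupr => i _.
by case: (hA i).
Qed.

HB.instance Definition _ := isOpenTopological.Build (analytic X)
  analytic_openT analytic_openI analytic_open_bigU.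

End Analytic.

(** * Vector bundles, given by transition functions *)

(* [trans i j x] sends the coordinates of a vector of the fiber at [x] in the
   [j]-th frame to its coordinates in the [i]-th one. *)
Record vbundle (X : variety) (r : nat) := VBundle {
  frame : Type;
  frame_dom : frame -> set X;
  frame_open : forall i, zariski_open (frame_dom i);
  frame_cover : forall x, exists i, frame_dom i x;
  trans : frame -> frame -> X -> 'M[C]_r;
  trans_regular : forall i j k l,
    regular_on (frame_dom i `&` frame_dom j) (fun x => trans i j x k l);
  trans1 : forall i x, frame_dom i x -> trans i i x = 1%:M;
  transM : forall i j k x, frame_dom i x -> frame_dom j x -> frame_dom k x ->
    trans i j x *m trans j k x = trans i k x
}.

(* Sym^2 of the space of column vectors, as the space of symmetric matrices;
   the square of the vector [v] is [v *m v^T]. *)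
Definition sym_mx (e : nat) : {vspace 'M[C]_e} :=
  lker (linfun (fun A : 'M[C]_e => A - A^T)).

Lemma sym_mxP e (A : 'M[C]_e) : reflect (A^T = A) (A \in sym_mx e).
Proof.
have add : linear (fun A : 'M[C]_e => A - A^T).
  by move=> a B D; rewrite linearP /= scalerBr opprD addrACA.
pose f : {linear 'M[C]_e -> 'M[C]_e} :=
  HB.pack (fun A : 'M[C]_e => A - A^T) (GRing.isLinear.Build _ _ _ _ _ add).
rewrite memv_ker (lfunE f) /= subr_eq0.
by apply: (iffP eqP) => [<-|->].
Qed.

Definition Sym2 (e : nat) : vectType C := subvs_of (sym_mx e).

Definition HomSym2 (e f : nat) : vectType C := 'Hom(Sym2 e, 'cV[C]_f).

(* [psi' = h o psi o Sym^2(g)^-1], for invertible [g] *)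
Definition transports e f (g : 'M[C]_e) (h : 'M[C]_f) (psi psi' : HomSym2 e f) :=
  forall S S' : Sym2 e, vsval S' = g *m vsval S *m g^T -> psi' S' = h *m psi S.

(* A morphism of vector bundles Sym^2(E) -> F, by its matrices in the frames of
   E and F. *)
Record sym2_morphism (X : variety) (e f : nat) (E : vbundle X e) (F : vbundle X f) :=
  Sym2Morphism {
  local_map : frame E -> frame F -> X -> HomSym2 e f;
  local_map_regular : forall i j (S : Sym2 e) k,
    regular_on (frame_dom i `&` frame_dom j) (fun x => local_map i j x S k ord0);
  local_map_compat : forall i i' j j' x,
    frame_dom i x -> frame_dom i' x -> frame_dom j x -> frame_dom j' x ->
    transports (trans i' i x) (trans j' j x) (local_map i j x) (local_map i' j' x)
}.

(** * The first Chern class *)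

Definition cexp (z : C) : C :=
  let: (x +i* y)%C := z in ((expR x * cos y) +i* (expR x * sin y))%C.

Definition two_pi_i : C := (0 +i* (2 * pi))%C.

(* c_1(E) = c_1(det E) is the image of the class of the cocycle det(trans) under
   the connecting map of the exponential sequence 0 -> Z -> O -> O^* -> 0 (with
   [cexp (2 pi i _)] as exponential) of continuous functions:  choose logarithms
   [l x y] of the determinants on a fine enough cover, and take the (integer
   valued) coboundary of [l]. *)
Definition is_c1 (X : variety) r (E : vbundle X r) (h : H2 (analytic X)) :=
  exists (U : analytic X -> set (analytic X)) (i : X -> frame E)
    (l : X -> X -> analytic X -> C) (c : Z2 (analytic X)),
  [/\ pointed_cover U /\ (forall x, U x `<=` frame_dom (i x)),
    forall x y, {within U x `&` U y, continuous (l x y)},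
    forall x y p, (U x `&` U y) p ->
      cexp (two_pi_i * l x y p) = \det (trans (i x) (i y) p),
    forall x y z p, (U x `&` U y `&` U z) p ->
      ratr (cocycle_val c x y z p) = l y z p - l x z p + l x y p &
    h = H2_class c].

(* Such a class exists and is unique. *)
Definition c1 (X : variety) r (E : vbundle X r) : H2 (analytic X) :=
  xget 0 [set h | is_c1 E h].

(** * The virtual class *)

(* The pencil P(Ker psi) is tangent to the discriminant at a quadric [A] of corank
   exactly 1: the differential at [A] of the equation det of the discriminant
   vanishes on Ker psi. *)
Definition tangent_pencils (e f : nat) : set (HomSym2 e f) := [set psi |
  \dim (lker psi) = 2%N /\
  exists A : Sym2 e, [/\ A \in lker psi, \rank (vsval A) = e.-1 &
    forall B : Sym2 e, B \in lker psi ->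
      (\det (map_mx polyC (vsval A) + 'X *: map_mx polyC (vsval B)))^`().[0] = 0]].

(* The group H^2_G(pt), for G = GL_e x GL_f, is freely generated by the universal
   first Chern classes; the pair [(a, b)] stands for a c_1(E) + b c_1(F).  If [Z]
   is an invariant hypersurface with ideal generated by [P], then G acts on [P] by
   a character, and the class of [Z] is the first Chern class of this character:
   [P] is an equivariant section, with divisor [Z], of the corresponding line
   bundle. *)
Definition is_equivariant_class e f (Z : set (HomSym2 e f)) (w : int * int) :=
  exists P : polyfun (HomSym2 e f), [/\ P != 0,
    forall Q, vanishes_on Z Q <-> exists S, Q = S * P &
    forall g h psi psi', g \in unitmx -> h \in unitmx -> transports g h psi psi' ->
      peval P psi' = \det g ^ w.1 * \det h ^ w.2 * peval P psi].

Definition equivariant_class e f (Z : set (HomSym2 e f)) : int * int :=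
  xget (0, 0) [set w | is_equivariant_class Z w].

(* By definition, the virtual class depends on [phi] only through E and F. *)
Definition virtual_class (X : variety) e f (E : vbundle X e) (F : vbundle X f)
    (phi : sym2_morphism E F) : H2 (analytic X) :=
  let w := equivariant_class (zariski_closure (@tangent_pencils e f)) in
  c1 E *~ w.1 + c1 F *~ w.2.

End Variety.

(* Main.v *)
Require Import Defs.
From mathcomp Require Import all_boot all_order all_algebra.
From mathcomp Require Import all_classical all_reals all_analysis.
From HB Require Import structures.
From mathcomp Require Import all_fingroup all_field.
From mathcomp Require Import ring zify.
From mathcomp Require Import -(notations) mpoly.

Set Implicit Arguments.
Unset Strict Implicit.
Unset Printing Implicit Defensive.

Import Order.TTheory GRing.Theory Num.Theory.
Local Open Scope ring_scope.

(** The tangent pencils form the zero locus of the discriminant of the binary form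
    det (s A + t B), where A and B span the kernel of psi. In Pluecker coordinates A and B
    are polynomial in psi, and that discriminant, computed as the discriminant of
    adj(A) B and divided by suitable powers of det A and of a maximal minor, gives a
    polynomial P in psi which does not depend on the chart. Replacing psi by
    h psi Sym^2(g)^-1 multiplies P by det(h)^(e(e-1)) det(g)^(4(e-1)-(e+1)e(e-1)), and
    4(e-1) - (e+1)e(e-1) = -(e-1)(e^2+e-4). Finally, P generates the ideal of the tangent
    pencils: restricted to suitable lines it has only simple roots, all of them tangent
    pencils. *)

(** * The discriminant of the characteristic polynomial *)

(** The obstacle is reducedness: [P] must generate the whole ideal of the tangent pencils. This
    comes down to a single pencil of symmetric matrices whose discriminant has simple roots. A
    diagonal pencil cannot serve, because its discriminant is a square. Adding a small multiple of
    the all-ones matrix splits each double root in two, by first-order perturbation of a double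
    eigenvalue. Divisibility of polynomials in psi is never obtained from factorizations. If
    [H * Q = S * P] with [P] homogeneous, then [P] divides [Q] as soon as, on one line whose
    direction is not a zero of [P], no zero of [P] is a zero of [H]: in such a direction [P] becomes
    monic in the parameter, up to a unit, and Euclidean division applies. The same line serves to
    divide the numerator of [P] by its denominator and, at the end, to remove a leading coefficient.
    Every pencil on it contains the identity; since the adjugate of a scalar matrix is scalar, the
    matrices of the charts are explicit there. The term (e+1)e(e-1) in the exponent of det(g) comes
    from det Sym^2(g) = det(g)^(e+1). *)

(* The power sums of the eigenvalues give the discriminant of the characteristic
   polynomial as a Hankel determinant. *)
Definition disc_mx (R : comNzRingType) n (S : 'M[R]_n.+1) : R :=
  \det (\matrix_(i < n.+1, j < n.+1) \tr (S ^+ (i + j))).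

Lemma map_disc_mx (R R' : comNzRingType) (h : {rmorphism R -> R'}) n
    (S : 'M[R]_n.+1) : h (disc_mx S) = disc_mx (map_mx h S).
Proof.
rewrite /disc_mx -det_map_mx; congr (\det _); apply/matrixP => i j.
by rewrite !mxE -rmorphXn/= trace_map_mx.
Qed.

Lemma disc_mx_conj (K : fieldType) n (P S : 'M[K]_n.+1) :
  P \in unitmx -> disc_mx (P *m S *m invmx P) = disc_mx S.
Proof.
move=> uP; congr (\det _); apply/matrixP => i j; rewrite !mxE.
have -> k : (P *m S *m invmx P) ^+ k = P *m S ^+ k *m invmx P.
  elim: k => [|k IH]; first by rewrite !expr0 mulmx1 mulmxV.
  by rewrite !exprS IH -!mulmxE !mulmxA mulmxKV.
by rewrite mxtrace_mulC mulmxA mulVmx // mul1mx.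
Qed.

(** The Hankel matrix of [c *: S] is D H D, with D the diagonal matrix of the powers of c. *)
Lemma disc_mxZ (R : comNzRingType) n (c : R) (S : 'M[R]_n.+1) :
  disc_mx (c *: S) = c ^+ (n.+1 * n) * disc_mx S.
Proof.
pose D := diag_mx (\row_(i < n.+1) c ^+ i).
have -> : disc_mx (c *: S) =
    \det (D *m (\matrix_(i, j) \tr (S ^+ (i + j))) *m D).
  congr (\det _); apply/matrixP => i j; rewrite mul_mx_diag mul_diag_mx !mxE.
  by rewrite exprZn mxtraceZ exprD; ring.
rewrite !det_mulmx mulrAC -expr2 det_diag.
under eq_bigr do rewrite mxE.
have -> : \prod_(i < n.+1) c ^+ i = c ^+ 'C(n.+1, 2).
  by rewrite -triangular_sum big_mkord (big_morph (fun i => c ^+ i) (exprD c) (expr0 c)).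
rewrite -exprM; congr (_ ^+ _ * _).
by rewrite bin2 muln2 even_halfK //= oddM /= andNb.
Qed.

Section ClosedField.
Variables (K : numClosedFieldType) (n : nat).
Implicit Types (S : 'M[K]_n.+1) (r : 'I_n.+1 -> K).

Lemma is_trig_mxX (t : 'M[K]_n.+1) k : is_trig_mx t ->
  is_trig_mx (t ^+ k) /\ forall i, (t ^+ k) i i = t i i ^+ k.
Proof.
move=> /is_trig_mxP tt; elim: k => [|k [/is_trig_mxP IH1 IH2]].
  split=> [|i]; last by rewrite !expr0 mxE eqxx.
  by rewrite expr0; apply: scalar_mx_is_trig.
have E (i j : 'I_n.+1) : (i <= j)%N -> (t ^+ k.+1) i j = t i i * (t ^+ k) i j.
  move=> le_ij; rewrite exprS -mulmxE mxE (bigD1 i) //= big1 ?addr0 // => l nli.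
  have [lt_il|le_li] := ltnP i l; first by rewrite tt ?mul0r.
  rewrite IH1 ?mulr0 // (leq_trans _ le_ij) // ltn_neqAle le_li andbT.
  by rewrite -val_eqE in nli.
split=> [|i]; last by rewrite E // IH2 -exprS.
by apply/is_trig_mxP => i j lt_ij; rewrite E ?(ltnW lt_ij) // IH1 // mulr0.
Qed.

(** Schur triangularization: the [r i] are the diagonal entries of a triangular form, and powers of
    a triangular matrix have the powers of these entries on their diagonal. *)
Lemma char_poly_split S : exists2 r : 'I_n.+1 -> K,
  char_poly S = \prod_i ('X - (r i)%:P) &
  forall k, \tr (S ^+ k) = \sum_i r i ^+ k.
Proof.
have [P /unitarymx_unit uP] := Schur S (ltn0Sn n).
rewrite /similar_to conjumx //; set t := P *m S *m _ => trt.
have St : S = invmx P *m t *m P by rewrite /t !mulmxA mulVmx // mul1mx mulmxKV.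
have Xt k : S ^+ k = invmx P *m t ^+ k *m P.
  elim: k => [|k IH]; first by rewrite !expr0 mulmx1 mulVmx.
  by rewrite !exprS IH {1}St -!mulmxE !mulmxA mulmxK.
exists (fun i => t i i).
  rewrite -(char_poly_trig trt) St /char_poly /char_poly_mx.
  have uPp : map_mx polyC (invmx P) *m map_mx polyC P = 1%:M.
    by rewrite -map_mxM mulVmx // map_mx1.
  have -> : 'X%:M - map_mx polyC (invmx P *m t *m P) =
      map_mx polyC (invmx P) *m ('X%:M - map_mx polyC t) *m map_mx polyC P.
    rewrite mulmxBr mulmxBl !map_mxM (scalar_mxC 'X (map_mx _ (invmx P))).
    by rewrite -['X%:M *m _ *m _]mulmxA uPp mulmx1.
  by rewrite !det_mulmx mulrAC -det_mulmx uPp det1 mul1r.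
move=> k; rewrite Xt mxtrace_mulC mulmxA mulmxV // mul1mx.
by apply: eq_bigr => i _; case: (is_trig_mxX k trt).
Qed.

Lemma mxtraceX S r k : char_poly S = \prod_i ('X - (r i)%:P) ->
  \tr (S ^+ k) = \sum_i r i ^+ k.
Proof.
have [r' -> ->] := char_poly_split S.
rewrite -(big_map r' xpredT (fun x => 'X - x%:P)).
rewrite -(big_map r xpredT (fun x => 'X - x%:P)) => /prod_XsubC_eq e.
by rewrite -(big_map r' xpredT (fun x => x ^+ k)) (perm_big _ e) big_map.
Qed.

(** The Hankel matrix of the power sums is a Vandermonde matrix times its transpose. *)
Lemma disc_mxE S r : char_poly S = \prod_i ('X - (r i)%:P) ->
  disc_mx S = (\prod_(i < n.+1) \prod_(j < n.+1 | (i < j)%N) (r j - r i)) ^+ 2.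
Proof.
move=> Sr; have := det_Vandermonde (\row_i r i).
under eq_bigr do under eq_bigr do rewrite !mxE.
move=> <-; rewrite expr2 -{2}det_tr -det_mulmx; congr (\det _).
apply/matrixP => i j; rewrite !mxE (mxtraceX _ Sr).
by apply: eq_bigr => l _; rewrite !mxE exprD.
Qed.

Lemma disc_mx_neq0P S r : char_poly S = \prod_i ('X - (r i)%:P) ->
  reflect (injective r) (disc_mx S != 0).
Proof.
move=> /disc_mxE ->; rewrite expf_eq0 /=; apply: (iffP idP) => [nz | inj].
  move=> i j eij; apply/eqP; apply: contraNT nz => nij.
  wlog lt_ij : i j eij nij / (i < j)%N => [W|].
    by case: (ltngtP i j) => [/W|/W|/val_inj eq]; [apply|apply; rewrite // eq_sym
       |rewrite eq eqxx in nij].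
  by rewrite (bigD1 i) //= (bigD1 j) //= eij subrr !mul0r.
rewrite prodf_seq_neq0; apply/allP => i _; rewrite prodf_seq_neq0.
apply/allP => j _; apply/implyP => lt_ij; rewrite subr_eq0 (inj_eq inj).
by rewrite -val_eqE /= gtn_eqF.
Qed.

End ClosedField.

Lemma disc_mx_diag_neq0 (K : numClosedFieldType) n (d : 'I_n.+1 -> K) : disc_mx (diag_mx (\row_a d a)) != 0 <->
  injective d.
Proof.
have chp : char_poly (diag_mx (\row_a d a)) = \prod_a ('X - (d a)%:P).
  rewrite char_poly_trig ?diag_mx_is_trig //; apply: eq_bigr => a _.
  by rewrite !mxE eqxx mulr1n.
by split=> [|] /(disc_mx_neq0P chp).
Qed.

Lemma poly_ext (K : numDomainType) (p q : {poly K}) :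
  (forall z, p.[z] = q.[z]) -> p = q.
Proof.
move=> eq_pq; apply/eqP; rewrite -subr_eq0; apply/negPn/negP => nz.
have := @max_poly_roots _ (p - q) [seq i%:R | i <- iota 0 (size (p - q))] nz.
rewrite size_map size_iota ltnn => H; apply/notF/H.
  by apply/allP => x _; rewrite rootE hornerD hornerN eq_pq subrr.
by rewrite map_inj_uniq ?iota_uniq // => i j /eqP; rewrite eqr_nat => /eqP.
Qed.

Lemma horner_char_poly (R : comNzRingType) n (S : 'M[R]_n) z :
  (char_poly S).[z] = \det (z%:M - S).
Proof.
rewrite -[LHS]/(horner_eval z _) -det_map_mx; congr (\det _).
apply/matrixP => i j; rewrite /char_poly_mx !mxE.
by rewrite rmorphB rmorphMn /= /horner_eval hornerX hornerC.
Qed.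

(** Each index lies in exactly [n] of the pairs i < j. *)
Lemma prod_ltn_pair (R : comNzRingType) n (h : 'I_n.+1 -> R) :
  \prod_(i < n.+1) \prod_(j < n.+1 | (i < j)%N) (h i * h j) =
  (\prod_i h i) ^+ n.
Proof.
rewrite (eq_bigr _ (fun i _ => big_split _ _ _ _ _)) big_split /= [X in _ * X](exchange_big_dep xpredT) //= -big_split /=.
rewrite -prodrXl; apply: eq_bigr => i _.
have prodc (P : pred 'I_n.+1) : \prod_(j | P j) h i = h i ^+ #|P| by exact: prodr_const.
rewrite !prodc -exprD; congr (_ ^+ _).
transitivity #|predC1 i|; last by rewrite cardC1 card_ord.
set P := fun j => _; set Q := fun j => _.
have PQ0 : #|predI P Q| = 0%N.
  by apply: eq_card0 => j; apply/negbTE; rewrite !inE /P /Q; case: (ltngtP i j).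
rewrite -cardUI PQ0 addn0.
by apply: eq_card => j; rewrite !inE /P /Q -val_eqE /= neq_ltn orbC.
Qed.

(** * Pencils of matrices under change of basis and congruence *)

Section Pencil.
Variables (K : numClosedFieldType) (n : nat).
Implicit Types (A B S : 'M[K]_n.+1) (r : 'I_n.+1 -> K).

Lemma det_split S r x y : char_poly S = \prod_i ('X - (r i)%:P) ->
  \det (x%:M + y *: S) = \prod_i (x + y * r i).
Proof.
move=> Sr; have [->|nzy] := eqVneq y 0.
  by rewrite scale0r addr0 det_scalar; under [RHS]eq_bigr do rewrite mul0r addr0;
    rewrite prodr_const card_ord.
have := horner_char_poly S (- x / y); rewrite Sr horner_prod.
under eq_bigr do rewrite hornerXsubC.
move=> e; have -> : x%:M + y *: S = (- y) *: ((- x / y)%:M - S).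
  rewrite scalerBr scale_scalar_mx scaleNr opprK; congr (_%:M + _).
  by rewrite mulrA mulNr mulrN opprK mulrAC divff // mul1r.
rewrite detZ -e -[X in _ ^+ X]card_ord -prodr_const -big_split /=.
apply: eq_bigr => i _; field; exact: nzy.
Qed.

(** An eigenvalue r becomes (c + d r) / (a + b r). The difference of two eigenvalues is multiplied
    by a d - b c and divided by both denominators; each denominator occurs in n pairs, hence 2 n
    times in the squared product. *)
Lemma disc_mx_mobius S a b c d : \det (a%:M + b *: S) != 0 ->
  disc_mx (invmx (a%:M + b *: S) *m (c%:M + d *: S)) *
    \det (a%:M + b *: S) ^+ (2 * n) = (a * d - b * c) ^+ (n.+1 * n) * disc_mx S.
Proof.
have [r Sr _] := char_poly_split S; rewrite (det_split _ _ Sr) => nz.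
have nzr i : a + b * r i != 0.
  by move: nz; rewrite prodf_seq_neq0 => /allP /(_ i); rewrite mem_index_enum => /(_ isT).
have uM : a%:M + b *: S \in unitmx.
  by rewrite unitmxE (det_split _ _ Sr) unitfE.
set T := invmx _ *m _.
pose r' i := (c + d * r i) / (a + b * r i).
have Tr : char_poly T = \prod_i ('X - (r' i)%:P).
  apply: poly_ext => z; rewrite horner_char_poly horner_prod.
  have -> : z%:M - T = invmx (a%:M + b *: S) *m ((z * a - c)%:M + (z * b - d) *: S).
    rewrite /T -[z%:M](mulKmx uM) -mulmxBr mul_mx_scalar; congr (_ *m _).
    by apply/matrixP => i j; rewrite !mxE; ring.
  rewrite det_mulmx det_inv !(det_split _ _ Sr) -prodfV -big_split /=.
  apply: eq_bigr => i _; rewrite hornerXsubC /r'; field; exact: nzr.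
rewrite (disc_mxE Tr) (disc_mxE Sr).
rewrite exprM exprAC -exprMn -prod_ltn_pair -big_split /=.
have -> : (a * d - b * c) ^+ (n.+1 * n) =
    (\prod_(i < n.+1) \prod_(j < n.+1 | (i < j)%N) (a * d - b * c)) ^+ 2.
  have := prod_ltn_pair (fun i : 'I_n.+1 => a * d - b * c).
  rewrite prodr_const card_ord -exprM => <-.
  by rewrite -prodrXl; apply: eq_bigr => i _; rewrite -prodrXl; apply: eq_bigr.
rewrite -exprMn -big_split /=; congr (_ ^+ 2).
apply: eq_bigr => i _; rewrite -!big_split; apply: eq_bigr => j _ /=.
rewrite /r'; field; apply/andP; split; exact: nzr.
Qed.

(* Both sides are multiples of [disc_mx (A^-1 B)]; the matrix [\adj A *m B] is used
   because it is a polynomial in A and B. *)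
Lemma disc_pencil A B a b c d : \det A != 0 -> \det (a *: A + b *: B) != 0 ->
  disc_mx (\adj (a *: A + b *: B) *m (c *: A + d *: B)) * \det A ^+ (n * n.-1) =
  (a * d - b * c) ^+ (n.+1 * n) * \det (a *: A + b *: B) ^+ (n * n.-1) *
    disc_mx (\adj A *m B).
Proof.
move=> nzA nzA'; have uA : A \in unitmx by rewrite unitmxE unitfE.
set A' := a *: A + b *: B; have uA' : A' \in unitmx by rewrite unitmxE unitfE.
have adjE (M N : 'M[K]_n.+1) : M \in unitmx ->
    disc_mx (\adj M *m N) = \det M ^+ (n.+1 * n) * disc_mx (invmx M *m N).
  move=> uM; have -> : \adj M = \det M *: invmx M.
    by rewrite /invmx uM scalerA divrr ?scale1r // -unitmxE.
  by rewrite -scalemxAl disc_mxZ.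
set S := invmx A *m B.
have eM x y : x *: A + y *: B = A *m (x%:M + y *: S).
  by rewrite mulmxDr mul_mx_scalar -scalemxAr mulKVmx.
have dA' : \det A' = \det A * \det (a%:M + b *: S) by rewrite /A' eM det_mulmx.
have nzM : \det (a%:M + b *: S) != 0.
  by apply: contraNneq nzA' => e; rewrite -/A' dA' e mulr0.
have := disc_mx_mobius c d nzM; rewrite !adjE // dA' -/S.
have -> : invmx A' *m (c *: A + d *: B) =
    invmx (a%:M + b *: S) *m (c%:M + d *: S).
  rewrite {1}/A' !eM.
  have uM : (a%:M + b *: S) \in unitmx by rewrite unitmxE unitfE.
  have uAM : A *m (a%:M + b *: S) \in unitmx by rewrite unitmx_mul uA.
  by apply: (can_inj (mulKmx uAM)); rewrite mulKVmx // -mulmxA mulKVmx.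
set D' := disc_mx _; set D := disc_mx S; set x := \det A; set y := \det _.
(* Of the n (n + 1) factors det A brought by the adjugate, 2 n belong to the discriminant of the
   binary form det (s A + t B) and n (n - 1) are in excess. *)
have -> : (n.+1 * n = 2 * n + n * n.-1)%N by case: (n) => // k /=; lia.
set p := (2 * n)%N; set q := (n * n.-1)%N; set z := _ ^+ (p + q); move=> e.
rewrite !exprMn (exprD x) (exprD y).
transitivity (x ^+ p * x ^+ q * x ^+ q * y ^+ q * (D' * y ^+ p)); first by ring.
by rewrite e; ring.
Qed.

(** The congruence replaces [\adj A *m B] by det(g)^2 times a conjugate of it. *)
Lemma disc_pencil_congr A B g : A \in unitmx -> g \in unitmx ->
  disc_mx (\adj (g *m A *m g^T) *m (g *m B *m g^T)) =
  \det g ^+ (2 * (n.+1 * n)) * disc_mx (\adj A *m B).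
Proof.
move=> uA ug; have ugT : g^T \in unitmx by rewrite unitmx_tr.
have adjE (M : 'M[K]_n.+1) : M \in unitmx -> \adj M = \det M *: invmx M.
  by move=> uM; rewrite /invmx uM scalerA divrr ?scale1r // -unitmxE.
rewrite !adjE ?unitmx_mul ?uA ?ug //.
have -> : \det (g *m A *m g^T) *: invmx (g *m A *m g^T) *m (g *m B *m g^T) =
    (\det g ^+ 2) *: (invmx g^T *m (\det A *: invmx A *m B) *m invmx (invmx g^T)).
  rewrite invmxK -!scalemxAl -!scalemxAr -!scalemxAl scalerA.
  congr (_ *: _); first by rewrite !det_mulmx det_tr; ring.
  have uN : g *m A *m g^T \in unitmx by rewrite !unitmx_mul ug uA.
  apply: (can_inj (mulKmx uN)); rewrite mulKVmx //.
  by rewrite -!mulmxA (mulKVmx ugT) (mulKVmx uA).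
by rewrite disc_mxZ disc_mx_conj ?unitmx_inv // -exprM.
Qed.

End Pencil.

(** * Double roots of the discriminant at derogatory matrices *)

Lemma horner_mx_sum (R : comNzRingType) n (S : 'M[R]_n.+1) (g : {poly R}) m :
  (size g <= m)%N -> horner_mx S g = \sum_(l < m) g`_l *: S ^+ l.
Proof.
move=> le_m; rewrite -[g in LHS]coefK poly_def raddf_sum.
rewrite (big_ord_widen _ (fun l => horner_mx S (g`_l *: 'X^l)) le_m) big_mkcond.
apply: eq_bigr => l _; case: ifP => [_|/negbT].
  by rewrite horner_mxZ rmorphXn /= horner_mx_X.
by rewrite -leqNgt => /leq_sizeP /(_ l (leqnn l)) ->; rewrite scale0r.
Qed.

Section SecondOrder.
Variables (K : fieldType) (n : nat) (S0 T : 'M[K]_n.+1) (g : {poly K}).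
Hypotheses (g_monic : g \is monic) (size_g : size g = n.+1).
Hypothesis gS0 : horner_mx S0 g = 0.

Definition line_mx := map_mx polyC S0 + 'X *: map_mx polyC T.

Lemma horner_line_mx a : map_mx (horner_eval a) line_mx = S0 + a *: T.
Proof.
apply/matrixP => i j; rewrite !mxE /horner_eval hornerD hornerM hornerX.
by rewrite !hornerC.
Qed.

Definition line_quo := map_mx (fun p => p %/ 'X) (horner_mx line_mx (map_poly polyC g)).

Lemma line_quoE : horner_mx line_mx (map_poly polyC g) = 'X *: line_quo.
Proof.
apply/matrixP => i j; rewrite !mxE mulrC divpK //.
rewrite -['X]subr0 -polyC0 dvdp_XsubCl; apply/eqP.
have := gS0; have {1}-> : g = map_poly (horner_eval 0) (map_poly polyC g).
  by rewrite -map_poly_comp map_poly_id // => x _; rewrite /= /horner_eval hornerC.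
have e : S0 = map_mx (horner_eval 0) line_mx by rewrite horner_line_mx scale0r addr0.
by rewrite [X in horner_mx X]e -map_horner_mx => /matrixP /(_ i j); rewrite !mxE.
Qed.

(* Completing [1, S, ..., S^(n-1)] by [g(S)] instead of [S^n] is a unimodular change of
   basis, and [g(S)] is divisible by X. *)
Lemma disc_line_mx : disc_mx line_mx = 'X^2 *
  \det (\matrix_(i < n.+1, j < n.+1)
    \tr ((if (i < n)%N then line_mx ^+ i else line_quo) *m
         (if (j < n)%N then line_mx ^+ j else line_quo))).
Proof.
set S := line_mx; set N := line_quo.
pose U := \matrix_(i < n.+1, l < n.+1)
  (if (i < n)%N then (i == l)%:R else (g`_l)%:P : {poly K}).
pose D := \row_(i < n.+1) (if (i < n)%N then 1 else 'X : {poly K}).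
have detU : \det U = 1.
  rewrite det_trig.
    apply: big1 => i _; rewrite !mxE eqxx; case: ltnP => // le_ni.
    have -> : (i : nat) = n by apply/eqP; rewrite eqn_leq le_ni -ltnS ltn_ord.
    by have := monicP g_monic; rewrite /lead_coef size_g => ->.
  apply/is_trig_mxP => i j lt_ij; rewrite mxE.
  have -> : (i < n)%N by rewrite (leq_trans lt_ij) // -ltnS ltn_ord.
  by rewrite -val_eqE /= ltn_eqF.
have detD : \det (diag_mx D) = 'X.
  rewrite det_diag big_ord_recr /= big1 ?mul1r => [|i _]; first by rewrite mxE ltnn.
  by rewrite mxE /= ltn_ord.
have PhiE (i : 'I_n.+1) : \sum_l U i l *: S ^+ l =
    D 0 i *: (if (i < n)%N then S ^+ i else N).
  rewrite !mxE; case: ltnP => lt_in.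
    rewrite (bigD1 i) //= mxE lt_in eqxx big1 ?addr0 // => l nli.
    by rewrite mxE lt_in eq_sym (negbTE nli) scale0r.
  rewrite -line_quoE (@horner_mx_sum _ _ _ _ n.+1).
    by apply: eq_bigr => l _; rewrite mxE ltnNge lt_in /= coef_map.
  by rewrite size_map_polyC size_g.
set Th := \matrix_(i, j) _.
have -> : 'X^2 * \det Th = \det (diag_mx D *m Th *m diag_mx D).
  by rewrite !det_mulmx detD expr2; ring.
have -> : disc_mx S = \det (U *m (\matrix_(i, j) \tr (S ^+ (i + j))) *m U^T).
  by rewrite !det_mulmx det_tr detU mulr1 mul1r.
congr (\det _); apply/matrixP => i j.
rewrite mul_mx_diag mul_diag_mx mxE [RHS]mxE [in RHS]mxE mxE.
transitivity (\tr ((\sum_l U i l *: S ^+ l) *m (\sum_l U j l *: S ^+ l))).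
  rewrite mulmx_sumr raddf_sum; apply: eq_bigr => l _.
  rewrite mxE -scalemxAr /= mxtraceZ mulmx_suml raddf_sum /= mulrC mxE.
  congr (_ * _); apply: eq_bigr => l' _.
  by rewrite -scalemxAl mxtraceZ mulmxE -exprD mxE.
rewrite !PhiE -scalemxAl -scalemxAr !mxtraceZ !mxE; ring.
Qed.

End SecondOrder.

Section DerogatoryMatrices.
Variable K : fieldType.

(* With S - a = L *m M of rank r, [(X - a) * p] evaluated at S is L *m p(M L + a) *m M,
   so p can be taken to be the characteristic polynomial of the r x r matrix M L + a. *)
Lemma annihilator_of_corank n (S : 'M[K]_n.+1) a : (\rank (S - a%:M)%R < n)%N ->
  exists g : {poly K}, [/\ g \is monic, size g = n.+1 & horner_mx S g = 0].
Proof.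
set T := S - a%:M => rkT; have ST : S = T + a%:M by rewrite /T subrK.
have [r0|r_gt0] := posnP (\rank T).
  have T0 : T = 0 by apply/eqP; rewrite -mxrank_eq0 r0.
  exists (('X - a%:P) * 'X^(n.-1)); split.
  - by rewrite monicMl ?monicXsubC ?monicXn.
  - rewrite size_Mmonic ?monicXn ?polyXsubC_eq0 // size_XsubC size_polyXn /=.
    by rewrite prednK //; apply: leq_ltn_trans rkT.
  - by rewrite rmorphM rmorphB /= horner_mx_X horner_mx_C -/T T0 mul0r.
have TE : T = col_base T *m row_base T by rewrite mulmx_base.
have [r [Lr [Mr [TEr rkr]]]] : exists r (L' : 'M[K]_(n.+1, r.+1)) (M' : 'M[K]_(r.+1, n.+1)),
    T = L' *m M' /\ (r.+1 < n)%N.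
  move: TE rkT; case: (\rank T) r_gt0 (col_base T) (row_base T) => // r _ L M.
  by exists r, L, M.
pose q := char_poly (Mr *m Lr + a%:M).
have Hp p : horner_mx S (('X - a%:P) * p) = Lr *m horner_mx (Mr *m Lr + a%:M) p *m Mr.
  elim/poly_ind: p => [|p c IH]; first by rewrite mulr0 !rmorph0 mulmx0 mul0mx.
  rewrite mulrDr mulrA rmorphD rmorphM /= IH horner_mx_X rmorphM /=.
  rewrite rmorphB /= horner_mx_X !horner_mx_C -/T {1}ST.
  rewrite rmorphD rmorphM /= horner_mx_X horner_mx_C -!mulmxE.
  rewrite TEr !(mulmxDr, mulmxDl) !mulmxA; congr (_ + _ + _).
    by rewrite !mul_mx_scalar -!scalemxAl.
  by rewrite !mul_mx_scalar -!scalemxAl.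
exists (('X - a%:P) * (q * 'X^(n.-1 - r.+1))).
have q_monic : q \is monic by apply: char_poly_monic.
split.
- by rewrite monicMl ?monicXsubC // monicMl ?monicXn.
- rewrite size_Mmonic ?polyXsubC_eq0 ?size_XsubC //; last by rewrite monicMl ?monicXn.
  rewrite size_Mmonic ?monicXn ?monic_neq0 // size_polyXn size_char_poly /=.
  by move: rkr; lia.
- by rewrite Hp rmorphM /= Cayley_Hamilton mul0r mulmx0 mul0mx.
Qed.

Lemma disc_line_mx_corank n (S T : 'M[K]_n.+1) a : (\rank (S - a%:M)%R < n)%N ->
  'X^2 %| disc_mx (line_mx S T).
Proof.
move=> /annihilator_of_corank [g [g_monic sg gS]].
by rewrite (disc_line_mx T g_monic sg gS) dvdp_mulr.
Qed.

End DerogatoryMatrices.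

(** * Formal degrees and top coefficients *)

Section TopCoefficient.
Variable R : comNzRingType.
Implicit Types p q : {poly R}.

(** Here [d] is only a formal degree: [c] may be zero, which keeps the notion stable under sums and
    products over any ring. *)
Definition top_coef p d c := (size p <= d.+1)%N /\ p`_d = c.

Lemma top_coefM p q d d' c c' : top_coef p d c -> top_coef q d' c' ->
  top_coef (p * q) (d + d') (c * c').
Proof.
move=> [sp <-] [sq <-]; split.
  by apply: leq_trans (size_polyMleq _ _) _; move: sp sq; lia.
have lt_d : (d < (d + d').+1)%N by rewrite ltnS leq_addr.
rewrite coefM (bigD1 (Ordinal lt_d)) //= addKn big1 ?addr0 // => i.
rewrite -val_eqE /= => nid; case: (ltngtP i d) nid => // [lt_id|lt_di] _.
  by rewrite [q`__]nth_default ?mulr0 //; apply: leq_trans sq _; lia.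
by rewrite nth_default ?mul0r //; apply: leq_trans sp _.
Qed.

Lemma top_coef_sum (I : finType) (p : I -> {poly R}) d (c : I -> R) :
  (forall i, top_coef (p i) d (c i)) -> top_coef (\sum_i p i) d (\sum_i c i).
Proof.
move=> H; split; last by rewrite coef_sum; apply: eq_bigr => i _; case: (H i).
apply: leq_trans (size_sum _ _ _) _; apply/bigmax_leqP => i _.
by case: (H i).
Qed.

Lemma top_coefC c : top_coef c%:P 0 c.
Proof. by rewrite /top_coef size_polyC coefC; split; case: eqP. Qed.

Lemma top_coef_prod (I : finType) (p : I -> {poly R}) d (c : I -> R) :
  (forall i, top_coef (p i) (d i) (c i)) ->
  top_coef (\prod_i p i) (\sum_i d i) (\prod_i c i).
Proof.
move=> H; elim/big_ind3 : _ => //; first exact: top_coefC.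
by move=> *; apply: top_coefM.
Qed.

(** The entry (i, j) of the Hankel matrix has formal degree i + j, and every permutation s gives the
    same total, the sum of all i + s i. *)
Lemma top_coef_disc n (S T : 'M[R]_n.+1) :
  top_coef (disc_mx (map_mx polyC S + 'X *: map_mx polyC T)) (n.+1 * n) (disc_mx T).
Proof.
set M := _ + _.
have HM k i j : top_coef ((M ^+ k) i j) k ((T ^+ k) i j).
  elim: k i j => [|k IH] i j.
    rewrite !expr0 !mxE; case: (i == j); [exact: (top_coefC 1)|exact: (top_coefC 0)].
  rewrite !exprS -!mulmxE !mxE; apply: top_coef_sum => l.
  rewrite -[k.+1]add1n; apply: top_coefM => //; rewrite !mxE; split.
    apply: leq_trans (size_polyD _ _) _; rewrite geq_max.
    rewrite (leq_trans (size_polyC_leq1 _)) // mulrC.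
    by apply: leq_trans (size_polyMleq _ _) _; rewrite size_polyX addnC /=; apply: size_polyC_leq1.
  by rewrite coefD coefXM !coefC /= add0r.
have -> : (n.+1 * n = \sum_(i < n.+1) i + \sum_(i < n.+1) i)%N.
  rewrite -(big_mkord xpredT id) triangular_sum addnn bin2 even_halfK //.
  by rewrite oddM /= andNb.
apply: top_coef_sum; move=> /= s0; have [s ->] : exists s : {perm 'I_n.+1}, s0 = s by exists s0.
rewrite -[(_ + _)%N]add0n; apply: top_coefM.
  by have := top_coefC ((-1) ^+ odd_perm s); rewrite rmorphXn /= polyCN.
have -> : (\sum_(i < n.+1) i + \sum_(i < n.+1) i = \sum_(i < n.+1) (i + s i))%N.
  by rewrite big_split /=; congr (_ + _)%N; apply: reindex_inj; apply: perm_inj.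
apply: top_coef_prod => i; rewrite !mxE.
exact: top_coef_sum.
Qed.

End TopCoefficient.

(** * Separable polynomials over a domain *)

Section Specialization.
Variables (R : idomainType) (K : numFieldType) (h : {rmorphism R -> K}).
Implicit Types p q : {poly R}.

Lemma coprimep_Bezout_const p q : coprimep p q ->
  exists u v c, c != 0 /\ u * p + v * q = c%:P.
Proof.
move=> /Pdiv.Idomain.Bezout_coprimepP [[u v] /=].
rewrite -size_poly_eq1 => /size_poly1P [c nzc e].
by exists u, v, c.
Qed.

(** When both leading coefficients survive, the Sylvester matrix keeps its size and the resultant
    commutes with [h]. *)
Lemma coprimep_of_map p q :
  h (lead_coef p) != 0 -> h (lead_coef q) != 0 ->
  coprimep (map_poly h p) (map_poly h q) -> coprimep p q.
Proof.
move=> nzp nzq cop; rewrite /coprimep eqn_leq leqNgt -resultant_eq0.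
have -> : resultant p q != 0.
  apply: contraTneq cop => r0; rewrite /coprimep neq_ltn -resultant_eq0.
  apply/orP; right; move/(congr1 h): r0; rewrite rmorph0 => <-; apply/eqP/esym.
  rewrite /resultant /Sylvester_mx !size_map_poly_id0 // -det_map_mx /= map_col_mx.
  congr (\det (col_mx _ _));
    by apply: map_lin1_mx => v; rewrite map_poly_rV rmorphM /= map_rVpoly.
by rewrite size_poly_gt0 gcdp_eq0; apply: contraNN nzp => /andP[/eqP -> _];
   rewrite lead_coef0 rmorph0.
Qed.

(** In characteristic 0 the leading coefficient of the derivative survives together with that of
    [p], so coprimality can be tested after applying [h]. *)
Lemma separable_poly_of_map p : h (lead_coef p) != 0 ->
  separable_poly (map_poly h p) -> separable_poly p.
Proof.
move=> nzl; rewrite !separable_poly.unlock deriv_map.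
have [->|nzp'] := eqVneq p^`() 0.
  rewrite map_poly0 /coprimep !gcdp0 size_map_poly_id0 //.
apply: coprimep_of_map => //.
have p_gt1 : (1 < size p)%N.
  by rewrite ltnNge; apply: contraNN nzp' => /size1_polyC ->; rewrite derivC.
have nzc : h p^`()`_(size p).-2 != 0.
  rewrite coef_deriv; case sp: (size p) p_gt1 => [|[|m]] // _ /=.
  have -> : p`_m.+1 = lead_coef p by rewrite /lead_coef sp.
  by rewrite rmorphMn -mulr_natr mulf_neq0 // pnatr_eq0.
suff -> : lead_coef p^`() = p^`()`_(size p).-2 by [].
rewrite /lead_coef; congr (_`_ _); apply/eqP; rewrite eqn_leq; apply/andP; split.
  rewrite -!subn1 leq_sub2r // -ltnS (leq_trans (lt_size_deriv _)) ?subn1 ?leqSpred //.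
  by apply: contraTneq p_gt1 => ->; rewrite size_poly0.
rewrite -ltnS [X in (_ < X)%N]prednK ?size_poly_gt0 // ltnNge.
by apply: contraNN nzc => le; rewrite nth_default ?rmorph0.
Qed.
End Specialization.

(** A Bezout relation without denominators has a nonzero constant on its right-hand side;
    separability persists wherever this constant does not vanish. *)
Lemma map_separable_poly (R : idomainType) (p : {poly R}) : separable_poly p ->
  exists2 c, c != 0 & forall (K : fieldType) (h : {rmorphism R -> K}),
    h c != 0 -> separable_poly (map_poly h p).
Proof.
rewrite separable_poly.unlock => /coprimep_Bezout_const [u [v [c [nzc e]]]].
exists c => // K h nzhc; rewrite deriv_map.
apply/Bezout_coprimepP; exists (map_poly h u, map_poly h v) => /=.
by rewrite -!rmorphM -rmorphD /= e map_polyC /= -size_poly_eq1 size_polyC nzhc.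
Qed.

(** * A pencil of matrices with separable discriminant *)

Section DoubleEigenvalue.
Variables (K : fieldType) (n : nat) (d : 'I_n.+2 -> K) (i j : 'I_n.+2).
Variable T : 'M[K]_n.+2.
Hypotheses (nij : i != j) (dij : d i = d j) (symT : T^T = T).
Hypothesis d_inj : forall a b, a != j -> b != j -> d a = d b -> a = b.

Let S0 := diag_mx (\row_a d a).
Let g := \prod_(a | a != j) ('X - (d a)%:P).
Let g1 := \prod_(a | (a != j) && (a != i)) ('X - (d a)%:P).

Let gE : g = ('X - (d i)%:P) * g1.
Proof. by rewrite /g (bigD1 i). Qed.

Lemma double_eigen_monic : g \is monic.
Proof. exact: monic_prod_XsubC. Qed.

Lemma double_eigen_size : size g = n.+2.
Proof.
by rewrite /g -big_filter size_prod_XsubC -sum1_size big_filter sum1_card cardC1 card_ord.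
Qed.

Lemma double_eigen_horner : horner_mx S0 g = 0.
Proof.
rewrite horner_mx_diag; apply/matrixP => a b; rewrite !mxE.
have [eab|] := eqVneq a b; last by rewrite mulr0n.
suff -> : g.[d a] = 0 by rewrite mul0rn.
have [->|naj] := eqVneq a j; first by rewrite gE hornerM hornerXsubC dij subrr mul0r.
by rewrite /g (bigD1 a) //= hornerM hornerXsubC subrr mul0r.
Qed.

Let S := line_mx S0 T.
Let N := line_quo S0 T g.
Let N0 := map_mx (horner_eval 0) N.
Let XN : horner_mx S (map_poly polyC g) = 'X *: N.
Proof. exact: line_quoE double_eigen_horner. Qed.

Let S_at0 : map_mx (horner_eval 0) S = S0.
Proof. by rewrite horner_line_mx scale0r addr0. Qed.

(** Being g(S) / X, the matrix N commutes with S; at 0 this makes N0 commute with the diagonal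
    matrix S0. *)
Let N0_diag a b : d a != d b -> N0 a b = 0.
Proof.
move=> nab; have comm : N *m S = S *m N.
  have XI (M1 M2 : 'M[{poly K}]_n.+2) : 'X *: M1 = 'X *: M2 -> M1 = M2.
    move=> /matrixP e; apply/matrixP => x y; have := e x y; rewrite !mxE.
    by apply/mulfI; rewrite polyX_eq0.
  apply: XI; rewrite [LHS]scalemxAl [RHS]scalemxAr -XN; exact: comm_horner_mx.
have := congr1 (fun M : 'M[_]_n.+2 => M a b) (congr1 (map_mx (horner_eval 0)) comm).
rewrite !map_mxM /= S_at0 -/N0 mul_mx_diag mul_diag_mx !mxE => /eqP.
by rewrite mulrC -subr_eq0 -mulrBl mulf_eq0 subr_eq0 eq_sym (negbTE nab) => /eqP.
Qed.

(** In g(S) = (S - d_i) g1(S), the rows of S - d_i belonging to the double eigenvalue are X times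
    those of T, and g1(S0) is diagonal. *)
Let N0_block a b : d a = d i -> d b = d i -> N0 a b = T a b * g1.[d i].
Proof.
move=> da db.
have : 'X *: N = (S - (d i)%:P%:M) *m horner_mx S (map_poly polyC g1).
  rewrite -XN gE rmorphM rmorphB /= map_polyX map_polyC /=.
  by rewrite rmorphM rmorphB /= horner_mx_X horner_mx_C.
move=> /(congr1 (fun M : 'M[_]_n.+2 => M a b)); rewrite !mxE.
have -> : \sum_c (S - (d i)%:P%:M) a c * horner_mx S (map_poly polyC g1) c b =
    'X * \sum_c (T a c)%:P * horner_mx S (map_poly polyC g1) c b.
  rewrite mulr_sumr; apply: eq_bigr => c _; rewrite !mxE da.
  by case: (a == c); rewrite ?mulr1n ?mulr0n; ring.
move=> /(mulfI (negbT (polyX_eq0 _))) e.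
have g1S c : (horner_mx S (map_poly polyC g1) c b).[0] = g1.[d b] *+ (c == b).
  have -> : (horner_mx S (map_poly polyC g1) c b).[0] = horner_mx S0 g1 c b.
    rewrite -S_at0; have {2}-> : g1 = map_poly (horner_eval 0) (map_poly polyC g1).
      by rewrite -map_poly_comp map_poly_id // => x _; rewrite /= /horner_eval hornerC.
    by rewrite -map_horner_mx mxE.
  rewrite horner_mx_diag !mxE; case: eqP => [->|]; by rewrite ?mulr1n ?mulr0n.
rewrite /horner_eval e horner_sum (bigD1 b) //= big1 ?addr0 => [|c ncb].
  by rewrite hornerM hornerC g1S eqxx db.
by rewrite hornerM g1S (negbTE ncb) mulr0.
Qed.

Let kappa := g1.[d i].

Lemma double_eigen_kappa : kappa != 0.
Proof.
rewrite /kappa /g1 horner_prod prodf_seq_neq0; apply/allP => a _.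
apply/implyP => /andP[naj nai]; rewrite hornerXsubC subr_eq0.
by apply: contraNneq nai => e; apply/eqP/d_inj.
Qed.

(** The cofactor of X^2 in the discriminant of S0 + X T, as produced by [disc_line_mx]. *)
Definition double_eigen_theta :=
  \det (\matrix_(a < n.+2, b < n.+2)
    \tr ((if (a < n.+1)%N then S ^+ a else N) *m
         (if (b < n.+1)%N then S ^+ b else N))).

Variables mu1 mu2 : K.
Hypotheses (tr1 : mu1 + mu2 = T i i + T j j)
  (tr2 : mu1 ^+ 2 + mu2 ^+ 2 = T i i ^+ 2 + T j j ^+ 2 + 2 * T i j ^+ 2).

(* Only the trace and the trace of the square of the block of N0 matter, so the block
   can be replaced by the diagonal matrix of its eigenvalues. *)
Let nu a := if a == i then kappa * mu1 else if a == j then kappa * mu2 else N0 a a.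
Let W := \matrix_(a < n.+2, b < n.+2) (if (a < n.+1)%N then d b ^+ a else nu b).

(** As for the discriminant itself, the matrix of traces at 0 is W W^T: the powers of S become
    diagonal at 0, and so does N outside the block, which enters only through its traces. *)
Lemma double_eigen_theta0 : double_eigen_theta.[0] = \det W ^+ 2.
Proof.
rewrite expr2 -{2}det_tr -det_mulmx /double_eigen_theta.
rewrite -[LHS]/(horner_eval 0 _) -det_map_mx; congr (\det _).
apply/matrixP => a b; rewrite !mxE -trace_map_mx map_mxM /=.
have PsiE (c : 'I_n.+2) : map_mx (horner_eval 0) (if (c < n.+1)%N then S ^+ c else N) =
    if (c < n.+1)%N then diag_mx (\row_l d l ^+ c) else N0.
  case: ifP => // _; rewrite rmorphXn /= S_at0.
  elim: (c : nat) => [|k IH].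
    by apply/matrixP => x y; rewrite !mxE expr0.
  rewrite exprS IH -mulmxE; apply/matrixP => x y; rewrite mul_diag_mx !mxE.
  by rewrite exprS mulrnAr.
have sumD (F : 'I_n.+2 -> K) : \sum_l F l =
    F i + F j + \sum_(l | (l != i) && (l != j)) F l.
  by rewrite (bigD1 i) //= (bigD1 j) 1?eq_sym //= addrA.
have nu_i : nu i = kappa * mu1 by rewrite /nu eqxx.
have nu_j : nu j = kappa * mu2 by rewrite /nu eq_sym (negbTE nij) eqxx.
have nu_l l : (l != i) && (l != j) -> nu l = N0 l l.
  by rewrite /nu => /andP[/negbTE -> /negbTE ->].
have lin (e : nat) : \sum_l d l ^+ e * N0 l l = \sum_l d l ^+ e * nu l.
  rewrite !sumD nu_i nu_j -dij !N0_block //= -/kappa; congr (_ + _).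
    by transitivity (d i ^+ e * kappa * (T i i + T j j)); [ring|rewrite -tr1; ring].
  by apply: eq_bigr => l /nu_l ->.
rewrite !PsiE; under [RHS]eq_bigr do rewrite !mxE.
have [lt_a|le_a] := ltnP a n.+1; have [lt_b|le_b] := ltnP b n.+1.
- rewrite /mxtrace; apply: eq_bigr => l _.
  by rewrite mul_diag_mx !mxE eqxx mulr1n.
- rewrite -lin; apply: eq_bigr => l _.
  by rewrite mul_diag_mx !mxE.
- rewrite mxtrace_mulC; under [RHS]eq_bigr do rewrite mulrC.
  rewrite -lin; apply: eq_bigr => l _.
  by rewrite mul_diag_mx !mxE.
- have off l : (l != i) && (l != j) -> (N0 *m N0) l l = N0 l l * N0 l l.
    move=> /andP[nli nlj]; rewrite mxE (bigD1 l) //= big1 ?addr0 // => c ncl.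
    rewrite N0_diag ?mul0r //; apply: contraNneq ncl => e; apply/eqP/esym.
    have [cj|ncj] := eqVneq c j; last exact: d_inj.
    by case/negP: nli; apply/eqP/d_inj => //; rewrite dij e cj.
  have blk c : (c == i) || (c == j) ->
      (N0 *m N0) c c = N0 c i * N0 i c + N0 c j * N0 j c.
    move=> hc; rewrite mxE sumD big1 ?addr0 // => l /andP[nli nlj].
    rewrite N0_diag ?mul0r //; have -> : d c = d i by case/orP: hc => /eqP ->.
    by apply: contraNneq nli => e; apply/eqP/esym/d_inj.
  rewrite /mxtrace !sumD (blk i) ?eqxx // (blk j) ?eqxx ?orbT //.
  rewrite nu_i nu_j !N0_block // -/kappa; congr (_ + _); last first.
    by apply: eq_bigr => l /[dup] /off -> /nu_l ->.
  have -> : T j i = T i j by rewrite -[in LHS]symT mxE.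
  transitivity (kappa ^+ 2 * (T i i ^+ 2 + T j j ^+ 2 + 2 * T i j ^+ 2)); first by ring.
  by rewrite -tr2; ring.
Qed.

(** First-order perturbation: the double eigenvalue splits as d_i + mu1 X and d_i + mu2 X, so the
    discriminant vanishes to order exactly two when mu1 and mu2 differ. In the proof, [W] is a
    Vandermonde matrix completed by the row [nu]. *)
Lemma double_eigen_theta_eq0 : (double_eigen_theta.[0] == 0) = (mu1 == mu2).
Proof.
have nji : j != i by rewrite eq_sym.
rewrite double_eigen_theta0 expf_eq0 /=; apply/idP/eqP => [|e]; last first.
  rewrite -det_tr; apply/eqP/(determinant_alternate nij) => a; rewrite !mxE.
  rewrite /nu !eqxx (negbTE nji) e dij.
  by case: ifP.
move=> /det0P [v nzv vW]; apply/eqP; apply: contraNT nzv => nmu.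
pose c := v 0 ord_max.
pose p := \poly_(a < n.+1) v 0 (inord a).
(* A row vector killed by W is a polynomial p of degree at most n plus a multiple c of nu. Comparing
   columns i and j gives c = 0, and then p has n + 1 distinct roots. *)
have pE b : p.[d b] + c * nu b = 0.
  have := congr1 (fun M : 'rV_n.+2 => M 0 b) vW; rewrite !mxE big_ord_recr /=.
  rewrite mxE /= ltnn => <-; congr (_ + _); rewrite horner_poly.
  apply: eq_bigr => a _; rewrite mxE /= ltn_ord; congr (v 0 _ * _).
  by apply/val_inj; rewrite /= inordK // ltnS ltnW.
have c0 : c = 0.
  have := pE i; have := pE j; rewrite /nu !eqxx (negbTE nji).
  rewrite -dij => ej ei; have /addrI/eqP := etrans ei (esym ej).
  rewrite -subr_eq0 -mulrBr mulf_eq0 => /orP[/eqP //|].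
  by rewrite -mulrBr mulf_eq0 (negbTE double_eigen_kappa) subr_eq0 (negbTE nmu).
have p0 : p = 0.
  apply/eqP/negPn/negP => nzp.
  have := @max_poly_roots _ p [seq d a | a <- enum (predC1 j)] nzp.
  rewrite size_map -cardE cardC1 card_ord /= => H.
  suff : (n.+1 < n.+1)%N by rewrite ltnn.
  apply: leq_trans (size_poly _ _); apply: H.
    by apply/allP => x /mapP[a _ ->]; rewrite rootE -(pE a) c0 mul0r addr0.
  rewrite map_inj_in_uniq ?enum_uniq // => a b; rewrite !mem_enum !inE.
  exact: d_inj.
apply/eqP/rowP => a; rewrite [RHS]mxE.
have [lt_a|le_a] := ltnP a n.+1.
  have := congr1 (fun q : {poly K} => q`_a) p0; rewrite coef_poly lt_a coef0 => <-.
  by congr (v 0 _); apply/val_inj; rewrite /= inordK.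
rewrite -[RHS]c0; congr (v 0 _); apply/val_inj => /=.
by apply/eqP; rewrite eqn_leq le_a -ltnS ltn_ord.
Qed.

End DoubleEigenvalue.

(** Binary expansions are unique. In the diagonal pencil below, this leaves a single pair of equal
    eigenvalues at each root of the discriminant. *)
Lemma pow2_sum_inj a b i j : a != b -> i != j -> a != j -> b != j ->
  (2 ^ a + 2 ^ b)%N != (2 ^ i + 2 ^ j)%N.
Proof.
have small u v : (u < v)%N -> (2 ^ u + 2 ^ u <= 2 ^ v)%N.
  by move=> lt; rewrite addnn -mul2n -expnS leq_pexp2l.
have pos u : (0 < 2 ^ u)%N by rewrite expn_gt0.
wlog lt_ab : a b / (a < b)%N => [W nab nij naj nbj|_ nij naj nbj].
  case: (ltngtP a b) nab => // lt _; first by apply: W => //; rewrite neq_ltn lt.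
  by rewrite addnC; apply: W => //; rewrite neq_ltn lt.
have hab := small _ _ lt_ab.
case: (ltngtP b j) nbj => // [lt_bj|lt_jb] _.
  by have := small _ _ lt_bj; move: (pos a) (pos b) (pos i) (pos j); lia.
have hjb := small _ _ lt_jb.
case: (ltngtP i j) nij => // [lt_ij|lt_ji] _.
  by have := small _ _ lt_ij; move: (pos a) (pos b) (pos i) (pos j); lia.
case: (ltngtP i b) => [lt_ib|lt_bi|->].
- have := small _ _ lt_ib; have := small _ _ lt_ji.
  by move: (pos a) (pos b) (pos i) (pos j); lia.
- have := small _ _ lt_bi.
  by move: (pos a) (pos b) (pos i) (pos j); lia.
- rewrite addnC eqn_add2l; apply: contraNneq naj => e; apply/eqP.
  by apply: (@expnI 2).
Qed.

Lemma horner_disc_pencil (R : comNzRingType) n (A B : 'M[R]_n.+1) r :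
  (disc_mx (map_mx polyC A + 'X *: map_mx polyC B)).[r] = disc_mx (A + r *: B).
Proof.
rewrite -[LHS]/(horner_eval r _) map_disc_mx; congr disc_mx.
apply/matrixP => i j; rewrite !mxE rmorphD rmorphM /= /horner_eval hornerX.
by rewrite !hornerC.
Qed.

Lemma map_disc_pencil (R R' : comNzRingType) (h : {rmorphism R -> R'}) n (A B : 'M[R]_n.+1) :
  map_poly h (disc_mx (map_mx polyC A + 'X *: map_mx polyC B)) =
  disc_mx (map_mx polyC (map_mx h A) + 'X *: map_mx polyC (map_mx h B)).
Proof.
rewrite map_disc_mx; congr disc_mx; apply/matrixP => i j; rewrite !mxE.
by rewrite rmorphD rmorphM /= map_polyX !map_polyC.
Qed.

(** First-order Taylor expansion of a polynomial in two variables along the lines of slope sigma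
    through (s0, 0). *)
Lemma horner_line_coef01 (K : fieldType) (p : {poly {poly K}}) s0 :
  exists z a b, forall sigma,
    let q := p.[s0%:P + sigma *: 'X] in q`_0 = z /\ q`_1 = a + sigma * b.
Proof.
elim/poly_ind: p => [|p c [z [a [b IH]]]].
  by exists 0, 0, 0 => sigma /=; rewrite horner0 !coef0 mulr0 addr0.
exists (z * s0 + c`_0), (a * s0 + c`_1), (b * s0 + z) => sigma /=.
have [e0 e1] := IH sigma; rewrite hornerMXaddC; move: e0 e1.
set q := p.[_] => e0 e1; rewrite mulrDr -scalerAr !coefD !coefZ !coefMC !coefMX /=.
by rewrite e0 e1 mulr0 addr0; split; ring.
Qed.

(** Gauss's lemma at the prime X: as long as X divides [c], it divides [h] or [g] and can be
    cancelled; if it divides [g], its second copy is moved into [h]. *)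
Lemma scale_square_reduce (K : fieldType) (D g h : {poly {poly K}}) (c : {poly K}) :
  c != 0 -> map_poly (horner_eval 0) D != 0 -> c *: D = h * (g * g) ->
  exists (c' : {poly K}) (h' g' : {poly {poly K}}), [/\ c'.[0] != 0, size g' = size g & c' *: D = h' * (g' * g')].
Proof.
move=> nzc nzD; have [m le_m] := ubnP (size c).
elim: m => // m IH in c h g nzc le_m *; move=> e.
have [c0|nzc0] := eqVneq c.[0] 0; last by exists c, h, g.
have divX (p : {poly {poly K}}) : map_poly (horner_eval 0) p = 0 ->
    exists2 p' : {poly {poly K}}, p = 'X%:P * p' & size p' = size p.
  move=> p0; pose p' := \poly_(i < size p) (p`_i %/ 'X).
  have pE : p = 'X%:P * p'.
    apply/polyP => i; rewrite coefCM coef_poly.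
    case: ltnP => [_|le_p]; last by rewrite mulr0 nth_default.
    rewrite mulrC divpK // -['X]subr0 -polyC0 dvdp_XsubCl.
    by have := congr1 (fun q : {poly K} => q`_i) p0; rewrite coef_map coef0 => /eqP.
  by exists p' => //; rewrite [in RHS]pE size_Cmul // polyX_eq0.
have cX : c = 'X * (c %/ 'X).
  by rewrite mulrC divpK // -['X]subr0 -polyC0 dvdp_XsubCl; apply/eqP.
set c1 := c %/ 'X in cX.
have nzc1 : c1 != 0 by apply: contraNneq nzc => z; rewrite cX z mulr0.
have le_c1 : (size c1 < m)%N.
  by rewrite -ltnS (leq_trans _ le_m) // cX mulrC size_mulX.
have nzX : 'X%:P != 0 :> {poly {poly K}} by rewrite polyC_eq0 polyX_eq0.
have : map_poly (horner_eval 0) h * (map_poly (horner_eval 0) g * map_poly (horner_eval 0) g) = 0.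
  by rewrite -!rmorphM -e -mul_polyC rmorphM /= map_polyC /= /horner_eval c0 mul0r.
move=> /eqP; rewrite !mulf_eq0 orbb => /orP[/eqP /divX [h' hE _]|/eqP /divX [g' gE <-]].
  apply: (IH c1 h' g) => //; apply: (mulfI nzX).
  transitivity (h * (g * g)); last by rewrite hE; ring.
  by rewrite -e cX -!mul_polyC polyCM; ring.
apply: (IH c1 ('X%:P * h) g') => //; apply: (mulfI nzX).
transitivity (h * (g * g)); last by rewrite gE; ring.
by rewrite -e cX -!mul_polyC polyCM; ring.
Qed.

Section SeparablePencil.
Variables (K : numClosedFieldType) (n : nat).

(** The eigenvalues x_a^2 + s x_a of Bd + s Cd with indices a and b meet exactly at s = - (x_a +
    x_b), and powers of 2 make these sums distinct for distinct pairs. *)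
Let x (a : 'I_n.+2) : K := (2 ^ a)%:R.
Let Bd := diag_mx (\row_a x a ^+ 2) : 'M[K]_n.+2.
Let Cd := diag_mx (\row_a x a) : 'M[K]_n.+2.
Let J := const_mx 1 : 'M[K]_n.+2.
Let D2 := disc_mx (map_mx polyC (line_mx Bd J) + 'X *: map_mx polyC (map_mx polyC Cd)).

Let x_inj : injective x.
Proof.
move=> a b /eqP; rewrite eqr_nat => /eqP /expnI e.
by apply: val_inj; apply: e.
Qed.

Let nzCd : disc_mx Cd != 0.
Proof. exact/disc_mx_diag_neq0. Qed.

Let mapD2 e : map_poly (horner_eval e) D2 = disc_mx (line_mx (Bd + e *: J) Cd).
Proof.
rewrite /D2 map_disc_pencil horner_line_mx; congr (disc_mx (_ + _ *: map_mx _ _)).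
by apply/matrixP => a b; rewrite !mxE /= /horner_eval hornerC.
Qed.

Let size_disc_Cd (S : 'M[K]_n.+2) : size (disc_mx (line_mx S Cd)) = (n.+2 * n.+1).+1.
Proof.
have [le_k ck] := top_coef_disc S Cd; apply/eqP; rewrite eqn_leq le_k ltnNge.
by apply: contraNN nzCd => le; rewrite -ck nth_default.
Qed.

Let size_D2 : size D2 = (n.+2 * n.+1).+1.
Proof.
have [le_k ck] := top_coef_disc (line_mx Bd J) (map_mx polyC Cd).
apply/eqP; rewrite eqn_leq le_k ltnNge; apply: contraNN nzCd => le.
by rewrite -(polyC_eq0 (disc_mx Cd)) map_disc_mx -ck nth_default.
Qed.

(** On the line s = s0 + sigma e through a point where two eigenvalues meet, the coefficient of e^2
    in the discriminant vanishes exactly when the 2 x 2 block of J + sigma Cd has a double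
    eigenvalue, which happens for two opposite nonzero slopes. A square factor through that point
    would make this coefficient a constant times the square of an affine function of sigma, which
    cannot have two distinct roots without being zero. *)
Lemma separable_perturbation : separable_poly D2.
Proof.
apply/negPn/negP => nsep.
have nzD2 : D2 != 0 by rewrite -size_poly_gt0 size_D2.
have nzD20 : map_poly (horner_eval 0) D2 != 0.
  by rewrite mapD2 -size_poly_gt0 size_disc_Cd.
(* A failure of separability gives a square factor over the fractions in e, and clearing
   denominators gives c. The other possible cause, a nonconstant factor with zero derivative, is
   excluded in characteristic 0. *)
have [c0 [h0 [g0 [nzc0 gt1 e0]]]] : exists (c : {poly K}) (h g : {poly {poly K}}),
    [/\ c != 0, (1 < size g)%N & c *: D2 = h * (g * g)].
  apply: contrapT => nex; case/negP: nsep; apply/separable_polyP; split=> [u v uvD|u uD gt1].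
    rewrite coprimep_def eqn_leq size_poly_gt0 gcdp_eq0 negb_and.
    have nzuv : u * v != 0 by apply: contraNneq nzD2 => z; move: uvD; rewrite z dvd0p.
    move: (nzuv); rewrite mulf_eq0 negb_or => /andP[-> _]; rewrite andbT leqNgt.
    apply/negP => gt1; apply: nex.
    have /Pdiv.Idomain.dvdpP [[c h] /= nzc e] : gcdp u v * gcdp u v %| D2.
      by apply: dvdp_trans uvD; rewrite dvdp_mul ?dvdp_gcdl ?dvdp_gcdr.
    by exists c, h, (gcdp u v).
  have : u^`()`_(size u).-2 != 0.
    rewrite coef_deriv; case su: (size u) gt1 => [|[|m]] // _ /=.
    have -> : u`_m.+1 = lead_coef u by rewrite /lead_coef su.
    rewrite -mulr_natr mulf_neq0 //; first by rewrite lead_coef_eq0 -size_poly_gt0 su.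
    have -> : (m.+1)%:R = ((m.+1)%:R : K)%:P by rewrite rmorph_nat.
    by rewrite polyC_eq0 pnatr_eq0.
  by apply: contraNneq => ->; rewrite coef0.
have [c [h [g [nzc sg e]]]] := scale_square_reduce nzc0 nzD20 e0.
pose g_0 := map_poly (horner_eval 0) g.
pose h_0 := map_poly (horner_eval 0) h.
have e_0 : c.[0] *: map_poly (horner_eval 0) D2 = h_0 * (g_0 * g_0).
  rewrite -!rmorphM -e -[in RHS]mul_polyC rmorphM /= map_polyC /= mul_polyC.
  by [].
have nzg : g != 0 by rewrite -size_poly_gt0 sg ltnW.
have : h_0 * (g_0 * g_0) != 0 by rewrite -e_0 scaler_eq0 negb_or nzc.
rewrite !mulf_eq0 orbb negb_or => /andP[nzh_0 nzg_0].
(* D2 and its specialization at e = 0 have the same degree, so no factor loses degree there. *)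
have size_g0 : (1 < size g_0)%N.
  have nzh : h != 0 by apply: contraNneq nzh_0 => z; rewrite /h_0 z rmorph0.
  have := congr1 (fun p : {poly _} => size p) e.
  have := congr1 (fun p : {poly _} => size p) e_0.
  rewrite /= !size_scale //; last by apply: contraNneq nzc => ->; rewrite horner0.
  rewrite mapD2 size_disc_Cd size_D2 !size_mul ?mulf_neq0 //.
  have : (size h_0 <= size h)%N by apply: size_poly.
  have : (size g_0 <= size g)%N by apply: size_poly.
  move: gt1; rewrite -sg.
  move: nzg_0 nzh_0 nzg nzh; rewrite -!size_poly_gt0.
  move: (n.+2 * n.+1)%N (size g_0) (size h_0) (size g) (size h) => k a b a' b'.
  lia.
have [s0 /rootP g_0s0] := closed_rootP g_0 (negbT (gtn_eqF size_g0)).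
pose d a := x a ^+ 2 + s0 * x a.
have dE : Bd + s0 *: Cd = diag_mx (\row_a d a).
  by apply/matrixP => a b; rewrite !mxE; case: (a == b); rewrite ?mulr1n ?mulr0n ?mulr0 ?addr0.
have d_0 : disc_mx (diag_mx (\row_a d a)) = 0.
  rewrite -dE -[Bd]addr0 -(scale0r J) -horner_disc_pencil -mapD2.
  apply: (mulfI nzc); rewrite -hornerZ e_0 !hornerM g_0s0; ring.
have [i [j [nij dij]]] : exists i j, i != j /\ d i = d j.
  apply: contrapT => nex; have : injective d.
    move=> a b dab; apply/eqP/negPn/negP => nab; apply: nex.
    by exists a, b.
  by move/disc_mx_diag_neq0; rewrite d_0 eqxx.
have dB a b : d a - d b = (x a - x b) * (x a + x b + s0) by rewrite /d; ring.
have dP a b : a != b -> d a = d b -> s0 = - (x a + x b).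
  move=> nab /eqP; rewrite -subr_eq0 dB mulf_eq0 subr_eq0 (inj_eq x_inj) (negbTE nab).
  by rewrite addrC addr_eq0 => /eqP.
have d_inj a b : a != j -> b != j -> d a = d b -> a = b.
  move=> naj nbj dab; apply/eqP/negPn/negP => nab.
  have /eqP := dP _ _ nab dab; rewrite (dP _ _ nij dij) eqr_opp eq_sym -!natrD eqr_nat.
  by apply/negP/pow2_sum_inj.
have phiD2 sigma : D2.[s0%:P + sigma *: 'X] =
    disc_mx (line_mx (diag_mx (\row_a d a)) (J + sigma *: Cd)).
  rewrite horner_disc_pencil -dE; congr disc_mx; apply/matrixP => a b.
  by rewrite !mxE -!mul_polyC !(polyCD, polyCM); ring.
pose gd := \prod_(a | a != j) ('X - (d a)%:P).
have [z [p [q gpq]]] := horner_line_coef01 g s0.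
have horner0E (f : {poly {poly K}}) sigma :
    (f.[s0%:P + sigma *: 'X]).[0] = (map_poly (horner_eval 0) f).[s0].
  rewrite -[LHS]/(horner_eval 0 _) -horner_map /=; congr (_.[_]).
  by rewrite /horner_eval hornerD hornerZ hornerX hornerC mulr0 addr0.
have z0 : z = 0 by have [<- _] := gpq 0; rewrite -horner_coef0 horner0E.
(* On the line, g vanishes at e = 0, so that g^2 absorbs the factor e^2 of the discriminant; what
   remains is compared at e = 0. *)
have key sigma : c.[0] * (double_eigen_theta d j (J + sigma *: Cd)).[0] =
    h_0.[s0] * (p + sigma * q) ^+ 2.
  have [g0E g1E] := gpq sigma; set gs := g.[_] in g0E g1E.
  have [gs' gsE] : exists gs', gs = 'X * gs'.
    have /dvdpP [gs' ->] : 'X %| gs.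
      by rewrite -['X]subr0 -polyC0 dvdp_XsubCl rootE horner_coef0 g0E z0.
    by exists gs'; rewrite mulrC.
  have gs'0 : gs'.[0] = p + sigma * q by rewrite -g1E gsE coefXM horner_coef0.
  have := congr1 (horner_eval (s0%:P + sigma *: 'X)) e.
  rewrite /horner_eval hornerZ !hornerM -/gs phiD2.
  have sT : (J + sigma *: Cd)^T = J + sigma *: Cd.
    by rewrite linearD linearZ /= tr_diag_mx trmx_const.
  rewrite (disc_line_mx _ (double_eigen_monic d j) (double_eigen_size d j)
    (double_eigen_horner nij dij)) -/(double_eigen_theta _ _ _).
  set th := double_eigen_theta _ _ _; set hs := h.[_] => e'.
  have : c * th = hs * gs' ^+ 2.
    apply: (@mulfI _ ('X^2 : {poly K})); first by rewrite expf_neq0 ?polyX_eq0.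
    transitivity (c * ('X^2 * th)); first by ring.
    by rewrite e' gsE; ring.
  move=> /(congr1 (horner_eval 0)); rewrite /horner_eval !hornerM gs'0.
  by rewrite /hs horner0E.
have nxij : x i - x j != 0 by rewrite subr_eq0 (inj_eq x_inj).
have tij : ('i / (x i - x j)) ^+ 2 * (x i - x j) ^+ 2 = -1.
  by rewrite -exprMn mulrVK ?unitfE // sqrCi.
have thE sigma m1 m2 : m1 + m2 = 2 + sigma * (x i + x j) ->
    m1 ^+ 2 + m2 ^+ 2 = (1 + sigma * x i) ^+ 2 + (1 + sigma * x j) ^+ 2 + 2 ->
    ((double_eigen_theta d j (J + sigma *: Cd)).[0] == 0) = (m1 == m2).
  move=> e1 e2; apply: (double_eigen_theta_eq0 nij dij) => //.
  - by rewrite linearD linearZ /= tr_diag_mx trmx_const.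
  - by rewrite !mxE !eqxx !mulr1n e1; ring.
  - by rewrite !mxE !eqxx (negbTE nij) !mulr1n mulr0n e2; ring.
(* The block with diagonal 1 + sigma x_i, 1 + sigma x_j and off-diagonal entries 1 has a double
   eigenvalue when sigma^2 (x_i - x_j)^2 + 4 = 0. *)
have eq_sq sigma : sigma ^+ 2 * (x i - x j) ^+ 2 = - 4 -> h_0.[s0] * (p + sigma * q) ^+ 2 = 0.
  move=> es; rewrite -key; apply/eqP; rewrite mulf_eq0; apply/orP; right.
  rewrite (thE _ (1 + sigma * (x i + x j) / 2) (1 + sigma * (x i + x j) / 2)) //.
    by field.
  apply/eqP; rewrite -subr_eq0; apply/eqP.
  transitivity (- (sigma ^+ 2 * (x i - x j) ^+ 2 + 4) / 2); first by field.
  by rewrite es; ring.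
(* At slope 0 the block of J has the distinct eigenvalues 0 and 2. *)
have : h_0.[s0] * (p + 0 * q) ^+ 2 != 0.
  rewrite -(key 0); apply: mulf_neq0; first exact: nzc.
  have -> := thE 0 0 2; first by rewrite eq_sym pnatr_eq0.
    by rewrite mul0r addr0 add0r.
  ring.
rewrite mulf_eq0 negb_or expf_eq0 /= mul0r addr0 => /andP[nzh /negP []].
pose sg0 := 2 * ('i / (x i - x j)).
have e1 : p + sg0 * q = 0.
  have /eqP : h_0.[s0] * (p + sg0 * q) ^+ 2 = 0.
    by apply: eq_sq; rewrite /sg0 exprMn -mulrA tij; ring.
  by rewrite mulf_eq0 (negbTE nzh) expf_eq0 => /eqP.
have e2 : p + (- sg0) * q = 0.
  have /eqP : h_0.[s0] * (p + (- sg0) * q) ^+ 2 = 0.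
    by apply: eq_sq; rewrite /sg0 sqrrN exprMn -mulrA tij; ring.
  by rewrite mulf_eq0 (negbTE nzh) expf_eq0 => /eqP.
have : p *+ 2 = 0 by transitivity ((p + sg0 * q) + (p + (- sg0) * q)); [ring|rewrite e1 e2 addr0].
by move/eqP; rewrite mulrn_eq0.
Qed.

Lemma poly_nonroot (p : {poly K}) : p != 0 -> exists z, p.[z] != 0.
Proof.
move=> nzp; apply: contrapT => nex; case/negP: nzp; apply/eqP/poly_ext => z.
by rewrite horner0; apply/eqP/negPn/negP => nz; apply: nex; exists z.
Qed.

Lemma separable_pencil : exists B C : 'M[K]_n.+2,
  [/\ B^T = B, C^T = C, disc_mx C != 0 & separable_poly (disc_mx (line_mx B C))].
Proof.
have [c nzc sep] := map_separable_poly separable_perturbation.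
have [e nze] := poly_nonroot nzc.
exists (Bd + e *: J), Cd; split=> //.
- by rewrite linearD linearZ /= tr_diag_mx trmx_const.
- by rewrite tr_diag_mx.
- by rewrite -mapD2; apply: sep.
Qed.

End SeparablePencil.

(** * Polynomial functions on a vector space *)

Lemma digits_inj B n (a b : 'I_n -> nat) :
  (forall i, a i < B)%N -> (forall i, b i < B)%N ->
  (\sum_(i < n) a i * B ^ i = \sum_(i < n) b i * B ^ i)%N -> a =1 b.
Proof.
elim: n a b => [|n IH] a b ltaB ltbB; first by move=> _ [].
have B_gt0 : (0 < B)%N by apply: leq_trans (ltaB ord0).
have shift c : (\sum_(i < n.+1) c i * B ^ i =
    (\sum_(i < n) c (lift ord0 i) * B ^ i) * B + c ord0)%N.
  rewrite big_ord_recl expn0 muln1 addnC big_distrl /=; congr (_ + _)%N.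
  by apply: eq_bigr => i _; rewrite -mulnA -expnSr.
rewrite !shift => e.
have e0 : a ord0 = b ord0.
  by have := congr1 (modn^~ B) e; rewrite /= !modnMDl !modn_small.
have {}e : (\sum_(i < n) a (lift ord0 i) * B ^ i = \sum_(i < n) b (lift ord0 i) * B ^ i)%N.
  by have := congr1 (divn^~ B) e; rewrite /= !divnMDl // !divn_small // !addn0.
move=> i; have [->//|[j ->]] : i = ord0 \/ exists j, i = lift ord0 j.
  by case: (unliftP ord0 i) => [j ->|->]; [right; exists j|left].
exact: (IH (fun j => a (lift ord0 j)) (fun j => b (lift ord0 j))).
Qed.

(* Kronecker substitution: X_i := X^(B^i), with B larger than all exponents. *)
Lemma mpoly_ext (K : numDomainType) n (p : mpoly n K) :
  (forall v : 'I_n -> K, meval v p = 0) -> p = 0.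
Proof.
move=> p0; apply/mpolyP => m0; rewrite mcoeff0.
have [m0p|] := boolP (m0 \in msupp p); last by rewrite mcoeff_msupp negbK => /eqP.
pose B := msize p.
pose enc (m : multinom n) := (\sum_(i < n) m i * B ^ i)%N.
pose q : {poly K} := \sum_(m <- msupp p) mcoeff m p *: 'X^(enc m).
have q0 : q = 0.
  apply: poly_ext => z; rewrite horner0 -(p0 (fun i => z ^+ (B ^ i)%N)) mevalE.
  rewrite horner_sum; apply: eq_bigr => m _; rewrite hornerZ hornerXn; congr (_ * _).
  rewrite /enc (big_morph (fun k => z ^+ k) (exprD z) (expr0 z)).
  by apply: eq_bigr => i _; rewrite mulnC exprM.
have ltB (m : multinom n) i : m \in msupp p -> (m i < B)%N.
  move=> /msize_mdeg_lt; apply: leq_ltn_trans.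
  by rewrite mdegE (bigD1 i) //= leq_addr.
have := congr1 (fun q : {poly K} => q`_(enc m0)) q0; rewrite coef0 coef_sum.
rewrite (bigD1_seq m0) ?msupp_uniq //= coefZ coefXn eqxx mulr1 big_seq_cond big1 ?addr0 //.
move=> m /andP[mp nm]; rewrite coefZ coefXn; case: eqP => [e|]; last by rewrite mulr0.
case/negP: nm; apply/eqP/mnmP/(@digits_inj B); rewrite -?/(enc _) //.
  by move=> i; apply: ltB.
by move=> i; apply: ltB.
Qed.

(** * Functions given by evaluating one formal element *)

Section Representable.
Variables (A B : comNzRingType) (V : Type) (ev : V -> {rmorphism A -> B}).

(** With [ev v] the evaluation at v, these are the polynomial functions; the closure properties
    below produce polynomials from determinants and adjugates without writing them out. *)
Definition rep (F : V -> B) := exists a, forall v, ev v a = F v.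
Definition repmx m n (M : V -> 'M[B]_(m, n)) :=
  exists M0, forall v, map_mx (ev v) M0 = M v.

Lemma repmxP m n (M : V -> 'M[B]_(m, n)) :
  (forall i j, rep (fun v => M v i j)) -> repmx M.
Proof.
move=> H; have [f hf] := choice (fun ij => H ij.1 ij.2).
exists (\matrix_(i, j) f (i, j)) => v; apply/matrixP => i j.
by rewrite !mxE; apply: (hf (i, j)).
Qed.

Lemma repmx_entry m n (M : V -> 'M[B]_(m, n)) i j : repmx M -> rep (fun v => M v i j).
Proof. by move=> [M0 h]; exists (M0 i j) => v; rewrite -h mxE. Qed.

Lemma rep_eq F G : F =1 G -> rep F -> rep G.
Proof. by move=> e [a h]; exists a => v; rewrite h. Qed.

Lemma rep_ev a : rep (fun v => ev v a).
Proof. by exists a. Qed.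

Lemma repD F G : rep F -> rep G -> rep (fun v => F v + G v).
Proof. by move=> [a ha] [b hb]; exists (a + b) => v; rewrite rmorphD ha hb. Qed.

Lemma repN F : rep F -> rep (fun v => - F v).
Proof. by move=> [a ha]; exists (- a) => v; rewrite rmorphN ha. Qed.

Lemma repM F G : rep F -> rep G -> rep (fun v => F v * G v).
Proof. by move=> [a ha] [b hb]; exists (a * b) => v; rewrite rmorphM ha hb. Qed.

Lemma repX F k : rep F -> rep (fun v => F v ^+ k).
Proof. by move=> [a ha]; exists (a ^+ k) => v; rewrite rmorphXn ha. Qed.

Lemma rep_sum (I : finType) (F : I -> V -> B) :
  (forall i, rep (F i)) -> rep (fun v => \sum_i F i v).
Proof.
move=> /choice [a ha]; exists (\sum_i a i) => v; rewrite rmorph_sum.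
by apply: eq_bigr => i _.
Qed.

Lemma repmxM m n p (M : V -> 'M[B]_(m, n)) (N : V -> 'M[B]_(n, p)) :
  repmx M -> repmx N -> repmx (fun v => M v *m N v).
Proof. by move=> [a ha] [b hb]; exists (a *m b) => v; rewrite map_mxM ha hb. Qed.

Lemma repmxZ m n F (M : V -> 'M[B]_(m, n)) :
  rep F -> repmx M -> repmx (fun v => F v *: M v).
Proof. by move=> [a ha] [b hb]; exists (a *: b) => v; rewrite map_mxZ ha hb. Qed.

Lemma repmx_adj n (M : V -> 'M[B]_n) : repmx M -> repmx (fun v => \adj (M v)).
Proof. by move=> [a ha]; exists (\adj a) => v; rewrite map_mx_adj ha. Qed.

Lemma rep_det n (M : V -> 'M[B]_n) : repmx M -> rep (fun v => \det (M v)).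
Proof. by move=> [a ha]; exists (\det a) => v; rewrite -det_map_mx ha. Qed.

Lemma rep_disc n (M : V -> 'M[B]_n.+1) : repmx M -> rep (fun v => disc_mx (M v)).
Proof. by move=> [a ha]; exists (disc_mx a) => v; rewrite map_disc_mx ha. Qed.

End Representable.

Section PolynomialFunctions.
Variables (K : numClosedFieldType) (V : vectType K).
Local Notation A := (mpoly (\dim {:V}) K).
Implicit Types (p q : A) (u v w : V) (F G : V -> K).

Definition ev (v : V) : {rmorphism A -> K} :=
  meval (fun i => coord (vbasis {:V}) i v).
Definition evX (v : V) : {rmorphism {poly A} -> {poly K}} := map_poly (ev v).

Lemma evE v p : ev v p = peval p v. Proof. by []. Qed.

Lemma ev_ext p q : (forall v, ev v p = ev v q) -> p = q.
Proof.
move=> e; apply/eqP; rewrite -subr_eq0; apply/eqP/mpoly_ext => c.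
have := e (\sum_i c i *: (vbasis {:V})`_i) => /eqP.
rewrite -subr_eq0 -rmorphB => /eqP <-; apply: meval_eq => i.
by rewrite coord_sum_free // (basis_free (vbasisP _)).
Qed.

Lemma evX_ext (p q : {poly A}) : (forall v s, (evX v p).[s] = (evX v q).[s]) -> p = q.
Proof.
move=> e; apply/polyP => i; apply: ev_ext => v.
have e' : evX v p = evX v q by apply: poly_ext.
by have := congr1 (fun r : {poly K} => r`_i) e'; rewrite !coef_map.
Qed.

(** The product F G vanishes identically, in an integral domain. Identities between polynomial
    functions thus need checking only on a nonempty chart. *)
Lemma rep_ext F G : rep ev F -> rep ev G ->
  (exists v, G v != 0) -> (forall v, G v != 0 -> F v = 0) -> forall v, F v = 0.
Proof.
move=> [a ha] [b hb] [v1 nz] FG v.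
have : a * b = 0.
  apply: ev_ext => w; rewrite rmorphM rmorph0 ha hb.
  by have [->|/FG ->] := eqVneq (G w) 0; rewrite ?mulr0 ?mul0r.
move/eqP; rewrite mulf_eq0 => /orP[/eqP a0|/eqP b0].
  by rewrite -ha a0 rmorph0.
by move: nz; rewrite -hb b0 rmorph0 eqxx.
Qed.

Lemma rep_nonzero2 F G : rep ev F -> rep ev G ->
  (exists v, F v != 0) -> (exists v, G v != 0) -> exists v, F v != 0 /\ G v != 0.
Proof.
move=> hF hG [v nz] exG; apply: contrapT => nex; case/negP: nz.
apply/eqP/(rep_ext hF hG exG) => w nzG; apply/eqP/negPn/negP => nzF.
by apply: nex; exists w.
Qed.

Lemma rep_coord i : rep ev (fun v => coord (vbasis {:V}) i v).
Proof. by exists (mpolyX K (mnm1 i)) => v; rewrite /= mevalXU. Qed.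

Lemma rep_const c : rep ev (fun=> c).
Proof. by exists (mpolyC _ c) => v; rewrite /= mevalC. Qed.

Lemma rep_linear (lam : V -> K) : (forall a u v, lam (a *: u + v) = a * lam u + lam v) ->
  rep ev lam.
Proof.
move=> lin; have l0 : lam 0 = 0.
  have := lin 1 0 0; rewrite scale1r addr0 mul1r => /eqP.
  by rewrite addrC -subr_eq subrr eq_sym => /eqP.
apply: (@rep_eq _ _ _ _ (fun v => \sum_i coord (vbasis {:V}) i v * lam (vbasis {:V})`_i)).
  move=> v; rewrite [in RHS](coord_vbasis (memvf v)).
  elim/big_rec2: _ => [|i y x _ ->]; first by rewrite l0.
  by rewrite lin.
by apply: rep_sum => i; apply: repM; [apply: rep_coord|apply: rep_const].
Qed.

Lemma rep_comp (W : vectType K) (q : mpoly (\dim {:W}) K) (L : V -> W) :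
  (forall i, rep ev (fun v => coord (vbasis {:W}) i (L v))) ->
  rep ev (fun v => peval q (L v)).
Proof.
move=> /choice [l hl]; exists (comp_mpoly [tuple l i | i < \dim {:W}] q) => v.
by rewrite /= comp_mpoly_meval; apply: meval_eq => i; rewrite tnth_mktuple -hl.
Qed.

(** The direction [ell v] may move with v: constant directions serve the divisibility criterion, a
    linear one the deformation that determines the ideal. *)
Lemma rep_line q (ell : V -> V) :
  (forall i, rep ev (fun v => coord (vbasis {:V}) i (ell v))) ->
  exists Q : {poly A}, forall v s, (evX v Q).[s] = peval q (v + s *: ell v).
Proof.
move=> /choice [l hl].
exists (mmap (fun c : K => (mpolyC _ c)%:P)
  (fun i => (mpolyX K (mnm1 i))%:P + 'X * (l i)%:P) q) => v s.
rewrite /peval mevalE /mmap rmorph_sum horner_sum; apply: eq_bigr => m _.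
rewrite rmorphM hornerM /= map_polyC hornerC /= mevalC; congr (_ * _).
rewrite /mmap1 rmorph_prod horner_prod; apply: eq_bigr => i _.
rewrite rmorphXn horner_exp; congr (_ ^+ _) => /=.
rewrite rmorphD rmorphM /= map_polyX !map_polyC /= hornerD hornerM hornerX !hornerC.
by rewrite mevalXU -/(ev v _) hl linearD linearZ.
Qed.

End PolynomialFunctions.

(** * Divisibility tested on a line *)

Lemma top_coef_reverse (K : numFieldType) (f g : {poly K}) d :
  (forall s, s != 0 -> f.[s] = s ^+ d * g.[s^-1]) -> top_coef f d g.[0].
Proof.
(* f is a reciprocal polynomial of g; the factor X^M clears the negative exponents that s^d g(1/s)
   could have. *)
move=> fg; pose M := (size g).+1.
pose r : {poly K} := \sum_(i < size g) g`_i *: 'X^(d + M - i).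
have e : 'X^M * f = r.
  apply: poly_ext => s; rewrite hornerM hornerXn horner_sum.
  have [->|nzs] := eqVneq s 0.
    rewrite expr0n mul0r big1 // => i _; rewrite hornerZ hornerXn expr0n.
    case: eqP => [|_]; last by rewrite mulr0.
    by move: (ltn_ord i); rewrite /M; lia.
  rewrite fg // horner_coef !mulr_sumr; apply: eq_bigr => i _.
  rewrite hornerZ hornerXn exprVn [RHS]mulrC.
  have -> : s ^+ (d + M - i) = s ^+ M * s ^+ d / s ^+ i.
    rewrite -exprD addnC -expfB_cond //.
    by rewrite (negbTE nzs) (leq_trans (ltnW (ltn_ord i))) // /M; lia.
  by rewrite !mulrA; ring.
have fE j : f`_j = \sum_(i < size g) g`_i * (M + j == d + M - i)%N%:R.
  have -> : f`_j = ('X^M * f)`_(M + j) by rewrite coefXnM ltnNge leq_addr /= addKn.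
  by rewrite e coef_sum; apply: eq_bigr => i _; rewrite coefZ coefXn.
split.
  apply/leq_sizeP => j lt_dj; rewrite fE big1 // => i _.
  rewrite (_ : (_ == _) = false) ?mulr0 //; apply/negbTE/eqP.
  by move: (ltn_ord i); rewrite /M; lia.
rewrite fE horner_coef0; have [->|nzg] := eqVneq g 0.
  by rewrite coef0 big1 // => i _; rewrite coef0 mul0r.
have g_gt0 : (0 < size g)%N by rewrite size_poly_gt0.
rewrite (bigD1 (Ordinal g_gt0)) //= big1 ?addr0 => [|i ni0].
  by rewrite subn0 addnC eqxx mulr1.
rewrite (_ : (_ == _) = false) ?mulr0 //; apply/negbTE/eqP.
by move: ni0 (ltn_ord i); rewrite -val_eqE /= /M; lia.
Qed.

(** When a p + b (h + x p) is constant, this turns h r = u p into the divisibility of a constant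
    multiple of r by p. *)
Lemma bezout_factor (R : comNzRingType) (a b h x p r u : R) : h * r = u * p ->
  (a * p + b * (h + x * p)) * r = (a * r + b * (u + x * r)) * p.
Proof.
move=> e; transitivity (a * p * r + b * (h * r) + b * (x * p) * r); first by ring.
by rewrite e; ring.
Qed.

Section LineDivision.
Variables (K : numClosedFieldType) (V : vectType K).
Local Notation A := (mpoly (\dim {:V}) K).
Implicit Types (P Q H S : A) (u v w : V).

Lemma rep_coord_const u i : rep (@ev K V) (fun=> coord (vbasis {:V}) i u).
Proof. exact: rep_const. Qed.

Lemma homogeneous_line P u d (Ps : {poly A}) :
  (forall c v, c != 0 -> peval P (c *: v) = c ^+ d * peval P v) ->
  (forall v s, (evX v Ps).[s] = peval P (v + s *: u)) ->
  top_coef Ps d (mpolyC _ (peval P u)).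
Proof.
move=> homP PsE.
have top v : top_coef (evX v Ps) d (peval P u).
  have [G GE] := rep_line P (rep_coord_const v).
  have := GE u 0; rewrite scale0r addr0 => <-; apply: top_coef_reverse => s nzs.
  rewrite PsE GE -homP //; congr peval.
  by rewrite scalerDr scalerA divff // scale1r addrC.
split.
  apply/leq_sizeP => j lt_dj; apply: ev_ext => v; rewrite rmorph0.
  by rewrite -(coef_map (ev v)); apply/leq_sizeP: j lt_dj; case: (top v).
by apply: ev_ext => v; rewrite -(coef_map (ev v)) /= mevalC; case: (top v).
Qed.

(** Along the direction u, homogeneity gives P the unit leading coefficient P(u). Coprimality of P
    and H on the line through [v0] implies coprimality on the generic parallel line. The remainder
    of Q modulo P then becomes a multiple of P after multiplication by a factor free of the
    parameter, so it is zero by degree. *)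
Lemma line_coprime P H Q S u v0 d :
  (forall c v, c != 0 -> peval P (c *: v) = c ^+ d * peval P v) -> peval P u != 0 ->
  (forall s, peval P (v0 + s *: u) = 0 -> peval H (v0 + s *: u) != 0) ->
  H * Q = S * P -> exists Q', Q = Q' * P.
Proof.
move=> homP nzPu cop HQ.
have line q := rep_line q (rep_coord_const u).
have [Ps PsE] := line P; have [Hs HsE] := line H.
have [Qs QsE] := line Q; have [Ss SsE] := line S.
have [szP topP] := homogeneous_line homP PsE.
pose c : A := mpolyC _ (peval P u); pose c' : A := mpolyC _ (peval P u)^-1.
have cc' : c * c' = 1 by rewrite -mpolyCM divff.
pose P1 := c' *: Ps.
have P1_monic : P1 \is monic.
  have sz : size P1 = d.+1.
    apply/eqP; rewrite eqn_leq (leq_trans (size_scale_leq _ _)) //= ltnNge.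
    apply/negP => /leq_sizeP /(_ d (leqnn d)); rewrite coefZ topP mulrC cc'.
    by move/eqP; rewrite oner_eq0.
  by rewrite monicE /lead_coef sz coefZ topP mulrC cc'.
have P1E v s : (evX v P1).[s] = (peval P u)^-1 * (evX v Ps).[s].
  by rewrite /P1 -mul_polyC rmorphM hornerM /= map_polyC hornerC /= mevalC.
have HQs : Hs * Qs = Ss * Ps.
  apply: evX_ext => v s; rewrite !rmorphM !hornerM HsE QsE SsE PsE.
  by have := congr1 (fun q : A => peval q (v + s *: u)) HQ; rewrite -!evE !rmorphM.
have PsP1 : Ps = c *: P1 by rewrite scalerA cc' scale1r.
(* [H1] is congruent to [Hs] modulo [P1] and monic, so its leading coefficient survives evaluation
   at [v0]. *)
pose H1 := Hs + 'X^(size Hs) * P1.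
have H1_monic : H1 \is monic.
  have mon : 'X^(size Hs) * P1 \is monic by rewrite monicMl ?monicXn.
  rewrite monicE /H1 lead_coefDr ?(monicP mon) //.
  have nzXn : 'X^(size Hs) != 0 :> {poly A} by rewrite monic_neq0 ?monicXn.
  rewrite size_Mmonic // size_polyXn addSn /= -[X in (X < _)%N]addn0 ltn_add2l.
  by rewrite size_poly_gt0 monic_neq0.
have copP1 : coprimep P1 H1.
  apply: (@coprimep_of_map _ _ (ev v0)); rewrite ?(monicP P1_monic) ?(monicP H1_monic)
    ?rmorph1 ?oner_eq0 //.
  apply/Pdiv.ClosedField.coprimepP => s; rewrite rootE -/(evX v0 P1) -/(evX v0 H1).
  rewrite /H1 rmorphD rmorphM hornerD hornerM P1E mulf_eq0 invr_eq0 (negbTE nzPu) /=.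
  by rewrite PsE HsE => /eqP e; rewrite e !mulr0 addr0 cop.
have [a [b [k [nzk e]]]] := coprimep_Bezout_const copP1.
have := Pdiv.RingMonic.rdivp_eq P1_monic Qs.
set q := Pdiv.CommonRing.rdivp _ _; set r := Pdiv.CommonRing.rmodp _ _ => Qsqr.
have sz_r : (size r < size P1)%N by rewrite Pdiv.CommonRing.ltn_rmodpN0 ?monic_neq0.
have r0 : r = 0.
  have e2 : k *: r = (a * r + b * (c *: Ss - Hs * q + 'X^(size Hs) * r)) * P1.
    have Hr : Hs * r = (c *: Ss - Hs * q) * P1.
      have -> : r = Qs - q * P1 by rewrite Qsqr addrC addKr.
      by rewrite mulrBr HQs PsP1 -!mul_polyC; ring.
    by rewrite -mul_polyC -e; apply: bezout_factor.
  apply/eqP/negPn/negP => nzr.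
  have : (size (k *: r) < size P1)%N by rewrite size_scale.
  rewrite e2; set w := (_ + _); have [w0|nzw] := eqVneq w 0.
    by have := e2; rewrite -/w w0 mul0r => /eqP; rewrite scale_poly_eq0 (negbTE nzk) (negbTE nzr).
  have : (0 < size w)%N by rewrite size_poly_gt0.
  rewrite size_Mmonic //; move: (size w) => [//|m] _; by rewrite addSn /= ltnNge leq_addl.
exists (q.[0] * c'); apply: ev_ext => v; rewrite !rmorphM !evE.
have := QsE v 0; rewrite scale0r addr0 => <-.
rewrite Qsqr r0 addr0 rmorphM hornerM P1E PsE scale0r addr0 mulrA.
by rewrite -!evE -horner_map rmorph0 /c' /= mevalC.
Qed.

End LineDivision.

(** * Kernel vectors in Pluecker coordinates *)

HB.lock Definition frame_mx (R : comNzRingType) f (M : 'M[R]_(f, f + 2))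
  (x y : 'rV[R]_(f + 2)) : 'M[R]_(f + 2) := col_mx M (col_mx x y : 'M[_]_(1 + 1, _)).

Definition last f : 'I_(f + 2) := rshift f (rshift 1 (0 : 'I_1) : 'I_(1 + 1)).
Definition penult f : 'I_(f + 2) := rshift f (lshift 1 (0 : 'I_1) : 'I_(1 + 1)).

Section Plucker.
Variables (R : comNzRingType) (f : nat).
Implicit Types (M : 'M[R]_(f, f + 2)) (x y z : 'rV[R]_(f + 2)).
Local Notation last := (last f).
Local Notation penult := (penult f).

Definition plucker M x y := \det (frame_mx M x y).
(* For M of rank f, the vectors [kvec M x] are those of the kernel of M. *)
Definition kvec M x := \col_j plucker M x (delta_mx 0 j).

Lemma mul_frame_mx M x y p (T : 'M[R]_(f + 2, p)) : frame_mx M x y *m T =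
  col_mx (M *m T) (col_mx (x *m T) (y *m T) : 'M[_]_(1 + 1, p)).
Proof. by rewrite frame_mx.unlock mul_col_mx; congr col_mx; exact: (@mul_col_mx _ 1 1 _ _ x y T). Qed.

Lemma frame_mxl M x y i j : frame_mx M x y (lshift 2 i) j = M i j.
Proof. by rewrite frame_mx.unlock; exact: col_mxEu. Qed.

Lemma frame_mx_penult M x y j : frame_mx M x y penult j = x 0 j.
Proof. by rewrite frame_mx.unlock; exact: etrans (col_mxEd _ _ _ _) (col_mxEu _ _ _ _). Qed.

Lemma frame_mx_last M x y j : frame_mx M x y last j = y 0 j.
Proof. by rewrite frame_mx.unlock; exact: etrans (col_mxEd _ _ _ _) (col_mxEd _ _ _ _). Qed.

Lemma frame_mx_ind (P : 'I_(f + 2) -> Prop) :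
  (forall i, P (lshift 2 i)) -> P penult -> P last -> forall i, P i.
Proof.
move=> Pl Pp Pa i; rewrite -(fintype.splitK i); case: (fintype.split i) => /= [j|j]; first exact: Pl.
have [-> //|-> //] : j = lshift 1 (0 : 'I_1) \/ j = rshift 1 (0 : 'I_1).
by case: j => -[|[|//]] lt; [left|right]; apply: val_inj.
Qed.

(** Laplace expansion along the last row, whose cofactors are the entries of [kvec M x]. *)
Lemma kvecP M x z : z *m kvec M x = (plucker M x z)%:M.
Proof.
apply/matrixP => i j; rewrite !ord1 !mxE mulr1n /plucker (expand_det_row _ last).
apply: eq_bigr => l _; rewrite !mxE frame_mx_last; congr (_ * _).
rewrite /plucker (expand_det_row _ last) (bigD1 l) //= big1 ?addr0 => [|l' nl].
  rewrite frame_mx_last mxE !eqxx mul1r /cofactor; congr (_ * \det _).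
  apply/matrixP => a b; rewrite !mxE; move: (lift last a) (neq_lift last a) => c.
  elim/frame_mx_ind: c => [c|_|]; rewrite ?frame_mxl ?frame_mx_penult //.
  by rewrite eqxx.
by rewrite frame_mx_last mxE (negbTE nl) mul0r.
Qed.

Lemma plucker_xx M x : plucker M x x = 0.
Proof.
apply: (@determinant_alternate _ _ _ penult last) => [|j].
  by rewrite -val_eqE /= eqn_add2l.
by rewrite frame_mx_penult frame_mx_last.
Qed.

Lemma kvec_ker M x : M *m kvec M x = 0.
Proof.
apply/row_matrixP => i; rewrite row_mul kvecP row0.
suff -> : plucker M x (row i M) = 0 by apply/matrixP => a b; rewrite !mxE mul0rn.
apply: (@determinant_alternate _ _ _ (lshift 2 i) last) => [|j].
  by rewrite -val_eqE /= ltn_eqF // (leq_trans (ltn_ord i)) // leq_addr.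
by rewrite frame_mxl frame_mx_last mxE.
Qed.

Lemma plucker_sym M x y : plucker M y x = - plucker M x y.
Proof.
rewrite /plucker; have -> : frame_mx M y x = xrow penult last (frame_mx M x y).
  apply/matrixP => i j; rewrite mxE; elim/frame_mx_ind: i => [i||].
  - rewrite tpermD ?frame_mxl //.
      by rewrite -val_eqE /= gtn_eqF // ltn_addr.
    by rewrite -val_eqE /= gtn_eqF // (leq_trans (ltn_ord i)) // leq_addr.
  - by rewrite tpermL frame_mx_last frame_mx_penult.
  - by rewrite tpermR frame_mx_last frame_mx_penult.
rewrite xrowE det_mulmx det_perm odd_tperm.
suff -> : penult != last by rewrite expr1 mulN1r.
by rewrite -val_eqE /= eqn_add2l.
Qed.

Lemma plucker_mul M x y (T : 'M[R]_(f + 2)) :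
  plucker (M *m T) (x *m T) (y *m T) = plucker M x y * \det T.
Proof. by rewrite /plucker -det_mulmx mul_frame_mx frame_mx.unlock. Qed.

Lemma plucker_mull (h : 'M[R]_f) M x y : plucker (h *m M) x y = \det h * plucker M x y.
Proof.
rewrite /plucker; have -> : frame_mx (h *m M) x y = block_mx h 0 0 1%:M *m frame_mx M x y.
  by rewrite !frame_mx.unlock mul_block_col !mul0mx mul1mx addr0 add0r.
by rewrite det_mulmx det_ublock det1 mulr1.
Qed.

Lemma kvec_mull (h : 'M[R]_f) M x : kvec (h *m M) x = \det h *: kvec M x.
Proof. by apply/matrixP => i j; rewrite !mxE plucker_mull. Qed.

End Plucker.

Section PluckerField.
Variables (K : fieldType) (f : nat).
Implicit Types (M : 'M[K]_(f, f + 2)) (x y z : 'rV[K]_(f + 2)) (a : 'cV[K]_(f + 2)).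

Lemma plucker_inj M x y a : plucker M x y != 0 ->
  M *m a = 0 -> x *m a = 0 -> y *m a = 0 -> a = 0.
Proof.
move=> nzw Ma xa ya; have uF : frame_mx M x y \in unitmx by rewrite unitmxE unitfE.
by rewrite -(mulKmx uF a) mul_frame_mx Ma xa ya !col_mx0 mulmx0.
Qed.

Lemma plucker_neq0 M x y :
  (forall a, M *m a = 0 -> x *m a = 0 -> y *m a = 0 -> a = 0) -> plucker M x y != 0.
Proof.
move=> inj; rewrite /plucker -det_tr; apply/det0P => -[v nzv].
move=> /(congr1 trmx); rewrite trmx_mul trmxK trmx0 mul_frame_mx => e.
case/eqP: nzv; rewrite -[v]trmxK; apply: (can_inj (@trmxK _ _ _)); rewrite trmxK trmx0.
have [eM ex] : M *m v^T = 0 /\ (col_mx (x *m v^T) (y *m v^T) : 'M[_]_(1 + 1, 1)) = 0.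
  by apply: eq_col_mx; rewrite e col_mx0.
have [{}ex ey] : x *m v^T = 0 /\ y *m v^T = 0.
  by apply: eq_col_mx; rewrite ex col_mx0.
exact: inj.
Qed.

Lemma kvec_unique M x y a : plucker M x y != 0 ->
  M *m a = 0 -> x *m a = 0 -> y *m a = (plucker M x y)%:M -> a = kvec M x.
Proof.
move=> nzw Ma xa ya; apply/eqP; rewrite -subr_eq0; apply/eqP.
apply: (plucker_inj nzw); rewrite mulmxBr ?kvec_ker ?Ma ?subrr //.
  by rewrite xa kvecP plucker_xx raddf0 subrr.
by rewrite ya kvecP subrr.
Qed.

Lemma kvec_unique2 M x y a : plucker M x y != 0 ->
  M *m a = 0 -> x *m a = (- plucker M x y)%:M -> y *m a = 0 -> a = kvec M y.
Proof.
move=> nzw Ma xa ya; apply: (@kvec_unique _ _ x) => //; rewrite plucker_sym ?oppr_eq0 //.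
Qed.

(** Cramer's rule: both sides have the same image under the invertible [frame_mx M x y]. *)
Lemma kvec_span M x y a : plucker M x y != 0 -> M *m a = 0 ->
  a = ((y *m a) 0 0 / plucker M x y) *: kvec M x
    - ((x *m a) 0 0 / plucker M x y) *: kvec M y.
Proof.
move=> nzw Ma; apply/eqP; rewrite -subr_eq0; apply/eqP.
apply: (plucker_inj nzw).
- by rewrite !mulmxBr -!scalemxAr !kvec_ker Ma !scaler0 !subr0.
- rewrite !mulmxBr -!scalemxAr !kvecP plucker_xx (plucker_sym _ x y).
  apply/matrixP => i j; rewrite !ord1 !mxE /= !mulr1n.
  by field.
- rewrite !mulmxBr -!scalemxAr !kvecP plucker_xx.
  apply/matrixP => i j; rewrite !ord1 !mxE /= !mulr1n.
  by field.
Qed.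

End PluckerField.

(** * Tangency and double eigenvalues *)

Lemma det_transvection (R : comNzRingType) n (i j : 'I_n) (a : R) : i != j ->
  \det (1%:M + a *: delta_mx i j) = 1.
Proof.
move=> nij; wlog lt_ji : i j nij / (j < i)%N => [W|].
  case: (ltngtP j i) => [lt|lt|/val_inj e]; first exact: W.
    rewrite -det_tr linearD linearZ /= trmx1 trmx_delta; apply: W => //.
    by rewrite eq_sym.
  by rewrite e eqxx in nij.
rewrite det_trig; first by apply: big1 => k _; rewrite !mxE eqxx;
  case: eqP => [->|_]; rewrite /= ?(negbTE nij) ?mulr0 addr0.
apply/is_trig_mxP => k l lt_kl; rewrite !mxE -val_eqE /= ltn_eqF // add0r.
case: eqP => [ek|_]; last by rewrite mulr0.
case: eqP => [el|_]; last by rewrite mulr0.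
by move: lt_kl; rewrite ek el ltnNge ltnW.
Qed.

Lemma deriv_prod_ord (R : comNzRingType) n (p : 'I_n -> {poly R}) :
  (\prod_i p i)^`() = \sum_i (p i)^`() * \prod_(j | j != i) p j.
Proof.
elim: n p => [|n IH] p; first by rewrite !big_ord0 derivC.
rewrite big_ord_recl derivM IH [in RHS]big_ord_recl; congr (_ * _ + _).
  rewrite [in RHS]big_mkcond big_ord_recl /= mul1r; exact: eq_bigr.
rewrite mulr_sumr; apply: eq_bigr => i _; rewrite mulrCA; congr (_ * _).
rewrite [in RHS]big_mkcond big_ord_recl /= big_mkcond.
by congr (_ * _); apply: eq_bigr.
Qed.

Lemma deriv_det (R : comNzRingType) n (M : 'M[{poly R}]_n) :
  (\det M)^`() = \sum_i \sum_j (M i j)^`() * cofactor M i j.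
Proof.
transitivity (\sum_i \det (\matrix_(k, l) if k == i then (M k l)^`() else M k l)).
  rewrite exchange_big /= raddf_sum /=; apply: eq_bigr => s _.
  have sgn (q : {poly R}) : ((-1) ^+ odd_perm s * q)^`() = (-1) ^+ odd_perm s * q^`().
    by case: odd_perm; rewrite ?expr1 ?expr0 ?mul1r // !mulN1r derivN.
  rewrite sgn deriv_prod_ord mulr_sumr; apply: eq_bigr => i _; congr (_ * _).
  rewrite [RHS](bigD1 i) //= mxE eqxx; congr (_ * _); apply: eq_bigr => k nki.
  by rewrite mxE (negbTE nki).
apply: eq_bigr => i _; rewrite (expand_det_row _ i); apply: eq_bigr => j _.
rewrite mxE eqxx; congr (_ * (_ * \det _)); apply/matrixP => a b.
by rewrite !mxE eq_sym (negbTE (neq_lift _ _)).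
Qed.

(** Jacobi's formula, which makes tangency a linear condition on [B]. *)
Lemma deriv_det_pencil0 (K : fieldType) n (A B : 'M[K]_n) :
  (\det (map_mx polyC A + 'X *: map_mx polyC B))^`().[0] = \tr (\adj A *m B).
Proof.
transitivity (\sum_i \sum_j B i j * cofactor A i j).
  rewrite deriv_det horner_sum; apply: eq_bigr => i _; rewrite horner_sum.
  apply: eq_bigr => j _; rewrite hornerM; congr (_ * _).
    by rewrite !mxE derivD derivM derivX !derivC mulr0 mul1r addr0 add0r hornerC.
  rewrite -[LHS]/(horner_eval 0 _) -cofactor_map_mx; congr cofactor.
  apply/matrixP => a b; rewrite !mxE rmorphD rmorphM /= /horner_eval hornerX.
  by rewrite !hornerC mul0r addr0.
rewrite exchange_big; apply: eq_bigr => j _.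
by rewrite mxE; apply: eq_bigr => i _; rewrite mxE mulrC.
Qed.

(** If the diagonal of G vanishes, the identity serves. Otherwise take G_ii nonzero and S = U D U^T,
    with U a transvection of parameter a and D diagonal with entry t at i and 1 elsewhere. The trace
    is t G_ii + b, with b quadratic in a; a nonzero b gives a nonzero solution t, hence an
    invertible S. *)
Lemma symmetric_complement (K : numFieldType) n (G : 'M[K]_n.+2) : G^T = G ->
  exists S : 'M[K]_n.+2, [/\ S^T = S, \det S != 0 & \tr (G *m S) = 0].
Proof.
move=> symG.
have Gsym i j : G j i = G i j by rewrite -[in LHS]symG mxE.
have [[i nzi]|nex] := pselect (exists i, G i i != 0); last first.
  exists 1%:M; rewrite trmx1 det1 oner_neq0; split=> //.
  rewrite mulmx1; apply: big1 => i _; apply/eqP/negPn/negP => nz.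
  by apply: nex; exists i.
have [j nij] : exists j, i != j.
  by exists (lift i 0); apply: neq_lift.
pose U a := 1%:M + a *: delta_mx i j : 'M[K]_n.+2.
pose G' a := (U a)^T *m G *m U a.
have detU a : \det (U a) = 1 by apply: det_transvection.
pose D t := diag_mx (\row_l (if l == i then t else 1 : K)).
have UG a : G' a = G + a *: (delta_mx j i *m G) + a *: (G *m delta_mx i j)
    + (a ^+ 2) *: (delta_mx j i *m G *m delta_mx i j).
  have UT : (U a)^T = 1%:M + a *: delta_mx j i.
    by rewrite /U linearD linearZ /= trmx1 trmx_delta.
  rewrite /G' UT /U mulmxDl mul1mx -scalemxAl mulmxDr mulmx1 mulmxDl.
  by rewrite -scalemxAl -!scalemxAr scalerA -expr2 !addrA.
have jG l m : (delta_mx j i *m G) l m = (l == j)%:R * G i m.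
  rewrite mxE (bigD1 i) //= big1 ?addr0 => [|k nk]; rewrite mxE ?eqxx ?andbT //.
  by rewrite (negbTE nk) andbF mul0r.
have Gj l m (N : 'M[K]_n.+2) : (N *m delta_mx i j) l m = N l i * (m == j)%:R.
  rewrite mxE (bigD1 i) //= big1 ?addr0 => [|k nk]; rewrite mxE ?eqxx //=.
  by rewrite (negbTE nk) /= mulr0.
have nji : (j == i) = false by rewrite eq_sym (negbTE nij).
have addE (M1 M2 : 'M[K]_n.+2) l m : (M1 + M2) l m = M1 l m + M2 l m by rewrite mxE.
have sclE t (M1 : 'M[K]_n.+2) l m : (t *: M1) l m = t * M1 l m by rewrite mxE.
have G'i a : G' a i i = G i i.
  by rewrite UG !addE !sclE !Gj !jG (negbTE nij) !(mul0r, mulr0, addr0).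
have G'j a : G' a j j = G j j + a * G i j *+ 2 + a ^+ 2 * G i i.
  by rewrite UG !addE !sclE !Gj !jG !eqxx (Gsym i j) /=; ring.
have G'l a l : l != j -> G' a l l = G l l.
  by move=> nl; rewrite UG !addE !sclE !Gj !jG (negbTE nl) !(mul0r, mulr0, addr0).
pose c := \sum_(l | (l != i) && (l != j)) G l l.
have trE a t : \tr (G *m (U a *m D t *m (U a)^T)) =
    t * G i i + (G j j + a * G i j *+ 2 + a ^+ 2 * G i i) + c.
  have GD l : (G' a *m D t) l l = G' a l l * (if l == i then t else 1).
    by rewrite mul_mx_diag [LHS]mxE; congr (_ * _); rewrite mxE.
  rewrite !mulmxA mxtrace_mulC !mulmxA -/(G' a) /mxtrace.
  rewrite (bigD1 i) //= (bigD1 j) 1?eq_sym //= !GD eqxx nji G'i G'j addrA mulr1.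
  rewrite (mulrC t); congr (_ + _); apply: eq_bigr => l /andP[nli nlj].
  by rewrite GD (negbTE nli) mulr1 G'l.
(* The leading coefficient in a is G_ii, and the second difference at -1, 0, 1 is 2 G_ii. *)
have [a nza] : exists a, G j j + a * G i j *+ 2 + a ^+ 2 * G i i + c != 0.
  apply: contrapT => nex.
  have z a : G j j + a * G i j *+ 2 + a ^+ 2 * G i i + c = 0.
    by apply/eqP/negPn/negP => nz; apply: nex; exists a.
  have := z 1; have := z (-1); have := z 0 => z0 zm z1; case/eqP: nzi.
  have : G i i *+ 2 = 0.
    transitivity ((G j j + 1 * G i j *+ 2 + 1 ^+ 2 * G i i + c) +
      (G j j + -1 * G i j *+ 2 + (-1) ^+ 2 * G i i + c) -
      (G j j + 0 * G i j *+ 2 + 0 ^+ 2 * G i i + c) *+ 2); first by ring.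
    by rewrite z0 z1 zm; ring.
  by move/eqP; rewrite mulrn_eq0 => /eqP.
set b := _ + c in nza.
exists (U a *m D (- b / G i i) *m (U a)^T); split.
- by rewrite !trmx_mul trmxK tr_diag_mx mulmxA.
- rewrite !det_mulmx det_tr detU mulr1 mul1r det_diag (bigD1 i) //= mxE eqxx.
  rewrite big1 ?mulr1 => [|l nl]; last by rewrite mxE (negbTE nl).
  by rewrite mulf_neq0 ?oppr_eq0 ?invr_eq0.
- by rewrite trE divfK // -addrA -/b addNr.
Qed.

Section Tangency.
Variables (K : numClosedFieldType) (n : nat).
Implicit Types A B M : 'M[K]_n.+1.

Let unit_adj A : \det A != 0 -> \adj A \in unitmx.
Proof.
move=> nzA; have : \adj A *m A = (\det A)%:M := mul_adj_mx A.
move/(congr1 determinant); rewrite det_mulmx det_scalar => e.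
rewrite unitmxE unitfE; apply: contraNneq nzA => z; move/eqP: e.
by rewrite z mul0r eq_sym expf_eq0 /=.
Qed.

Let pencil_split A B p q (r : 'I_n.+1 -> K) : char_poly (\adj A *m B) = \prod_i ('X - (r i)%:P) ->
  (\det (\adj A))%:P * \det (map_mx polyC (p *: A + q *: B) + 'X *: map_mx polyC A) =
  \prod_i ((p * \det A + q * r i)%:P + 'X * (\det A)%:P).
Proof.
move=> Sr; apply: poly_ext => x; rewrite hornerM hornerC horner_prod.
rewrite -[(\det (_ + _)).[x]]/(horner_eval x _) -det_map_mx -det_mulmx.
have -> : map_mx (horner_eval x) (map_mx polyC (p *: A + q *: B) + 'X *: map_mx polyC A) =
    p *: A + q *: B + x *: A by exact: horner_line_mx.
have -> : \adj A *m (p *: A + q *: B + x *: A) =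
    (p * \det A + x * \det A)%:M + q *: (\adj A *m B).
  rewrite !mulmxDr -!scalemxAr mul_adj_mx !scale_scalar_mx raddfD /=.
  by rewrite -!addrA; congr (_ + _); rewrite addrC.
rewrite (det_split _ _ Sr); apply: eq_bigr => i _.
by rewrite hornerD hornerM hornerX !hornerC; ring.
Qed.

Let pencil_split0 A M p q (r : 'I_n.+1 -> K) :
  (\det (\adj A))%:P * \det (map_mx polyC M + 'X *: map_mx polyC A) =
    \prod_i ((p * \det A + q * r i)%:P + 'X * (\det A)%:P) ->
  \det (\adj A) * \det M = \prod_i (p * \det A + q * r i) /\
  \det (\adj A) * \tr (\adj M *m A) =
    \sum_i \det A * \prod_(j | j != i) (p * \det A + q * r j).
Proof.
have val l : ((p * \det A + q * r l)%:P + 'X * (\det A)%:P).[0] = p * \det A + q * r l.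
  by rewrite hornerD hornerM hornerX !hornerC mul0r addr0.
have drv l : ((p * \det A + q * r l)%:P + 'X * (\det A)%:P)^`().[0] = \det A.
  by rewrite derivD derivM derivX !derivC mulr0 addr0 mul1r add0r hornerC.
move=> e; split.
  have := congr1 (fun P : {poly K} => P.[0]) e; rewrite hornerM hornerC horner_prod.
  rewrite -[(\det (_ + _)).[0]]/(horner_eval 0 _) -det_map_mx.
  rewrite [map_mx (horner_eval 0) _](horner_line_mx M A 0) scale0r addr0 => ->.
  by apply: eq_bigr => l _.
have := congr1 (fun P : {poly K} => P^`().[0]) e.
rewrite derivM derivC mul0r add0r hornerM hornerC deriv_det_pencil0 deriv_prod_ord.
rewrite horner_sum => ->; apply: eq_bigr => l _; rewrite hornerM drv horner_prod.
by congr (_ * _); apply: eq_bigr => l' _.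
Qed.

(** With M the given combination, det (M + x A) vanishes at x = 0 together with its derivative, so
    two of its linear factors, indexed by the eigenvalues of [\adj A *m B], vanish there. *)
Lemma disc_tangent_eq0 A B p q : \det A != 0 -> p *: A + q *: B != 0 ->
  \det (p *: A + q *: B) = 0 -> \tr (\adj (p *: A + q *: B) *m A) = 0 ->
  disc_mx (\adj A *m B) = 0.
Proof.
move=> nzA nzM detM trM; have [r Sr _] := char_poly_split (\adj A *m B).
apply/eqP/negPn/negP => /(disc_mx_neq0P Sr) inj.
have e := pencil_split p q Sr.
have nzq : q != 0.
  apply: contraNneq nzM => q0; rewrite q0 scale0r addr0.
  move: detM; rewrite q0 scale0r addr0 detZ => /eqP; rewrite mulf_eq0 (negbTE nzA) orbF.
  by rewrite expf_eq0 /= => /eqP ->; rewrite scale0r.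
have [e0 e1] := pencil_split0 e.
move: e0; rewrite detM mulr0 => /esym/eqP/prodf_eq0 [i _ /eqP ri].
move: e1; rewrite trM mulr0 (bigD1 i) //= [X in _ + X]big1 ?addr0 => [/esym/eqP|l nli]; last first.
  by rewrite (bigD1 i) 1?eq_sym //= ri mul0r mulr0.
rewrite mulf_eq0 (negbTE nzA) => /prodf_eq0 [j nji].
rewrite -ri => /eqP /addrI /(mulfI nzq) /inj eji.
by rewrite eji eqxx in nji.
Qed.

(** A repeated eigenvalue r gives the singular member [B - c *: A] with c = r / det A, and the bound
    on the ranks makes its corank exactly one. *)
Lemma tangent_of_disc_eq0 A B : \det A != 0 -> disc_mx (\adj A *m B) = 0 ->
  (forall a, (n <= \rank (\adj A *m B - a%:M)%R)%N) ->
  exists c, [/\ \rank (B - c *: A) = n, \det (B - c *: A) = 0 &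
                \tr (\adj (B - c *: A) *m A) = 0].
Proof.
move=> nzA disc0 rk; have [r Sr _] := char_poly_split (\adj A *m B).
have [i [j [nij rij]]] : exists i j, i != j /\ r i = r j.
  apply: contrapT => nex; have : injective r.
    by move=> a b rab; apply/eqP/negPn/negP => nab; apply: nex; exists a, b.
  by move/(disc_mx_neq0P Sr); rewrite disc0 eqxx.
pose c := r i / \det A; have ME : B - c *: A = (- c) *: A + 1 *: B.
  by rewrite scale1r scaleNr addrC.
have e := pencil_split (- c) 1 Sr; rewrite -ME in e.
have cr l : - c * \det A + 1 * r l = r l - r i by rewrite /c mulNr divfK // mul1r addrC.
have nzadj : \det (\adj A) != 0 by have := unit_adj nzA; rewrite unitmxE unitfE.
have [e0 e1] := pencil_split0 e.
have detM : \det (B - c *: A) = 0.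
  move/eqP: e0; rewrite (bigD1 i) //= cr subrr mul0r mulf_eq0 (negbTE nzadj).
  by move=> /eqP.
exists c; split=> //.
  apply/eqP; rewrite eqn_leq; apply/andP; split.
    rewrite -ltnS ltn_neqAle rank_leq_row andbT.
    apply: contra_eqN detM => /eqP rkM; rewrite -unitfE -unitmxE -row_free_unit.
    by rewrite /row_free rkM.
  have := rk (r i); have -> : \adj A *m B - (r i)%:M = \adj A *m (B - c *: A).
    by rewrite mulmxBr -scalemxAr mul_adj_mx scale_scalar_mx /c divfK.
  by rewrite eqmxMfull // row_full_unit unit_adj.
move/eqP: e1; rewrite big1 => [|l _]; first by rewrite mulf_eq0 (negbTE nzadj) => /eqP.
have [k [nkl rk0]] : exists k, k != l /\ r k = r i.
  by have [eli|nli] := eqVneq l i; [exists j; rewrite eli eq_sym|exists i; rewrite eq_sym].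
by rewrite (bigD1 k) //= cr rk0 subrr mul0r mulr0.
Qed.

End Tangency.

Lemma separable_root_dvdp (K : closedFieldType) (p q : {poly K}) : separable_poly p ->
  (forall x, root p x -> root q x) -> p %| q.
Proof.
move=> sep rts; have nzp := separable_poly_neq0 sep.
have [rs pE] := closed_field_poly_normal p.
have nzl : lead_coef p != 0 by rewrite lead_coef_eq0.
have urs : uniq rs.
  rewrite -separable_prod_XsubC -(eqp_separable (p := p)) //.
  by rewrite {1}pE eqp_scale.
rewrite pE dvdpZl //; apply: uniq_roots_dvdp; last by rewrite uniq_rootsE.
apply/allP => x xrs; apply: rts; rewrite pE rootZ // root_prod_XsubC //.
Qed.

(** * Characters of the general linear group *)

(* A character of GL_n over a closed field is a power of the determinant as soon as
   it is so on scalar matrices: diagonal matrices reduce to diag(z, 1, ..., 1), which is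
   an n-th power up to conjugation, and every unit is a quotient of two matrices with
   distinct eigenvalues. *)
Section Character.
Variables (K : numClosedFieldType) (n k : nat) (chi : 'M[K]_n.+1 -> K).
Hypothesis chiM : forall g h, chi (g *m h) = chi g * chi h.
Hypothesis chi_scalar : forall z, chi z%:M = z ^+ (n.+1 * k).

Let chi1 : chi 1%:M = 1. Proof. by rewrite chi_scalar expr1n. Qed.

Let chi_conj p g : p \in unitmx -> chi (invmx p *m g *m p) = chi g.
Proof.
by move=> up; rewrite !chiM mulrAC -chiM mulVmx // chi1 mul1r.
Qed.

Let D (i : 'I_n.+1) z := diag_mx (\row_j (if j == i then z else 1 : K)).

Let prodD (r : 'I_n.+1 -> K) : diag_mx (\row_j r j) = \big[mulmx/1%:M]_j D j (r j).
Proof.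
have -> s : \big[mulmx/1%:M]_(j <- s) D j (r j) =
    diag_mx (\row_l \prod_(j <- s) (if l == j then r j else 1)).
  elim: s => [|j s IH].
    by rewrite big_nil; apply/matrixP => a b; rewrite !mxE big_nil.
  rewrite big_cons IH mulmx_diag; congr diag_mx; apply/rowP => l.
  by rewrite !mxE big_cons.
congr diag_mx; apply/rowP => l; rewrite !mxE -big_mkcond /=.
by rewrite (eq_bigl (pred1 l)) ?big_pred1_eq // => j; rewrite eq_sym.
Qed.

Let chi_prod (r : 'I_n.+1 -> 'M[K]_n.+1) : chi (\big[mulmx/1%:M]_j r j) = \prod_j chi (r j).
Proof. exact: big_morph. Qed.

Let chi_D i z : chi (D i z) = z ^+ k.
Proof.
have DE j w : chi (D j w) = chi (D i w).
  have up : @tperm_mx K _ i j \in unitmx by apply: unitmx_perm.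
  rewrite -(chi_conj _ up); congr chi; apply: (can_inj (mulKmx up)).
  rewrite -mulmxA mulKVmx //; apply/matrixP => a b; rewrite mul_mx_diag mul_diag_mx !mxE.
  case: (tperm i j a =P b) => [<-|_]; last by rewrite mul0r mulr0.
  rewrite mulrC; congr (_ * _); rewrite (canF_eq (tpermK i j)) tpermL.
  by [].
have De w : chi (D i w) ^+ n.+1 = w ^+ (n.+1 * k).
  rewrite -chi_scalar.
  have -> : w%:M = diag_mx (\row_j w) :> 'M[_]_n.+1 by apply/matrixP => a b; rewrite !mxE.
  rewrite prodD chi_prod (eq_bigr (fun=> chi (D i w))) => [|j _]; last exact: DE.
  by rewrite prodr_const card_ord.
have DM v w : chi (D i (v * w)) = chi (D i v) * chi (D i w).
  rewrite -chiM; congr chi; rewrite mulmx_diag; congr diag_mx.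
  by apply/rowP => j; rewrite !mxE; case: eqP => // _; rewrite mulr1.
have DX v m : chi (D i (v ^+ m)) = chi (D i v) ^+ m.
  elim: m => [|m IH]; last by rewrite !exprS DM IH.
  rewrite !expr0 -[RHS]chi1; congr chi; apply/matrixP => a b; rewrite !mxE.
  by case: (a == i).
by rewrite -(rootCK (ltn0Sn n) z) DX De exprM.
Qed.

Let chi_diagonalizable g : g \in unitmx -> disc_mx g != 0 -> chi g = \det g ^+ k.
Proof.
move=> ug; have [r gr _] := char_poly_split g.
move=> /(disc_mx_neq0P gr) inj.
have /diagonalizableP : exists2 rs, uniq rs & mxminpoly g %| \prod_(x <- rs) ('X - x%:P).
  exists [seq r i | i <- enum 'I_n.+1]; first by rewrite map_inj_uniq ?enum_uniq.
  by rewrite big_map big_enum -gr mxminpoly_dvd_char.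
move=> [P uP simP]; have [d /(similarRL uP) e] := similar_diagPex simP.
have -> : g = invmx P *m diag_mx d *m P by rewrite e !mulmxA mulVmx // mul1mx mulmxKV.
rewrite chi_conj // !det_mulmx mulrAC -det_mulmx mulVmx // det1 mul1r det_diag -prodrXl.
have -> : d = \row_j d 0 j by apply/rowP => j; rewrite mxE.
by rewrite prodD chi_prod; apply: eq_bigr => j _; rewrite chi_D mxE.
Qed.

Lemma character_unitmx g : g \in unitmx -> chi g = \det g ^+ k.
Proof.
move=> ug; pose d : 'M[K]_n.+1 := diag_mx (\row_i (i.+1)%:R).
have nzd : disc_mx d != 0.
  apply/disc_mx_diag_neq0 => a b /eqP; rewrite eqr_nat eqSS => /eqP e.
  exact: val_inj.
have nzdet : \det d != 0.
  rewrite det_diag prodf_seq_neq0; apply/allP => i _; rewrite mxE pnatr_eq0 //.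
(* With h = (g^-1 + s) d one has g h = (1 + s g) d. The discriminants of h and g h are polynomials
   in s, nonzero because the first has top coefficient disc d and the second has value disc d at 0;
   p3 ensures that g h is invertible. *)
pose p1 := disc_mx (line_mx (invmx g *m d) d).
pose p2 := disc_mx (line_mx d (g *m d)).
pose p3 := \det (map_mx polyC 1%:M + 'X *: map_mx polyC g).
have nzp1 : p1 != 0.
  have [_ top] := top_coef_disc (invmx g *m d) d.
  by apply: contraNneq nzd => z; rewrite -top -/p1 z coef0.
have nzp2 : p2 != 0.
  apply: contraNneq nzd => z; have := horner_disc_pencil d (g *m d) 0.
  by rewrite scale0r addr0 => <-; rewrite -/p2 z horner0.
have hp3 s : p3.[s] = \det (1%:M + s *: g).
  rewrite -[LHS]/(horner_eval s _) -det_map_mx.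
  by rewrite [map_mx (horner_eval s) _](horner_line_mx 1%:M g s).
have nzp3 : p3 != 0.
  by apply: contra_neq (oner_neq0 K) => z; rewrite -(det1 _ n.+1) -(addr0 1%:M)
    -(scale0r g) -hp3 z horner0.
have [s] := poly_nonroot (mulf_neq0 (mulf_neq0 nzp1 nzp2) nzp3).
rewrite !hornerM !mulf_eq0 !negb_or hp3 => /andP[/andP[nz1 nz2] nz3].
pose h := invmx g *m d + s *: d.
have ghE : g *m h = (1%:M + s *: g) *m d.
  by rewrite mulmxDr mulKVmx // mulmxDl mul1mx -scalemxAl -scalemxAr.
have ugh : g *m h \in unitmx.
  by rewrite ghE unitmxE det_mulmx unitfE mulf_neq0.
have uh : h \in unitmx by move: ugh; rewrite unitmx_mul ug.
have e1 : chi h = \det h ^+ k.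
  by apply: (chi_diagonalizable uh); rewrite /h -horner_disc_pencil; exact: nz1.
have e2 : chi (g *m h) = \det (g *m h) ^+ k.
  apply: chi_diagonalizable => //; rewrite ghE mulmxDl mul1mx -scalemxAl.
  by rewrite -horner_disc_pencil.
have nzh : \det h ^+ k != 0 by rewrite expf_neq0 // -unitfE -unitmxE.
by apply: (mulIf nzh); rewrite -{1}e1 -chiM e2 det_mulmx exprMn.
Qed.

End Character.

(** * Coordinates on symmetric matrices *)

Lemma card_ord_le_pairs e : #|[set p : 'I_e * 'I_e | (p.1 <= p.2)%N]| = 'C(e.+1, 2).
Proof.
rewrite -sum1dep_card -(pair_big_dep xpredT (fun i j : 'I_e => (i <= j)%N) (fun _ _ => 1%N)) /=.
rewrite (exchange_big_dep xpredT) //= -triangular_sum big_nat_recl // add0n big_mkord.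
apply: eq_bigr => j _; rewrite -(big_ord_widen_cond _ xpredT (fun _ => 1%N) (ltn_ord j)).
  by rewrite sum1_card card_ord.
Qed.

(** The entries on and above the diagonal are coordinates. *)
Lemma dim_sym_mx (R : realType) e : \dim (sym_mx R e) = 'C(e.+1, 2).
Proof.
pose I := [set p : 'I_e * 'I_e | (p.1 <= p.2)%N].
pose C := Complex R.
pose F (A : 'M[C]_e) : 'rV[C]_#|I| := \row_k A (enum_val k).1 (enum_val k).2.
have F_lin : linear F by move=> a A B; apply/rowP => k; rewrite !mxE.
pose FL : {linear 'M[C]_e -> 'rV[C]_#|I|} := HB.pack F (GRing.isLinear.Build _ _ _ _ _ F_lin).
have FE A : linfun FL A = F A by rewrite lfunE.
rewrite -(@limg_dim_eq _ _ _ (linfun FL)).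
  suff -> : (linfun FL @: sym_mx R e)%VS = fullv.
    by rewrite dimvf /dim /= mul1n card_ord_le_pairs.
  apply/vspaceP => v; rewrite memvf; apply/memv_imgP.
  pose r (i j : 'I_e) : C := if [pick k : 'I_#|I| | enum_val k == (i, j)] is Some k
    then v 0 k else 0.
  pose A : 'M[C]_e := \matrix_(i, j) if (i <= j)%N then r i j else r j i.
  exists A.
    apply/sym_mxP/matrixP => i j; rewrite !mxE.
    by case: (ltngtP i j) => // /val_inj ->.
  apply/rowP => k; rewrite FE !mxE.
  have := enum_valP k; rewrite inE => ->; rewrite /r; case: pickP => [k'|/(_ k)].
    by rewrite -surjective_pairing => /eqP /enum_val_inj ->.
  by rewrite -surjective_pairing eqxx.
apply/eqP; rewrite -subv0; apply/subvP => A.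
rewrite memv_cap memv0 => /andP[/sym_mxP symA]; rewrite memv_ker FE => /eqP F0.
apply/eqP/matrixP => i j; rewrite mxE.
wlog le_ij : i j / (i <= j)%N => [W|].
  by case/orP: (leq_total i j) => [/W //|/W <-]; rewrite -{1}symA mxE.
have ijI : (i, j) \in I by rewrite inE.
have := congr1 (fun v : 'rV_#|I| => v 0 (enum_rank_in ijI (i, j))) F0.
by rewrite !mxE enum_rankK_in.
Qed.

Section Coordinates.
Variables (R : realType) (e f N : nat) (bas : N.-tuple (Sym2 R e)).
Hypothesis bas_basis : basis_of {:Sym2 R e} bas.
Local Notation C := (Complex R).
Local Notation V := (HomSym2 R e f).
Implicit Types (psi : V) (S : Sym2 R e).

Definition crd (S : Sym2 R e) : 'cV[C]_N := \col_j coord bas j S.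
Definition uncrd (a : 'cV[C]_N) : Sym2 R e := \sum_j a j 0 *: bas`_j.
Definition sym_of (a : 'cV[C]_N) : 'M[C]_e := vsval (uncrd a).

Lemma crdK S : uncrd (crd S) = S.
Proof.
rewrite [RHS](coord_basis bas_basis (memvf S)); apply: eq_bigr => j _.
by rewrite mxE.
Qed.

Lemma uncrdK a : crd (uncrd a) = a.
Proof.
apply/matrixP => i j; rewrite !mxE ord1 coord_sum_free //.
exact: basis_free bas_basis.
Qed.

Lemma crd_linear : linear crd.
Proof. by move=> c S T; apply/matrixP => i j; rewrite !mxE linearP. Qed.

Lemma uncrd_linear : linear uncrd.
Proof.
move=> c a b; rewrite /uncrd scaler_sumr -big_split; apply: eq_bigr => j _.
by rewrite !mxE scalerDl scalerA.
Qed.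

Lemma sym_of_linear : linear sym_of.
Proof. by move=> c a b; rewrite /sym_of uncrd_linear linearP. Qed.

HB.instance Definition _ := GRing.isLinear.Build _ _ _ _ crd crd_linear.
HB.instance Definition _ := GRing.isLinear.Build _ _ _ _ uncrd uncrd_linear.
HB.instance Definition _ := GRing.isLinear.Build _ _ _ _ sym_of sym_of_linear.

Lemma sym_ofT a : (sym_of a)^T = sym_of a.
Proof. by apply/sym_mxP; apply: subvsP. Qed.

Lemma sym_of_crd S : sym_of (crd S) = vsval S.
Proof. by rewrite /sym_of crdK. Qed.

Definition mx_of (psi : V) : 'M[C]_(f, N) := \matrix_(k, j) psi bas`_j k 0.

Lemma mx_ofE psi S : psi S = mx_of psi *m crd S.
Proof.
rewrite -[S in LHS]crdK linear_sum; apply/matrixP => k j.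
rewrite ord1 summxE mxE; apply: eq_bigr => l _.
by rewrite linearZ !mxE mulrC.
Qed.

Lemma mx_of_uncrd psi a : psi (uncrd a) = mx_of psi *m a.
Proof. by rewrite mx_ofE uncrdK. Qed.

Lemma mx_of_linear : linear mx_of.
Proof. by move=> c psi psi'; apply/matrixP => i j; rewrite !mxE add_lfunE scale_lfunE !mxE. Qed.

HB.instance Definition _ := GRing.isLinear.Build _ _ _ _ mx_of mx_of_linear.

Definition hom_of (M : 'M[C]_(f, N)) : V := linfun (mulmx M \o crd).

Lemma crd_delta (j : 'I_N) : crd bas`_j = delta_mx j 0.
Proof.
apply/matrixP => i l; rewrite !mxE ord1 andbT coord_free ?(basis_free bas_basis) //.
by rewrite -val_eqE eq_sym.
Qed.

Lemma hom_ofK M : mx_of (hom_of M) = M.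
Proof.
apply/matrixP => k j; rewrite mxE lfunE /=.
by rewrite crd_delta -colE mxE.
Qed.

Lemma mx_of_inj : injective mx_of.
Proof. by move=> p q epq; apply/lfunP => S; rewrite !mx_ofE epq. Qed.

Lemma mx_ofK psi : hom_of (mx_of psi) = psi.
Proof. by apply: mx_of_inj; rewrite hom_ofK. Qed.

Lemma hom_of_linear : linear hom_of.
Proof. by move=> c A B; apply: mx_of_inj; rewrite linearP /= !hom_ofK. Qed.

End Coordinates.

(** * The equation of the tangent pencils *)

Lemma linear_delta_sum (K : fieldType) N m p (h : {linear 'cV[K]_N -> 'M[K]_(m, p)}) a :
  h a = \sum_l a l 0 *: h (delta_mx l 0).
Proof.
rewrite {1}[a]matrix_sum_delta linear_sum; apply: eq_bigr => l _.
by rewrite big_ord1 linearZ.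
Qed.

(* [V] is Hom(Sym^2(K^e), K^f), with e = n + 2 and f + 2 = dim Sym^2(K^e), seen through
   its matrices [mx psi] in a basis of Sym^2, whose elements are sent by [sy] to
   symmetric matrices. *)
Section Charts.
Variables (K : numClosedFieldType) (n f : nat) (V : vectType K).
Local Notation N := (f + 2)%N.
Variables (mx : {linear V -> 'M[K]_(f, N)}) (sy : {linear 'cV[K]_N -> 'M[K]_n.+2}).
Implicit Types (psi : V) (x y : 'rV[K]_N).

Definition kernel_mx psi x : 'M[K]_n.+2 := sy (kvec (mx psi) x).
(* The superfluous factor det(kernel_mx psi x) makes [chart_den] vanish where that
   determinant does, even for n = 0. *)
Definition chart_num psi x y :=
  \det (kernel_mx psi x) * disc_mx (\adj (kernel_mx psi x) *m kernel_mx psi y).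
Definition chart_den psi x y :=
  plucker (mx psi) x y ^+ (n.+2 * n.+1) * \det (kernel_mx psi x) ^+ (n.+1 * n).+1.

Lemma rep_mx : repmx (@ev K V) mx.
Proof.
apply: repmxP => i j; apply: rep_linear => a u v.
by rewrite linearP !mxE.
Qed.

Lemma rep_plucker x y : rep (@ev K V) (fun psi => plucker (mx psi) x y).
Proof.
apply: rep_det; apply: repmxP => i j; elim/frame_mx_ind: i => [i||].
- by under eq_fun do rewrite frame_mxl; apply: repmx_entry; apply: rep_mx.
- by under eq_fun do rewrite frame_mx_penult; apply: rep_const.
- by under eq_fun do rewrite frame_mx_last; apply: rep_const.
Qed.

Lemma rep_kmx x : repmx (@ev K V) (kernel_mx^~ x).
Proof.
apply: repmxP => i j.
apply: (@rep_eq _ _ _ _ (fun psi =>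
   \sum_l plucker (mx psi) x (delta_mx 0 l) * sy (delta_mx l 0) i j)).
  move=> psi; rewrite /kernel_mx linear_delta_sum summxE; apply: eq_bigr => l _.
  by rewrite [RHS]mxE; congr (_ * _); rewrite mxE.
by apply: rep_sum => l; apply: repM; [apply: rep_plucker|apply: rep_const].
Qed.

Lemma rep_num x y : rep (@ev K V) (fun psi => chart_num psi x y).
Proof.
apply: repM; first by apply: rep_det; apply: rep_kmx.
by apply: rep_disc; apply: repmxM; [apply: repmx_adj|]; apply: rep_kmx.
Qed.

Lemma rep_den x y : rep (@ev K V) (fun psi => chart_den psi x y).
Proof.
by apply: repM; apply: repX; [apply: rep_plucker|apply: rep_det; apply: rep_kmx].
Qed.

Lemma den_neq0 psi x y : plucker (mx psi) x y != 0 -> \det (kernel_mx psi x) != 0 ->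
  chart_den psi x y != 0.
Proof. by move=> nzw nzd; rewrite mulf_neq0 // expf_neq0. Qed.

Lemma den_neq0W psi x y : chart_den psi x y != 0 ->
  plucker (mx psi) x y != 0 /\ \det (kernel_mx psi x) != 0.
Proof. by rewrite mulf_eq0 negb_or !expf_eq0 /= => /andP[]. Qed.

(** By a quadratic Pluecker relation, the two bases of the kernel differ by a matrix of determinant
    w' / w; the exponents of [chart_den] are those with which [disc_pencil] compensates this
    change. *)
Lemma num_den psi x y x' y' :
  plucker (mx psi) x y != 0 -> plucker (mx psi) x' y' != 0 ->
  \det (kernel_mx psi x) != 0 -> \det (kernel_mx psi x') != 0 ->
  chart_num psi x' y' * chart_den psi x y = chart_num psi x y * chart_den psi x' y'.
Proof.
move=> nzw nzw' nzd nzd'; rewrite /chart_den /chart_num.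
have := kvec_span nzw (kvec_ker (mx psi) x'); have := kvec_span nzw (kvec_ker (mx psi) y').
rewrite !kvecP !mxE !mulr1n.
set w := plucker (mx psi) x y in nzw *; set w' := plucker (mx psi) x' y'.
set xx := plucker _ x' x; set yx := plucker _ x' y.
set xy := plucker _ y' x; set yy := plucker _ y' y.
move=> ky' kx'.
have wE : w' * w = yx * (- xy) + xx * yy.
  have := kvecP (mx psi) x' y'; rewrite kx' mulmxBr -!scalemxAr !kvecP.
  move=> /(congr1 (fun M : 'M[_]_1 => M 0 0)); rewrite !mxE !mulr1n -/w' => <-.
  rewrite (plucker_sym _ y' x) (plucker_sym _ y' y) -/xy -/yy.
  by field.
have kx'E : kernel_mx psi x' = (yx / w) *: kernel_mx psi x + (- (xx / w)) *: kernel_mx psi y.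
  by rewrite /kernel_mx kx' linearB !linearZ_LR /= scalerN scaleNr.
have ky'E : kernel_mx psi y' = (yy / w) *: kernel_mx psi x + (- (xy / w)) *: kernel_mx psi y.
  by rewrite /kernel_mx ky' linearB !linearZ_LR /= scalerN scaleNr.
have := disc_pencil (yy / w) (- (xy / w)) nzd (B := kernel_mx psi y)
  (a := yx / w) (b := - (xx / w)).
rewrite -kx'E -ky'E => /(_ nzd').
have -> : yx / w * - (xy / w) - - (xx / w) * (yy / w) = w' / w.
  by rewrite -[w'](mulfK nzw) wE; field.
rewrite expr_div_n [n.+1.-1]/=; move: (n.+2 * n.+1)%N (n.+1 * n)%N => p q e.
have nzwp : w ^+ p != 0 by rewrite expf_neq0.
rewrite !exprS; set d := \det (kernel_mx psi x) in nzd e *; set d' := \det (kernel_mx psi x') in nzd' e *.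
set D := disc_mx (\adj (kernel_mx psi x) *m _) in e *; set D' := disc_mx _ in e *.
transitivity (d * d' * w ^+ p * (D' * d ^+ q)); first by ring.
by rewrite e; field.
Qed.

End Charts.

Lemma adj_scalar_mx (K : fieldType) n (c : K) : c != 0 ->
  \adj (c%:M) = (c ^+ n.+1)%:M :> 'M[K]_n.+2.
Proof.
move=> nzc; have uc : c%:M \in @unitmx K n.+2.
  by rewrite unitmxE det_scalar unitfE expf_neq0.
apply: (can_inj (mulKmx uc)); rewrite mul_mx_adj det_scalar.
by rewrite mul_scalar_mx scale_scalar_mx -exprS.
Qed.

Section Construction.
Variables (K : numClosedFieldType) (n f' : nat) (V : vectType K).
Local Notation f := f'.+1.
Local Notation N := (f + 2)%N.
Variables (mx : {linear V -> 'M[K]_(f, N)}) (hom : 'M[K]_(f, N) -> V).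
Variable sy : {linear 'cV[K]_N -> 'M[K]_n.+2}.
Hypothesis homK : cancel hom mx.
Local Notation first := (lshift 2 (0 : 'I_f)).
Local Notation last := (last f).
Local Notation penult := (penult f).
Variables (B0 C0 : 'M[K]_n.+2).
Hypotheses (sy_first : sy (delta_mx first 0) = C0) (sy_penult : sy (delta_mx penult 0) = B0)
  (sy_last : sy (delta_mx last 0) = 1%:M).
Hypotheses (nzB : disc_mx B0 != 0) (nzC : disc_mx C0 != 0).

Local Notation num := (chart_num mx sy).
Local Notation den := (chart_den mx sy).
Local Notation kmx := (kernel_mx mx sy).

(* The pencil [split_pt] is spanned by B0 and 1, and [nilp_pt] by C0 and 1; the sum of
   [nilp_pt] and a nonzero multiple of [split_pt] lies in the chart of [split_pt]. *)
Definition split_pt := hom (\matrix_(i, j) ((j : nat) == i)%:R).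
Definition nilp_pt := hom (\matrix_(i, j) ((j : nat) == i.+1)%:R).
Definition row_first : 'rV[K]_N := delta_mx 0 first.
Definition row_penult : 'rV[K]_N := delta_mx 0 penult.
Definition row_last : 'rV[K]_N := delta_mx 0 last.

Let ix (k : nat) : 'I_N := insubd first k.

Let ixE (i : 'I_N) : ix i = i. Proof. exact: valKd. Qed.

Let val_ix k : (k < N)%N -> ix k = k :> nat.
Proof. by move=> lt; rewrite /ix val_insubd lt. Qed.

Let mul_shift c (a : 'cV[K]_N) (i : 'I_f) : (c <= 1)%N ->
  (\matrix_(i < f, j < N) ((j : nat) == c + i)%N%:R *m a) i 0 = a (ix (c + i)%N) 0.
Proof.
move=> le_c; have lt : (c + i < N)%N by move: (ltn_ord i); lia.
rewrite mxE (bigD1 (ix (c + i)%N)) //= big1 ?addr0 => [|j nj].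
  by rewrite mxE val_ix // eqxx mul1r.
rewrite mxE (_ : (_ == _) = false) ?mul0r //; apply: contraNF nj => /eqP e.
by rewrite -e ixE.
Qed.

Let line_pt s : mx (nilp_pt + s *: split_pt) =
  \matrix_(i < f, j < N) ((j : nat) == 1 + i)%N%:R + s *: \matrix_(i < f, j < N) ((j : nat) == 0 + i)%N%:R.
Proof. by rewrite linearD linearZ /= !homK. Qed.

Let line_pt_mul s (a : 'cV[K]_N) (i : 'I_f) : (mx (nilp_pt + s *: split_pt) *m a) i 0 =
  a (ix i.+1) 0 + s * a (ix i) 0.
Proof. by rewrite line_pt mulmxDl -scalemxAl mxE [X in _ + X]mxE !mul_shift. Qed.

Let row_mul (j : 'I_N) (a : 'cV[K]_N) : delta_mx 0 j *m a = (a j 0)%:M :> 'M[K]_1.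
Proof. by rewrite -rowE; apply/matrixP => i k; rewrite !mxE !ord1 mulr1n. Qed.

Let scal0 (z : K) : z%:M = 0 :> 'M[_]_1 -> z = 0.
Proof. by move/matrixP/(_ 0 0); rewrite !mxE mulr1n. Qed.

Let cV0 (a : 'cV[K]_N) : (forall k, (k < N)%N -> a (ix k) 0 = 0) -> a = 0.
Proof.
move=> H; apply/matrixP => i j; rewrite ord1 mxE -(ixE i); exact: H.
Qed.

Let first_val : first = 0%N :> nat. Proof. by []. Qed.
Let penult_val : penult = f :> nat. Proof. by rewrite /= addn0. Qed.
Let last_val : last = f.+1 :> nat. Proof. by rewrite /= addn1. Qed.

Let ix_first : ix 0 = first. Proof. by rewrite -[RHS]ixE first_val. Qed.
Let ix_penult : ix f = penult. Proof. by rewrite -[RHS]ixE penult_val. Qed.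
Let ix_last : ix f.+1 = last. Proof. by rewrite -[RHS]ixE last_val. Qed.

Let plucker_line s : s != 0 ->
  plucker (mx (nilp_pt + s *: split_pt)) row_penult row_last != 0.
Proof.
move=> nzs; apply: plucker_neq0 => a Ma; rewrite !row_mul.
move=> /scal0 af /scal0 al; apply: cV0 => k ltN; have lt : (k < f.+2)%N by rewrite -(addn2 f).
have [->|lt_k] := eqVneq k f.+1; first by rewrite ix_last.
have le_k : (k <= f)%N by move: lt_k lt; lia.
(* Descending induction on k: the equation a_(k+1) + s a_k = 0, with s nonzero, carries the
   vanishing from a_f down to a_0. *)
move: le_k; elim/ltn_ind: {k ltN lt lt_k}(f - k)%N {-2}k (erefl (f - k)%N) => d IH k dE le_k.
have [->|ne] := eqVneq k f; first by rewrite ix_penult.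
have lt_k : (k < f)%N by rewrite ltn_neqAle ne.
have /matrixP/(_ (Ordinal lt_k) 0) := Ma; rewrite line_pt_mul mxE /=.
rewrite (IH (f - k.+1)%N) //; last by move: lt_k dE; lia.
by rewrite add0r => /eqP; rewrite mulf_eq0 (negbTE nzs) => /eqP.
Qed.

Let scalar_chart psi x y c (M : 'M[K]_n.+2) : c != 0 ->
  kmx psi x = c%:M -> kmx psi y = (- c) *: M -> disc_mx M != 0 -> num psi x y != 0.
Proof.
move=> nzc ex ey nzM; rewrite /chart_num ex ey; apply: mulf_neq0; first by rewrite det_scalar expf_neq0.
by rewrite adj_scalar_mx // mul_scalar_mx scalerA disc_mxZ mulf_neq0 // expf_neq0 // mulf_neq0 ?expf_neq0 ?oppr_eq0.
Qed.

Let kmx_last psi x y (c : K) : plucker (mx psi) x y = c -> c != 0 ->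
  mx psi *m (delta_mx last 0 : 'cV[K]_N) = 0 -> x *m (delta_mx last 0 : 'cV[K]_N) = 0 ->
  y *m (delta_mx last 0 : 'cV[K]_N) = 1%:M -> kmx psi x = c%:M.
Proof.
move=> ec nzc Ml xl yl; rewrite /kernel_mx -(@kvec_unique _ _ _ x y (c *: delta_mx last 0)).
- by rewrite linearZ /= sy_last scale_scalar_mx mulr1.
- by rewrite ec.
- by rewrite -scalemxAr Ml scaler0.
- by rewrite -scalemxAr xl scaler0.
- by rewrite -scalemxAr yl ec scale_scalar_mx mulr1.
Qed.

Let kmx_other psi x y (c : K) j (M : 'M[K]_n.+2) : plucker (mx psi) x y = c -> c != 0 ->
  mx psi *m (delta_mx j 0 : 'cV[K]_N) = 0 -> x *m (delta_mx j 0 : 'cV[K]_N) = 1%:M ->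
  y *m (delta_mx j 0 : 'cV[K]_N) = 0 -> sy (delta_mx j 0) = M -> kmx psi y = (- c) *: M.
Proof.
move=> ec nzc Mj xj yj <-; rewrite /kernel_mx -(@kvec_unique2 _ _ _ x y (- c *: delta_mx j 0)).
- by rewrite linearZ.
- by rewrite ec.
- by rewrite -scalemxAr Mj scaler0.
- by rewrite -scalemxAr xj ec scale_scalar_mx mulr1.
- by rewrite -scalemxAr yj scaler0.
Qed.

Let dd (i j : 'I_N) : delta_mx 0 i *m (delta_mx j 0 : 'cV[K]_N) = (i == j)%:R%:M :> 'M[_]_1.
Proof. by rewrite row_mul mxE eqxx andbT. Qed.

Let nfl : first == last = false. Proof. by []. Qed.
Let npl : penult == last = false.
Proof.
apply/negbTE/eqP => /(congr1 (@nat_of_ord N)); rewrite penult_val last_val.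
exact: n_Sn.
Qed.

Let mx_split (a : 'cV[K]_N) (i : 'I_f) : (mx split_pt *m a) i 0 = a (ix i) 0.
Proof. by rewrite homK -(mul_shift (c := 0)). Qed.

Let mx_nilp (a : 'cV[K]_N) (i : 'I_f) : (mx nilp_pt *m a) i 0 = a (ix i.+1) 0.
Proof. by rewrite homK -(mul_shift (c := 1)). Qed.

Let mx_delta0 (M : 'M[K]_(f, N)) j : (forall (i : 'I_f), (M *m delta_mx j (0 : 'I_1)) i 0 = 0) ->
  M *m delta_mx j (0 : 'I_1) = 0.
Proof. by move=> H; apply/matrixP => i k; rewrite ord1 H mxE. Qed.

Let ix_neq k (j : 'I_N) : (k < N)%N -> k != j -> ix k == j = false.
Proof.
move=> lt ne; apply: contraNF ne => /eqP <-; rewrite val_ix //.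
Qed.

Let plucker_split : plucker (mx split_pt) row_penult row_last != 0.
Proof.
apply: plucker_neq0 => a Ma; rewrite !row_mul => /scal0 af /scal0 al; apply: cV0 => k ltN.
have lt : (k < f.+2)%N by rewrite -(addn2 f).
have [->|lt_k] := eqVneq k f.+1; first by rewrite ix_last.
have [->|ne_k] := eqVneq k f; first by rewrite ix_penult.
have lt_kf : (k < f)%N by move: lt lt_k ne_k; lia.
by have /matrixP/(_ (Ordinal lt_kf) 0) := Ma; rewrite mx_split mxE.
Qed.

Let plucker_nilp : plucker (mx nilp_pt) row_first row_last != 0.
Proof.
apply: plucker_neq0 => a Ma; rewrite !row_mul => /scal0 af /scal0 al; apply: cV0 => -[|k] ltN.
  by rewrite ix_first.
have lt : (k.+1 < f.+2)%N by rewrite -(addn2 f).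
have [->|lt_k] := eqVneq k f; first by rewrite ix_last.
have lt_kf : (k < f)%N by move: lt lt_k; lia.
by have /matrixP/(_ (Ordinal lt_kf) 0) := Ma; rewrite mx_nilp mxE.
Qed.

Let ltN_f (i : 'I_f) k : (k <= 1)%N -> (k + i < N)%N.
Proof. by move=> le_k; move: (ltn_ord i); lia. Qed.

Let split_kill (j : 'I_N) : (f <= j)%N -> mx split_pt *m delta_mx j (0 : 'I_1) = 0.
Proof.
move=> le_j; apply: mx_delta0 => i; rewrite mx_split mxE ix_neq //.
  exact: (ltN_f i (k := 0)).
by rewrite ltn_eqF // (leq_trans (ltn_ord i)).
Qed.

Let nilp_kill (j : 'I_N) : (j == first) || (j == last) -> mx nilp_pt *m delta_mx j (0 : 'I_1) = 0.
Proof.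
move=> hj; apply: mx_delta0 => i; rewrite mx_nilp mxE ix_neq //.
  exact: (ltN_f i (k := 1)).
by case/orP: hj => /eqP ->; rewrite // last_val eqSS ltn_eqF.
Qed.

Lemma split_pt_kmx_penult :
  kmx split_pt row_penult = (plucker (mx split_pt) row_penult row_last)%:M.
Proof.
apply: (kmx_last (y := row_last)) => //.
- by apply: split_kill; rewrite last_val.
- by rewrite dd npl raddf0.
- by rewrite dd eqxx.
Qed.

Lemma split_pt_kmx_last :
  kmx split_pt row_last = - plucker (mx split_pt) row_penult row_last *: B0.
Proof.
apply: (kmx_other (x := row_penult) (j := penult)) => //.
- by apply: split_kill; rewrite penult_val.
- by rewrite dd eqxx.
- by rewrite dd eq_sym npl raddf0.
Qed.

Lemma split_pt_num : num split_pt row_penult row_last != 0.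
Proof.
exact: (scalar_chart plucker_split split_pt_kmx_penult split_pt_kmx_last nzB).
Qed.

Lemma nilp_pt_chart : num nilp_pt row_first row_last != 0 /\
  den nilp_pt row_first row_last != 0.
Proof.
have k1 : kmx nilp_pt row_first = (plucker (mx nilp_pt) row_first row_last)%:M.
  apply: (kmx_last (y := row_last)) => //.
  - by apply: nilp_kill; rewrite eqxx orbT.
  - by rewrite dd nfl raddf0.
  - by rewrite dd eqxx.
split; last by rewrite den_neq0 // k1 det_scalar expf_neq0.
apply: (scalar_chart plucker_nilp k1 _ nzC).
apply: (kmx_other (x := row_first) (j := first)) => //.
- by apply: nilp_kill; rewrite eqxx.
- by rewrite dd eqxx.
- by rewrite dd eq_sym nfl raddf0.
Qed.

Lemma line_pt_kmx s : s != 0 -> kmx (nilp_pt + s *: split_pt) row_penult =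
  (plucker (mx (nilp_pt + s *: split_pt)) row_penult row_last)%:M.
Proof.
move=> nzs; apply: (kmx_last (y := row_last)) => //.
- exact: plucker_line.
- rewrite linearD linearZ mulmxDl -scalemxAl nilp_kill ?eqxx ?orbT // split_kill ?last_val //.
  by rewrite scaler0 addr0.
- by rewrite dd npl raddf0.
- by rewrite dd eqxx.
Qed.

Lemma line_pt_den s : s != 0 -> den (nilp_pt + s *: split_pt) row_penult row_last != 0.
Proof.
move=> nzs; rewrite den_neq0 ?plucker_line // line_pt_kmx // det_scalar.
by rewrite expf_neq0 ?plucker_line.
Qed.

Lemma split_pt_den : den split_pt row_penult row_last != 0.
Proof.
by rewrite den_neq0 ?plucker_split // split_pt_kmx_penult det_scalar expf_neq0 ?plucker_split.
Qed.

(** Pluecker coordinates and kernel vectors are homogeneous of degree f in psi, hence the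
    determinant of a kernel matrix is of degree f (n + 2). *)
Definition den_degree := (f * (n.+2 * n.+1) + f * n.+2 * (n.+1 * n).+1)%N.

Lemma denZ psi c x y : den (c *: psi) x y = c ^+ den_degree * den psi x y.
Proof.
have cE : mx (c *: psi) = c%:M *m mx psi by rewrite linearZ mul_scalar_mx.
rewrite /chart_den /kernel_mx cE kvec_mull plucker_mull linearZ_LR detZ det_scalar.
rewrite /den_degree; move: (n.+2 * n.+1)%N (n.+1 * n).+1 => p q.
rewrite [(_ * plucker _ _ _) ^+ p]exprMn [(_ * \det _) ^+ q]exprMn mulrACA.
by rewrite exprD 3!exprM.
Qed.

(* The numerator is divisible by the denominator because a second chart has a denominator
   without common zero on the line through [nilp_pt] and [split_pt]. *)
Lemma discriminant_exists : exists P : mpoly (\dim {:V}) K,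
  [/\ forall psi x y, den psi x y != 0 -> peval P psi * den psi x y = num psi x y,
      peval P split_pt != 0 & peval P nilp_pt != 0].
Proof.
have [D0 D0E] := rep_den mx sy row_penult row_last.
have [D1 D1E] := rep_den mx sy row_first row_last.
have [M0 M0E] := rep_num mx sy row_penult row_last.
have [M1 M1E] := rep_num mx sy row_first row_last.
have nzD0 : exists psi, den psi row_penult row_last != 0.
  by exists split_pt; apply: split_pt_den.
have [nzM1 nzD1] := nilp_pt_chart.
have exD1 : exists psi, den psi row_first row_last != 0 by exists nilp_pt.
have rel : D1 * M0 = M1 * D0.
  apply: ev_ext => psi; apply/eqP; rewrite -subr_eq0 !rmorphM D0E D1E M0E M1E; apply/eqP.
  move: psi; apply: (@rep_ext _ _ _ (fun psi => den psi row_penult row_last * den psi row_first row_last)).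
  - apply: repD; first by apply: repM; [apply: rep_den|apply: rep_num].
    by apply: repN; apply: repM; [apply: rep_num|apply: rep_den].
  - by apply: repM; apply: rep_den.
  - have [psi [nz0 nz1]] := rep_nonzero2 (rep_den mx sy row_penult row_last)
      (rep_den mx sy row_first row_last) nzD0 exD1.
    by exists psi; rewrite mulf_neq0.
  - move=> psi; rewrite mulf_eq0 negb_or => /andP[/den_neq0W[w0 d0] /den_neq0W[w1 d1]].
    by rewrite (num_den w0 w1 d0 d1) mulrC subrr.
have [P PE] : exists P, M0 = P * D0.
  apply: (@line_coprime _ _ D0 D1 M0 M1 split_pt nilp_pt den_degree) => //.
  - by move=> c psi _; rewrite -!evE !D0E denZ.
  - by rewrite -evE D0E split_pt_den.
  - move=> s; rewrite -!evE D0E D1E => d0.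
    have [->|nzs] := eqVneq s 0; first by rewrite scale0r addr0.
    by move: (line_pt_den nzs); rewrite d0 eqxx.
have chart psi x y : den psi x y != 0 -> peval P psi * den psi x y = num psi x y.
  move=> nz; apply/eqP; rewrite -subr_eq0; apply/eqP.
  move: psi nz => psi0 nz; have exD : exists psi, den psi x y != 0 by exists psi0.
  move: psi0 {nz}; apply: (@rep_ext _ _ _ (fun psi => den psi row_penult row_last * den psi x y)).
  - apply: repD; first by apply: repM; [apply: rep_ev|apply: rep_den].
    by apply: repN; apply: rep_num.
  - by apply: repM; apply: rep_den.
  - have [psi [nz0 nz1]] := rep_nonzero2 (rep_den mx sy row_penult row_last)
      (rep_den mx sy x y) nzD0 exD.
    by exists psi; rewrite mulf_neq0.
  - move=> psi; rewrite mulf_eq0 negb_or => /andP[nz0 nz1].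
    have [w0 d0] := den_neq0W nz0; have [w1 d1] := den_neq0W nz1.
    apply: (mulIf nz0); rewrite mul0r mulrBl (num_den w0 w1 d0 d1) -M0E PE rmorphM D0E evE.
    by ring.
exists P; split=> //.
  have := chart _ _ _ split_pt_den; apply: contra_eq_neq => ->.
  by rewrite mul0r eq_sym split_pt_num.
have := chart _ _ _ nzD1; apply: contra_eq_neq => ->.
by rewrite mul0r eq_sym.
Qed.

End Construction.

(** * Semi-invariance *)

Lemma mulmx_col_inj (K : fieldType) m n (A B : 'M[K]_(m, n)) :
  (forall a : 'cV_n, A *m a = B *m a) -> A = B.
Proof.
move=> H; apply/matrixP => i j; have := H (delta_mx j 0).
by rewrite -!colE => /matrixP /(_ i 0); rewrite !mxE.
Qed.

Section SymmetricSquare.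
Variables (K : numClosedFieldType) (n N : nat).
Variables (sy : {linear 'cV[K]_N -> 'M[K]_n.+2}) (crd : 'M[K]_n.+2 -> 'cV[K]_N).
Hypotheses (syT : forall a, (sy a)^T = sy a) (syK : cancel sy crd)
  (crdK : forall S, S^T = S -> sy (crd S) = S).

Definition sym2_mx (g : 'M[K]_n.+2) : 'M[K]_N :=
  \matrix_(i, j) crd (g *m sy (delta_mx j 0) *m g^T) i 0.

Lemma sym2_mxE g a : sy (sym2_mx g *m a) = g *m sy a *m g^T.
Proof.
have -> : sym2_mx g *m a = \sum_j a j 0 *: crd (g *m sy (delta_mx j 0) *m g^T).
  apply/matrixP => i j; rewrite ord1 mxE summxE; apply: eq_bigr => l _.
  by rewrite mxE [RHS]mxE mulrC.
rewrite linear_sum (linear_delta_sum sy a) mulmx_sumr mulmx_suml.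
apply: eq_bigr => j _; rewrite linearZ_LR -scalemxAr -scalemxAl crdK //.
by rewrite !trmx_mul trmxK syT mulmxA.
Qed.

Lemma sym2_mxM g h : sym2_mx (g *m h) = sym2_mx g *m sym2_mx h.
Proof.
apply: mulmx_col_inj => a; apply: (can_inj syK).
by rewrite -[in RHS]mulmxA !sym2_mxE trmx_mul !mulmxA.
Qed.

Lemma sym2_mx_scalar z : sym2_mx z%:M = (z ^+ 2)%:M.
Proof.
apply: mulmx_col_inj => a; apply: (can_inj syK).
rewrite sym2_mxE tr_scalar_mx mul_scalar_mx mul_mx_scalar scalerA mul_scalar_mx.
by rewrite linearZ expr2.
Qed.

(** The left-hand side is a character; on scalars it is z^(2 N), and 2 N = (n + 2)(n + 3) determines
    the exponent. *)
Lemma det_sym2_mx g : (2 * N = n.+2 * n.+3)%N -> g \in unitmx ->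
  \det (sym2_mx g) = \det g ^+ n.+3.
Proof.
move=> hN; apply: (character_unitmx (chi := fun g => \det (sym2_mx g))).
  by move=> g1 g2; rewrite sym2_mxM det_mulmx.
by move=> z; rewrite sym2_mx_scalar det_scalar -exprM hN.
Qed.

End SymmetricSquare.

(** The field arithmetic of the chart computation, with t = det g and c the factor of the Pluecker
    coordinates; every power is treated as an independent nonzero quantity. *)
Lemma cancel_powers (K : fieldType) (c w d d' t D D' P P' : K) p q r s :
  c != 0 -> w != 0 -> d != 0 -> d' != 0 -> t != 0 ->
  D' * (t ^+ 2 * d) ^+ q = c ^+ 2 ^+ p * d' ^+ q * (t ^+ (2 * q + r) * D) ->
  P' * ((c * w) ^+ p * d' ^+ q.+1) = d' * D' ->
  P * (w ^+ p * d ^+ q.+1) = d * D ->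
  P' * t ^+ s = c ^+ p * t ^+ s * t ^+ r * P.
Proof.
move=> nzc nzw nzd nzd' nzt.
rewrite [_ ^+ 2 ^+ p]exprAC [(_ * d) ^+ q]exprMn [(c * w) ^+ p]exprMn (exprS d) (exprS d') exprD exprM.
have := expf_neq0 q nzd; have := expf_neq0 q nzd'; have := expf_neq0 p nzc.
have := expf_neq0 p nzw; have := expf_neq0 q (expf_neq0 2 nzt).
move: (c ^+ p) (w ^+ p) (d ^+ q) (d' ^+ q) (t ^+ 2 ^+ q) (t ^+ r) (t ^+ s).
move=> {c w t nzc nzw nzt} c w dq d'q tq tr ts nztq nzw nzc nzd'q nzdq e1 e2 e3.
have D'E : D' = P' * (c * w * d'q) by apply: (mulfI nzd'); rewrite -e2; ring.
have DE : D = P * (w * dq) by apply: (mulfI nzd); rewrite -e3; ring.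
suff -> : P' = c * tr * P by ring.
have nz : c * w * d'q * (tq * dq) != 0 by rewrite !mulf_neq0.
apply: (mulIf nz); move: e1; rewrite D'E DE => e1.
transitivity (P' * (c * w * d'q) * (tq * dq)); first by ring.
by rewrite e1; ring.
Qed.

Section Invariance.
Variables (K : numClosedFieldType) (n f : nat) (V : vectType K).
Local Notation N := (f + 2)%N.
Variables (mx : {linear V -> 'M[K]_(f, N)}) (hom : {linear 'M[K]_(f, N) -> V}).
Variables (sy : {linear 'cV[K]_N -> 'M[K]_n.+2}) (crd : 'M[K]_n.+2 -> 'cV[K]_N).
Hypotheses (homK : cancel hom mx) (mxK : cancel mx hom).
Hypotheses (syT : forall a, (sy a)^T = sy a) (syK : cancel sy crd)
  (crdK : forall S, S^T = S -> sy (crd S) = S) (hN : (2 * N = n.+2 * n.+3)%N).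
Variable P : mpoly (\dim {:V}) K.
Hypothesis chart : forall psi x y,
  chart_den mx sy psi x y != 0 -> peval P psi * chart_den mx sy psi x y = chart_num mx sy psi x y.
Hypothesis den_nonzero : exists psi x y, chart_den mx sy psi x y != 0.

Let sym2_unit g : g \in unitmx -> sym2_mx sy crd g \in unitmx.
Proof.
by move=> ug; rewrite unitmxE (det_sym2_mx syT syK crdK) // unitfE expf_neq0 // -unitfE -unitmxE.
Qed.

(** The forms x and y are moved along with psi, to x Sym^2(g)^-1 and y Sym^2(g)^-1; kernel vectors
    are then transported by Sym^2(g), up to the factor det h / det Sym^2(g). *)
Let semi_invariance_chart g h psi psi' x y : g \in unitmx -> h \in unitmx ->
  mx psi' *m sym2_mx sy crd g = h *m mx psi -> chart_den mx sy psi x y != 0 ->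
  peval P psi' * \det g ^+ (n.+3 * (n.+2 * n.+1)) =
  \det h ^+ (n.+2 * n.+1) * \det g ^+ (4 * n.+1) * peval P psi.
Proof.
move=> ug uh mE nzden; have := chart nzden; have [nzw nzA] := den_neq0W nzden.
have usg := sym2_unit ug; set sg := sym2_mx sy crd g in mE usg.
have dsg : \det sg = \det g ^+ n.+3 by apply: (det_sym2_mx syT syK crdK).
have nzg : \det g != 0 by rewrite -unitfE -unitmxE.
have nzh : \det h != 0 by rewrite -unitfE -unitmxE.
have nzsg : \det sg != 0 by rewrite dsg expf_neq0.
pose x' := x *m invmx sg; pose y' := y *m invmx sg.
pose c := \det h / \det sg.
have nzc : c != 0 by rewrite mulf_neq0 ?invr_eq0.
set w := plucker (mx psi) x y in nzw.
have w'E : plucker (mx psi') x' y' = c * w.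
  apply: (mulIf nzsg); rewrite -plucker_mul mE !mulmxKV // plucker_mull.
  by rewrite /c mulrAC divfK.
have nzw' : plucker (mx psi') x' y' != 0 by rewrite w'E mulf_neq0.
have kerM z : mx psi' *m (c *: (sg *m kvec (mx psi) z)) = 0.
  by rewrite -scalemxAr mulmxA mE -mulmxA kvec_ker mulmx0 scaler0.
have rowM r z : (r *m invmx sg) *m (c *: (sg *m kvec (mx psi) z)) =
    (c * plucker (mx psi) z r)%:M.
  by rewrite -scalemxAr mulmxA mulmxKV // kvecP scale_scalar_mx.
have kx' : kvec (mx psi') x' = c *: (sg *m kvec (mx psi) x).
  apply/esym/(kvec_unique nzw') => //; first by rewrite rowM plucker_xx mulr0 raddf0.
  by rewrite rowM w'E.
have ky' : kvec (mx psi') y' = c *: (sg *m kvec (mx psi) y).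
  apply/esym/(kvec_unique2 nzw') => //; last by rewrite rowM plucker_xx mulr0 raddf0.
  by rewrite rowM plucker_sym w'E mulrN.
set A := kernel_mx mx sy psi x in nzA; set B := kernel_mx mx sy psi y.
have A'E : kernel_mx mx sy psi' x' = c *: (g *m A *m g^T).
  by rewrite /kernel_mx kx' linearZ_LR (sym2_mxE syT crdK).
have B'E : kernel_mx mx sy psi' y' = c *: (g *m B *m g^T).
  by rewrite /kernel_mx ky' linearZ_LR (sym2_mxE syT crdK).
set A1 := g *m A *m g^T in A'E; set B1 := g *m B *m g^T in B'E.
have dA1 : \det A1 = \det g ^+ 2 * \det A by rewrite !det_mulmx det_tr; ring.
have nzA1 : \det A1 != 0 by rewrite dA1 mulf_neq0 ?expf_neq0.
have nzcA1 : \det (c *: A1) != 0 by rewrite detZ mulf_neq0 ?expf_neq0.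
have nzden' : chart_den mx sy psi' x' y' != 0 by rewrite den_neq0 // A'E.
have := chart nzden'; rewrite /chart_den /chart_num A'E B'E w'E -/w -/A -/B.
have := disc_pencil 0 c nzA1 (B := B1) (a := c) (b := 0).
rewrite !scale0r addr0 add0r mulr0 subr0 => /(_ nzcA1).
have uA : A \in unitmx by rewrite unitmxE unitfE.
rewrite (disc_pencil_congr B uA ug) dA1 /= -expr2.
have -> : \det h ^+ (n.+2 * n.+1) = c ^+ (n.+2 * n.+1) * \det g ^+ (n.+3 * (n.+2 * n.+1)).
  by rewrite (exprM _ n.+3) -dsg -exprMn /c divfK.
set D' := disc_mx _; set D := disc_mx _; set d' := \det (c *: A1) in nzcA1 *.
(* The part 2 (n + 1) n of the exponent of det g is absorbed by the power of det A1 in the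
   denominator; 4 (n + 1) remains. *)
have -> : (2 * (n.+2 * n.+1) = 2 * (n.+1 * n) + 4 * n.+1)%N.
  by rewrite -(addn2 n); move: n.+1 => m; ring.
set d := \det A in nzA *; set t := \det g in nzg *.
exact: cancel_powers.
Qed.

(** Since psi' depends linearly on psi, both sides are polynomial in psi, and the identity extends
    from a chart to the whole space. One power of det g stays on the left so that all exponents are
    natural numbers. *)
Lemma semi_invariance g h psi psi' : g \in unitmx -> h \in unitmx ->
  mx psi' *m sym2_mx sy crd g = h *m mx psi ->
  peval P psi' * \det g ^+ (n.+3 * (n.+2 * n.+1)) =
  \det h ^+ (n.+2 * n.+1) * \det g ^+ (4 * n.+1) * peval P psi.
Proof.
move=> ug uh mE; pose act phi := hom (h *m mx phi *m invmx (sym2_mx sy crd g)).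
have -> : psi' = act psi by rewrite /act -mE mulmxK ?sym2_unit // mxK.
have act_linear : linear act.
  by move=> a u v; rewrite /act linearP mulmxDr mulmxDl -scalemxAr -scalemxAl linearP.
apply/eqP; rewrite -subr_eq0; apply/eqP; clear psi' mE; move: psi.
have [phi [x [y nz]]] := den_nonzero.
apply: (@rep_ext _ _ _ (fun psi => chart_den mx sy psi x y)).
- apply: repD; last by apply: repN; apply: repM; [apply: rep_const|apply: rep_ev].
  apply: repM; last exact: rep_const.
  by apply: rep_comp => i; apply: rep_linear => a u v; rewrite act_linear linearP.
- exact: rep_den.
- by exists phi.
- move=> psi nzd; apply/eqP; rewrite subr_eq0; apply/eqP.
  by apply: (semi_invariance_chart ug uh _ nzd); rewrite homK mulmxKV ?sym2_unit.
Qed.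

Lemma semi_invariance_homogeneous c psi : c != 0 ->
  peval P (c *: psi) = c ^+ (f * (n.+2 * n.+1)) * peval P psi.
Proof.
move=> nzc; have := @semi_invariance 1%:M c%:M psi (c *: psi).
rewrite !unitmx1 unitmxE !det_scalar !expr1n !mulr1 -exprM; apply=> //.
  by rewrite unitfE expf_neq0.
rewrite linearZ (sym2_mx_scalar syT syK crdK) expr1n mulmx1.
by rewrite mul_scalar_mx.
Qed.

End Invariance.

(** * The ideal of the tangent pencils *)

Section TangentPencils.
Variables (K : numClosedFieldType) (n f : nat) (V : vectType K).
Local Notation N := (f + 2)%N.
Variables (mx : {linear V -> 'M[K]_(f, N)}) (hom : {linear 'M[K]_(f, N) -> V}).
Variables (sy : {linear 'cV[K]_N -> 'M[K]_n.+2}) (crd : 'M[K]_n.+2 -> 'cV[K]_N).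
Hypotheses (homK : cancel hom mx) (mxK : cancel mx hom).
Hypotheses (syT : forall a, (sy a)^T = sy a) (syK : cancel sy crd)
  (crdK : forall S, S^T = S -> sy (crd S) = S).

(** [tangent_pencils] in coordinates: a nonzero Pluecker coordinate expresses that the kernel has
    dimension two, and the trace is the differential of det. *)
Definition tangent (psi : V) :=
  (exists x y, plucker (mx psi) x y != 0) /\
  exists a, [/\ mx psi *m a = 0, \rank (sy a) = n.+1 &
    forall b, mx psi *m b = 0 -> \tr (\adj (sy a) *m sy b) = 0].

Let syI : injective sy := can_inj syK.

(** x' is the combination of x and y that vanishes at a, and y' is whichever of y and x does not
    vanish there, rescaled. *)
Lemma chart_at (M : 'M[K]_(f, N)) x y a : plucker M x y != 0 -> M *m a = 0 -> a != 0 ->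
  exists x' y', [/\ plucker M x' y' != 0, x' *m a = 0 & y' *m a = 1%:M].
Proof.
move=> nzw Ma nza; pose xa := (x *m a) 0 0; pose ya := (y *m a) 0 0.
have scal (z : 'rV[K]_N) b : z *m b = ((z *m b) 0 0)%:M by rewrite [LHS]mx11_scalar.
pose x' := ya *: x - xa *: y.
have x'a : x' *m a = 0.
  rewrite mulmxBl -!scalemxAl (scal x) (scal y) -/xa -/ya !scale_scalar_mx mulrC.
  by rewrite subrr.
suff exy : exists2 y' : 'rV[K]_N, (y' *m a) 0 0 != 0 &
    forall b : 'cV[K]_N, x' *m b = 0 -> y' *m b = 0 -> x *m b = 0 /\ y *m b = 0.
  have [y' nzy' inj] := exy; have y'E := scal y' a.
  move: {exy} ((y' *m a) 0 0) nzy' y'E => c nzc y'E.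
  exists x', (c^-1 *: y'); split=> //; last first.
    by rewrite -scalemxAl y'E scale_scalar_mx mulVf.
  apply: plucker_neq0 => b Mb x'b; rewrite -scalemxAl => /eqP.
  rewrite scaler_eq0 invr_eq0 (negbTE nzc) => /eqP /(inj _ x'b)[xb yb].
  exact: (plucker_inj nzw).
have x'b (b : 'cV[K]_N) : x' *m b = ya *: (x *m b) - xa *: (y *m b).
  by rewrite mulmxBl -!scalemxAl.
have [ya0|nzya] := eqVneq ya 0; last first.
  exists y => // b; rewrite x'b => + yb; rewrite yb scaler0 subr0 => /eqP.
  by rewrite scaler_eq0 (negbTE nzya) => /eqP.
have nzxa : xa != 0.
  apply: contraNneq nza => xa0; apply/eqP/(plucker_inj nzw Ma).
    by rewrite (scal x) -/xa xa0 raddf0.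
  by rewrite (scal y) -/ya ya0 raddf0.
exists x => // b; rewrite x'b ya0 scale0r add0r => /eqP.
by rewrite oppr_eq0 scaler_eq0 (negbTE nzxa) => /eqP.
Qed.

Variable P : mpoly (\dim {:V}) K.
Hypothesis chart : forall psi x y,
  chart_den mx sy psi x y != 0 -> peval P psi * chart_den mx sy psi x y = chart_num mx sy psi x y.

(** In a chart whose first kernel matrix is proportional to the invertible [sy a'], the numerator
    contains a discriminant that tangency kills. *)
Lemma singular_tangent_eq0 psi x y a a' : plucker (mx psi) x y != 0 ->
  mx psi *m a = 0 -> a != 0 -> \det (sy a) = 0 ->
  mx psi *m a' = 0 -> \det (sy a') != 0 -> \tr (\adj (sy a) *m sy a') = 0 ->
  peval P psi = 0.
Proof.
move=> nzw Ma nza da Ma' nzda' tr0.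
have nza' : a' != 0 by apply: contraNneq nzda' => ->; rewrite linear0 det0.
have [x' [y' [nzw' x'a y'a]]] := chart_at nzw Ma' nza'.
have kx' : kernel_mx mx sy psi x' = plucker (mx psi) x' y' *: sy a'.
  rewrite /kernel_mx -(@kvec_unique _ _ _ x' y' (plucker (mx psi) x' y' *: a')) //.
  - by rewrite linearZ.
  - by rewrite -scalemxAr Ma' scaler0.
  - by rewrite -scalemxAr x'a scaler0.
  - by rewrite -scalemxAr y'a scale_scalar_mx mulr1.
have nzdx' : \det (kernel_mx mx sy psi x') != 0 by rewrite kx' detZ mulf_neq0 ?expf_neq0.
have nzden := den_neq0 nzw' nzdx'.
apply: (mulIf nzden); rewrite chart // mul0r /chart_num.
have := kvec_span nzw' Ma; move: (_ / _) (_ / _) => q p aE.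
have saE : sy a = p *: kernel_mx mx sy psi x' + (- q) *: kernel_mx mx sy psi y'.
  by rewrite aE linearB !linearZ_LR /= scalerN scaleNr.
rewrite (@disc_tangent_eq0 _ _ _ _ p (- q)) ?mulr0 // -saE //.
  by apply: contraNneq nza => sa0; apply/eqP/syI; rewrite sa0 linear0.
by rewrite kx' -scalemxAr mxtraceZ tr0 mulr0.
Qed.

(* The quadrics of psi may all be singular. Then psi is deformed, keeping its point of
   tangency [a], to pencils containing b + t s, with [sy s] invertible and tangent at [sy a]. *)
Lemma tangent_eq0 psi : tangent psi -> peval P psi = 0.
Proof.
move=> [[x [y nzw]] [a [Ma ra tr0]]].
have nza : a != 0.
  by apply: contra_eq_neq ra => ->; rewrite linear0 mxrank0.
have da : \det (sy a) = 0.
  apply/eqP; apply: contraTT isT => nzd; have : sy a \in unitmx by rewrite unitmxE unitfE.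
  by rewrite -row_free_unit /row_free ra eqn_leq ltnn andbF.
have [x' [y' [nzw' x'a y'a]]] := chart_at nzw Ma nza.
pose w := plucker (mx psi) x' y'; pose b := - w^-1 *: kvec (mx psi) y'.
have Mb : mx psi *m b = 0 by rewrite -scalemxAr kvec_ker scaler0.
have x'b : x' *m b = 1%:M.
  by rewrite -scalemxAr kvecP plucker_sym scale_scalar_mx mulrNN mulVf.
move: b Mb x'b => b Mb x'b.
have [S [ST nzS trS]] := @symmetric_complement _ _ (\adj (sy a)) (etrans (trmx_adj _) (congr1 _ (syT a))).
pose s := crd S; have syS : sy s = S by apply: crdK.
pose r := (x' *m s) 0 0.
have x's : x' *m s = r%:M by rewrite [LHS]mx11_scalar.
(* With M the matrix of psi, that of psi + t ell is (1 + t r) M - t M s x'. It kills a, because x' a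
   = 0, and b + t s, because x' (b + t s) = 1 + t r. *)
pose ell := hom (r *: mx psi - mx psi *m s *m x').
have [PP PPE] := rep_line P (rep_coord_const ell).
have mE t : mx (psi + t *: ell) = (1 + t * r) *: mx psi - t *: (mx psi *m s *m x').
  by rewrite linearD linearZ /= homK scalerBr scalerA scalerDl scale1r addrA.
have key t : 1 + t * r != 0 -> \det (sy b + t *: S) != 0 -> (evX psi PP).[t] = 0.
  move=> nzr nzd; rewrite PPE; apply: (@singular_tangent_eq0 _ x' y' a (b + t *: s)) => //.
  - apply: plucker_neq0 => v; rewrite mE => + x'v y'v.
    rewrite mulmxBl -!scalemxAl -!mulmxA x'v !mulmx0 scaler0 subr0 => /eqP.
    by rewrite scaler_eq0 (negbTE nzr) => /eqP Mv; apply: (plucker_inj nzw').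
  - by rewrite mE mulmxBl -!scalemxAl -!mulmxA x'a Ma !mulmx0 !scaler0 subrr.
  - rewrite mE mulmxBl -!scalemxAl -!mulmxA !mulmxDr -!scalemxAr x'b x's Mb add0r.
    rewrite mulmx1 mul_mx_scalar -scalemxAr scalerDr !scalerA -scalerDl -scalerBl.
    by rewrite (_ : _ - _ = 0) ?scale0r //; ring.
  - by rewrite linearD linearZ /= syS.
  - by rewrite linearD linearZ /= syS mulmxDr -scalemxAr mxtraceD mxtraceZ tr0 // trS mulr0 addr0.
(* A nonzero polynomial vanishing at the excluded parameters: up to the factor det S, its second
   factor is det (sy b + t S). *)
pose q := (1%:P + r *: 'X) * char_poly (- (invmx S *m sy b)).
have uS : S \in unitmx by rewrite unitmxE unitfE.
have nzq : q != 0.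
  rewrite mulf_neq0 ?(monic_neq0 (char_poly_monic _)) //.
  apply/eqP => /(congr1 (fun p : {poly K} => p.[0])); rewrite hornerD hornerC hornerZ hornerX horner0.
  by move/eqP; rewrite mulr0 addr0 oner_eq0.
have : evX psi PP * q = 0.
  apply: poly_ext => t; rewrite hornerM horner0 /q hornerM horner_char_poly hornerD hornerC hornerZ hornerX.
  have [->|nz1] := eqVneq (1 + r * t) 0; first by rewrite mul0r mulr0.
  have [->|nz2] := eqVneq (\det (t%:M - - (invmx S *m sy b))) 0; first by rewrite !mulr0.
  rewrite key ?mul0r //; first by rewrite mulrC.
  rewrite -(mulKVmx uS (sy b)) -mul_mx_scalar -mulmxDr det_mulmx mulf_neq0 //.
  by move: nz2; rewrite opprK addrC.
move/eqP; rewrite mulf_eq0 (negbTE nzq) orbF => /eqP PP0.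
by have := PPE psi 0; rewrite PP0 horner0 scale0r addr0.
Qed.

End TangentPencils.

Section VanishDivides.
Variables (K : numClosedFieldType) (V : vectType K).
Local Notation A := (mpoly (\dim {:V}) K).

(** Pseudo-division: at a general v the specialization of D is separable and keeps its degree; it
    divides the specialized remainder, which is therefore zero. *)
Lemma rootwise_pseudo_dvd (D Q : {poly A}) (g : A) : g != 0 -> separable_poly D ->
  (forall v s, ev v g != 0 -> separable_poly (evX v D) -> root (evX v D) s ->
    root (evX v Q) s) ->
  exists k w, lead_coef D ^+ k *: Q = w * D.
Proof.
move=> nzg sepD sub; have nzD := separable_poly_neq0 sepD.
have [c nzc sepc] := map_separable_poly sepD.
have := Pdiv.Idomain.divp_eq Q D; set k := Pdiv.Idomain.scalp _ _.
set w := Pdiv.Idomain.divp _ _; set r := Pdiv.Idomain.modp _ _ => e.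
have szr : (size r < size D)%N by rewrite Pdiv.Idomain.ltn_modp.
exists k, w; rewrite e; suff -> : r = 0 by rewrite addr0.
apply/polyP => i; rewrite coef0; pose G := c * g * lead_coef D.
have nzG : G != 0 by rewrite !mulf_neq0 ?lead_coef_eq0.
apply: (mulIf nzG); rewrite mul0r; apply: ev_ext => v; rewrite rmorphM rmorph0.
have [->|] := eqVneq (ev v G) 0; first by rewrite mulr0.
rewrite /G 2!rmorphM !mulf_eq0 !negb_or => /andP[/andP[nzcv nzgv] nzl].
have sepv := sepc _ (ev v) nzcv.
have dv : evX v D %| evX v Q by apply: separable_root_dvdp => // s; apply: sub.
have szv : size (evX v D) = size D by rewrite size_map_poly_id0.
have : evX v D %| evX v r.
  have -> : evX v r = (ev v (lead_coef D) ^+ k)%:P * evX v Q - evX v w * evX v D.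
    have := congr1 (evX v) e; rewrite -mul_polyC !(rmorphM, rmorphD) /= map_polyC /= rmorphXn => ->.
    by rewrite addrC addKr.
  by rewrite dvdp_sub ?dvdp_mull ?dvdpp.
move=> dr; have : evX v r = 0.
  apply/eqP/negPn/negP => nzr; have := dvdp_leq nzr dr.
  by rewrite szv leqNgt (leq_ltn_trans (size_poly _ _) szr).
by move/(congr1 (fun p : {poly K} => p`_i)); rewrite coef_map coef0 => ->; rewrite mul0r.
Qed.

End VanishDivides.

(* An eigenvalue of geometric multiplicity at least two gives a double root of the
   discriminant. *)
Lemma separable_line_corank (K : numClosedFieldType) n (S T : 'M[K]_n.+1) s a :
  separable_poly (disc_mx (line_mx S T)) -> (n <= \rank (S + s *: T - a%:M)%R)%N.
Proof.
move=> sep; rewrite leqNgt; apply/negP => /(disc_line_mx_corank T) sq.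
have eD : disc_mx (line_mx (S + s *: T) T) = disc_mx (line_mx S T) \Po ('X + s%:P).
  apply: poly_ext => z; rewrite horner_comp !horner_disc_pencil hornerD hornerX hornerC.
  by rewrite scalerDl addrAC addrA.
have : ('X - s%:P) ^+ 2 %| disc_mx (line_mx S T).
  move: sq; rewrite eD => /(dvdp_comp_poly ('X - s%:P)); rewrite -comp_polyA comp_polyD.
  by rewrite comp_polyX comp_polyC subrK comp_polyXr comp_Xn_poly.
by rewrite separable_nosquare // size_XsubC.
Qed.

Section Ideal.
Variables (K : numClosedFieldType) (n f' : nat) (V : vectType K).
Local Notation f := f'.+1.
Local Notation N := (f + 2)%N.
Variables (mx : {linear V -> 'M[K]_(f, N)}) (hom : {linear 'M[K]_(f, N) -> V}).
Variable sy : {linear 'cV[K]_N -> 'M[K]_n.+2}.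
Hypothesis homK : cancel hom mx.
Local Notation first := (lshift 2 (0 : 'I_f)).
Local Notation last := (last f).
Local Notation penult := (penult f).
Local Notation row_penult := (row_penult K f').
Local Notation row_last := (row_last K f').
Variables (B0 C0 : 'M[K]_n.+2).
Hypotheses (sy_first : sy (delta_mx first 0) = C0) (sy_penult : sy (delta_mx penult 0) = B0)
  (sy_last : sy (delta_mx last 0) = 1%:M).
Hypotheses (nzB : disc_mx B0 != 0) (nzC : disc_mx C0 != 0)
  (sepBC : separable_poly (disc_mx (line_mx (- B0) C0))).
Local Notation den := (chart_den mx sy).
Local Notation num := (chart_num mx sy).
Local Notation kmx := (kernel_mx mx sy).
Local Notation split_pt := (split_pt hom).
Local Notation nilp_pt := (nilp_pt hom).
Local Notation plk psi := (plucker (mx psi) row_penult row_last).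

(** psi + s shift psi is psi composed with a transvection that preserves the forms [row_penult] and
    [row_last]; of the two kernel vectors of their chart only the second moves, along the first
    basis vector. *)
Let shift psi := hom (mx psi *m delta_mx first penult).

Let row_shift s (j : 'I_N) : j != first ->
  (delta_mx 0 j : 'rV[K]_N) *m (1%:M + s *: delta_mx first penult) = delta_mx 0 j.
Proof.
move=> nj; rewrite mulmxDr mulmx1 -scalemxAr mul_delta_mx_0 ?scaler0 ?addr0 //.
Qed.

Let nfp : penult != first. Proof. by []. Qed.
Let nfl : last != first. Proof. by []. Qed.
Let mx_shift psi s : mx (psi + s *: shift psi) = mx psi *m (1%:M + s *: delta_mx first penult).
Proof. by rewrite linearD linearZ /= homK mulmxDr mulmx1 -scalemxAr. Qed.

Let plk_shift psi s : plk (psi + s *: shift psi) = plk psi.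
Proof.
have e1 : row_penult *m _ = row_penult := row_shift s nfp.
have e2 : row_last *m _ = row_last := row_shift s nfl.
by rewrite mx_shift -{1}e1 -{1}e2 plucker_mul det_transvection ?mulr1.
Qed.

Let kvec_shift_penult psi s : plk psi != 0 ->
  kvec (mx (psi + s *: shift psi)) row_penult = kvec (mx psi) row_penult.
Proof.
move=> nzw; have pk : row_penult *m kvec (mx psi) row_penult = 0.
  by rewrite kvecP plucker_xx raddf0.
have dk : delta_mx first penult *m kvec (mx psi) row_penult = 0.
  by rewrite -[delta_mx first penult](mul_delta_mx (0 : 'I_1)) -mulmxA pk mulmx0.
apply/esym/(kvec_unique (y := row_last)) => //; first by rewrite plk_shift.
  by rewrite mx_shift -mulmxA mulmxDl mul1mx -scalemxAl dk scaler0 addr0 kvec_ker.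
by rewrite plk_shift kvecP.
Qed.

Let kvec_shift_last psi s : plk psi != 0 ->
  kvec (mx (psi + s *: shift psi)) row_last =
  kvec (mx psi) row_last + (s * plk psi) *: delta_mx first 0.
Proof.
move=> nzw; have pk : row_penult *m kvec (mx psi) row_last = (- plk psi)%:M.
  by rewrite kvecP plucker_sym.
have dE (j : 'I_N) : (delta_mx 0 j : 'rV[K]_N) *m (delta_mx first 0 : 'cV[K]_N) = (j == first)%:R%:M.
  by rewrite -rowE; apply/matrixP => i k; rewrite !mxE !ord1 eqxx andbT mulr1n.
have dk : delta_mx first penult *m kvec (mx psi) row_last = - plk psi *: delta_mx first 0.
  rewrite -[delta_mx first penult](mul_delta_mx (0 : 'I_1)) -mulmxA pk.
  by rewrite mul_mx_scalar.
have d0 : delta_mx first penult *m (delta_mx first 0 : 'cV[K]_N) = 0.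
  by rewrite mul_delta_mx_0.
apply/esym/(kvec_unique2 (x := row_penult)).
- by rewrite plk_shift.
- rewrite mx_shift -mulmxA -[RHS](kvec_ker (mx psi) row_last); congr (_ *m _).
  move: (kvec _ _) (plk psi) dk {pk nzw} => k w dk.
  rewrite mulmxDl mul1mx -scalemxAl (mulmxDr (delta_mx _ _)) dk.
  by rewrite -scalemxAr d0 scaler0 addr0 scalerA mulrN scaleNr addrK.
- by rewrite mulmxDr pk -scalemxAr dE (negbTE nfp) raddf0 scaler0 addr0 plk_shift.
- by rewrite mulmxDr kvecP plucker_xx -scalemxAr dE (negbTE nfl) !raddf0 addr0 ?scaler0.
Qed.

(** Separability excludes eigenvalues of geometric multiplicity two or more, so that each root is a
    tangency at a quadric of corank exactly one. *)
Let shift_tangent psi s : plk psi != 0 -> \det (kmx psi row_penult) != 0 ->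
  let S := \adj (kmx psi row_penult) *m kmx psi row_last in
  let T := plk psi *: (\adj (kmx psi row_penult) *m C0) in
  separable_poly (disc_mx (line_mx S T)) -> root (disc_mx (line_mx S T)) s ->
  tangent mx sy (psi + s *: shift psi).
Proof.
move=> nzw nzA S T sep; set A := kmx psi row_penult in nzA S T sep *.
pose B := kmx psi row_last + (s * plk psi) *: C0.
have STE : S + s *: T = \adj A *m B by rewrite mulmxDr -scalemxAr scalerA.
rewrite rootE horner_disc_pencil STE => /eqP dB.
have rk a : (n.+1 <= \rank (\adj A *m B - a%:M)%R)%N by rewrite -STE separable_line_corank.
have [c [rc dc tc]] := tangent_of_disc_eq0 nzA dB rk.
have kA : sy (kvec (mx (psi + s *: shift psi)) row_penult) = A.
  by rewrite kvec_shift_penult.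
have kB : sy (kvec (mx (psi + s *: shift psi)) row_last) = B.
  by rewrite kvec_shift_last // linearD linearZ /= sy_first.
clear STE dB rk; move: B rc dc tc kB => B rc dc tc kB.
have nzw' : plk (psi + s *: shift psi) != 0 by rewrite plk_shift.
split; first by exists row_penult, row_last.
exists (kvec (mx (psi + s *: shift psi)) row_last - c *: kvec (mx (psi + s *: shift psi)) row_penult).
have saE : sy (kvec (mx (psi + s *: shift psi)) row_last
    - c *: kvec (mx (psi + s *: shift psi)) row_penult) = B - c *: A.
  by rewrite linearB linearZ /= kA kB.
split; rewrite ?saE //.
  by rewrite mulmxBr -scalemxAr !kvec_ker scaler0 subrr.
have tB : \tr (\adj (B - c *: A) *m B) = 0.
  rewrite -{2}[B](subrK (c *: A)) mulmxDr mul_adj_mx dc -scalemxAr mxtraceD mxtraceZ tc.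
  by rewrite mulr0 addr0 raddf0 mxtrace0.
move: (\adj (B - c *: A)) tB tc => G tB tc b Mb.
have := kvec_span nzw' Mb; move: (_ / _) (_ / _) => q p ->.
rewrite linearB !linearZ_LR /= kA kB mulmxDr mxtraceD -!scalemxAr !mxtraceZ.
by rewrite mulmxN raddfN /= tB tc oppr0 !mulr0 addr0.
Qed.

Variable P : mpoly (\dim {:V}) K.
Variable d : nat.
Hypotheses (chart : forall psi x y, den psi x y != 0 -> peval P psi * den psi x y = num psi x y)
  (homP : forall c psi, c != 0 -> peval P (c *: psi) = c ^+ d * peval P psi)
  (nzPs : peval P split_pt != 0) (nzPn : peval P nilp_pt != 0).

Let split_w : plk split_pt != 0.
Proof. by have /den_neq0W[] := split_pt_den homK sy_last nzB nzC. Qed.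

(* Write A, B for the kernel matrices of psi and w for its Pluecker coordinate. Along the
   curve psi + s * shift psi, A is constant and B becomes B + s w C0, so that the equation
   restricts, up to a factor, to the discriminant of a line of matrices. For general psi
   it is separable and its roots are tangent pencils, where Q vanishes. Hence the
   restriction of Q is a multiple of it up to a power of its leading coefficient, which is
   removed by coprimality. *)
Lemma vanishing_dvd Q : (forall psi, tangent mx sy psi -> peval Q psi = 0) ->
  exists S, Q = S * P.
Proof.
move=> Q0.
have [M1 M1E] : repmx (@ev K V) (fun psi => \adj (kmx psi row_penult) *m kmx psi row_last).
  by apply: repmxM; [apply: repmx_adj|]; apply: rep_kmx.
have [M2 M2E] : repmx (@ev K V) (fun psi => plk psi *: (\adj (kmx psi row_penult) *m C0)).
  apply: repmxZ; first exact: rep_plucker.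
  apply: repmxM; first by apply: repmx_adj; apply: rep_kmx.
  by apply: repmxP => i j; apply: rep_const.
have [A1 A1E] : rep (@ev K V) (fun psi => \det (kmx psi row_penult)).
  by apply: rep_det; apply: rep_kmx.
have [W1 W1E] := rep_plucker mx row_penult row_last.
have [D1 D1E] := rep_den mx sy row_penult row_last.
pose D := disc_mx (map_mx polyC M1 + 'X *: map_mx polyC M2).
have evD psi : evX psi D = disc_mx (line_mx (\adj (kmx psi row_penult) *m kmx psi row_last)
    (plk psi *: (\adj (kmx psi row_penult) *m C0))).
  by rewrite -M1E -M2E -map_disc_pencil.
have [szD topD] := top_coef_disc M1 M2; rewrite -/D in szD topD.
have ev_top psi : ev psi (disc_mx M2) = disc_mx (plk psi *: (\adj (kmx psi row_penult) *m C0)).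
  by rewrite map_disc_mx M2E.
have top_neq0 psi c : c != 0 -> plk psi = c -> kmx psi row_penult = c%:M ->
    ev psi (disc_mx M2) != 0.
  move=> nzc ew ek; rewrite ev_top ew ek adj_scalar_mx // mul_scalar_mx scalerA -exprS.
  by rewrite disc_mxZ mulf_neq0 // !expf_neq0.
have kps := split_pt_kmx_penult homK sy_last nzB nzC.
have nz_top_split := top_neq0 split_pt _ split_w (erefl _) kps.
have nz_top : disc_mx M2 != 0.
  by apply: contraNneq nz_top_split => ->; rewrite rmorph0.
have lead : lead_coef D = disc_mx M2.
  rewrite /lead_coef (_ : size D = (n.+2 * n.+1).+1) //; apply/eqP.
  rewrite eqn_leq szD ltnNge; apply: contra nz_top => /leq_sizeP/(_ _ (leqnn _)).
  by rewrite topD => ->.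
(* Separability is tested at [split_pt], where the two matrices are - B0 and C0 multiplied by the
   same nonzero power of the Pluecker coordinate. *)
have sepD : separable_poly D.
  apply: (@separable_poly_of_map _ _ (ev split_pt)); first by rewrite lead.
  rewrite -/(evX _ _) evD kps (split_pt_kmx_last homK sy_penult nzB nzC) //.
  move: (plk split_pt) split_w => c nzc; rewrite adj_scalar_mx // !mul_scalar_mx !scalerA -exprS.
  rewrite mulrN -exprSr scaleNr -scalerN.
  have -> : line_mx (c ^+ n.+2 *: - B0) (c ^+ n.+2 *: C0) = (c ^+ n.+2)%:P *: line_mx (- B0) C0.
    by rewrite /line_mx !map_mxZ scalerDr !scalerA [_%:P * _]mulrC.
  rewrite disc_mxZ -!rmorphXn /= mul_polyC (@eqp_separable _ _ (disc_mx (line_mx (- B0) C0))) //.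
  by rewrite eqp_scale // !expf_neq0.
have [Qs QsE] : exists Qs : {poly mpoly (\dim {:V}) K}, forall v s,
    (evX v Qs).[s] = peval Q (v + s *: shift v).
  apply: rep_line => i; apply: rep_linear => a u v.
  by rewrite /shift linearP mulmxDl -scalemxAl linearP linearP.
have nzW : W1 * A1 != 0.
  apply: contraTneq isT => e; have := congr1 (ev split_pt) e.
  rewrite rmorphM rmorph0 W1E A1E kps det_scalar => /eqP.
  by rewrite mulf_eq0 expf_eq0 (negbTE split_w) andbF.
have [k [w e]] : exists k w, lead_coef D ^+ k *: Qs = w * D.
  apply: (rootwise_pseudo_dvd nzW sepD) => v s.
  rewrite rmorphM W1E A1E mulf_eq0 negb_or => /andP[nzw nzA]; rewrite evD => sepv rt.
  by rewrite rootE QsE Q0 //; apply: shift_tangent.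
have Q0E : Qs.[0] = Q.
  apply: ev_ext => v; have := QsE v 0; rewrite scale0r addr0 -evE => <-.
  by rewrite -horner_map rmorph0.
have PD v : peval P v * den v row_penult row_last = num v row_penult row_last.
  apply/eqP; rewrite -subr_eq0; apply/eqP; move: v.
  apply: (@rep_ext _ _ _ (fun psi => den psi row_penult row_last)).
  - apply: repD; first by apply: repM; [apply: rep_ev|apply: rep_den].
    by apply: repN; apply: rep_num.
  - exact: rep_den.
  - by exists split_pt; apply: (split_pt_den homK sy_last nzB nzC).
  - by move=> v /chart ->; rewrite subrr.
(* At s = 0 the polynomial P does not vanish; for s nonzero the first kernel matrix is a nonzero
   scalar, so neither the leading coefficient of D nor A1 vanishes. *)
apply: (@line_coprime _ _ P (disc_mx M2 ^+ k * A1) Q (w.[0] * D1) split_pt nilp_pt d) => //.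
  move=> s; have [->|nzs _] := eqVneq s 0.
    by rewrite scale0r addr0 => /eqP; rewrite (negbTE nzPn).
  have kl := line_pt_kmx homK sy_last nzB nzC nzs.
  have /den_neq0W[nzw nzA] := line_pt_den homK sy_last nzB nzC nzs.
  rewrite -evE rmorphM A1E mulf_neq0 // rmorphXn expf_neq0 //.
  exact: (top_neq0 _ _ nzw).
apply: ev_ext => v; rewrite !rmorphM A1E D1E.
have := congr1 (fun p : {poly _} => ev v p.[0]) e.
rewrite hornerZ hornerM Q0E lead rmorphM [in RHS]rmorphM => ev0.
have D0E : ev v D.[0] = disc_mx (\adj (kmx v row_penult) *m kmx v row_last).
  by rewrite horner_disc_pencil scale0r addr0 map_disc_mx M1E.
have := PD v; rewrite /chart_num -D0E -evE.
move: (den v row_penult row_last) => dn pd.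
transitivity (ev v (disc_mx M2 ^+ k) * ev v Q * \det (kmx v row_penult)); first by rewrite mulrAC.
by rewrite ev0 -!mulrA [dn * _]mulrC pd [_ * \det _]mulrC.
Qed.

End Ideal.

Section TangentIdeal.
Variables (K : numClosedFieldType) (n f' : nat) (V : vectType K).
Local Notation f := f'.+1.
Local Notation N := (f + 2)%N.
Variables (mx : {linear V -> 'M[K]_(f, N)}) (hom : {linear 'M[K]_(f, N) -> V}).
Variables (sy : {linear 'cV[K]_N -> 'M[K]_n.+2}) (crd : 'M[K]_n.+2 -> 'cV[K]_N).
Hypotheses (homK : cancel hom mx) (mxK : cancel mx hom).
Hypotheses (syT : forall a, (sy a)^T = sy a) (syK : cancel sy crd)
  (crdK : forall S, S^T = S -> sy (crd S) = S) (hN : (2 * N = n.+2 * n.+3)%N).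

Lemma tangent_ideal (B0 C0 : 'M[K]_n.+2) :
  sy (delta_mx (lshift 2 0) 0) = C0 -> sy (delta_mx (penult f) 0) = B0 ->
  sy (delta_mx (last f) 0) = 1%:M -> disc_mx B0 != 0 -> disc_mx C0 != 0 ->
  separable_poly (disc_mx (line_mx (- B0) C0)) ->
  exists P : mpoly (\dim {:V}) K, [/\ P != 0,
    forall Q, (forall psi, tangent mx sy psi -> peval Q psi = 0) <-> exists S, Q = S * P &
    forall g h psi psi', g \in unitmx -> h \in unitmx ->
      mx psi' *m sym2_mx sy crd g = h *m mx psi ->
      peval P psi' * \det g ^+ (n.+3 * (n.+2 * n.+1)) =
      \det h ^+ (n.+2 * n.+1) * \det g ^+ (4 * n.+1) * peval P psi].
Proof.
move=> sy_first sy_penult sy_last nzB nzC sep.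
have [P [chart nzs nzn]] := discriminant_exists homK sy_first sy_penult sy_last nzB nzC.
have exden : exists psi x y, chart_den mx sy psi x y != 0.
  by exists (split_pt hom), (row_penult K f'), (row_last K f');
     apply: (split_pt_den homK sy_last nzB nzC).
have inv := semi_invariance homK mxK syT syK crdK hN chart exden.
exists P; split=> //.
  by apply: contraNneq nzs => ->; rewrite -evE rmorph0.
move=> Q; split=> [|[S ->] psi tpsi].
  have homog := semi_invariance_homogeneous homK mxK syT syK crdK hN chart exden.
  exact: (vanishing_dvd homK sy_first sy_penult sy_last nzB nzC sep chart homog nzs nzn).
by rewrite -evE rmorphM [ev psi P]evE (tangent_eq0 homK syT syK crdK chart tpsi) mulr0.
Qed.

End TangentIdeal.

(** Translating the parameter by s replaces B by B + s C and preserves separability; an s outside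
    the roots gives the first matrix a nonzero discriminant. *)
Lemma separable_basis (K : numClosedFieldType) n : exists B C : 'M[K]_n.+2,
  [/\ B^T = B, C^T = C, disc_mx B != 0, disc_mx C != 0 &
      separable_poly (disc_mx (line_mx (- B) C))].
Proof.
have [B [C [BT CT nzC sep]]] := separable_pencil K n.
have [s nzs] := poly_nonroot (separable_poly_neq0 sep).
rewrite horner_disc_pencil in nzs.
exists (- (B + s *: C)), C; split=> //.
- by rewrite linearN linearD linearZ /= BT CT.
- by rewrite -scaleN1r disc_mxZ mulf_neq0 // expf_neq0 // oppr_eq0 oner_eq0.
rewrite opprK; have -> : disc_mx (line_mx (B + s *: C) C) = disc_mx (line_mx B C) \Po ('X + s%:P).
  apply: poly_ext => z; rewrite horner_comp !horner_disc_pencil hornerD hornerX hornerC.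
  by rewrite scalerDl addrAC addrA.
rewrite separable_poly.unlock /coprimep; move: sep; rewrite separable_poly.unlock => sep.
have dE : (disc_mx (line_mx B C) \Po ('X + s%:P))^`() = (disc_mx (line_mx B C))^`() \Po ('X + s%:P).
  by rewrite deriv_comp derivD derivX derivC addr0 mulr1.
rewrite /separable_poly.body dE; case/Bezout_eq1_coprimepP: sep => -[u v] /= e.
apply/Bezout_eq1_coprimepP; exists (u \Po ('X + s%:P), v \Po ('X + s%:P)).
by rewrite /= -!comp_polyM -comp_polyD e comp_polyC.
Qed.

Lemma disc_mx_scalar (K : numClosedFieldType) n (c : K) : disc_mx (c%:M : 'M[K]_n.+2) = 0.
Proof.
have [//|] := eqVneq (disc_mx (c%:M : 'M[K]_n.+2)) 0.
have -> : c%:M = diag_mx (\row_a (fun=> c) a) :> 'M[K]_n.+2.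
  by apply/matrixP => i j; rewrite !mxE.
by case/(@disc_mx_diag_neq0 _ n.+1 (fun=> c)) /(_ ord0 ord_max erefl) /(congr1 (@nat_of_ord _)).
Qed.

(** A relation involving B would put a scalar matrix on the line - B + s C, against
    [separable_line_corank]; one involving only C and 1 would make C scalar, of zero
    discriminant. *)
Lemma separable_basis_free (K : numClosedFieldType) n (B C : 'M[K]_n.+2) x y z :
  disc_mx C != 0 -> separable_poly (disc_mx (line_mx (- B) C)) ->
  z *: C + y *: B + x *: 1%:M = 0 -> [/\ x = 0, y = 0 & z = 0].
Proof.
rewrite scalemx1 => nzC sep e.
have y0 : y = 0.
  apply: contraTeq isT => nzy; have := @separable_line_corank _ _ _ _ (- (z / y)) (x / y) sep.
  suff -> : - B + - (z / y) *: C - (x / y)%:M = 0 by rewrite mxrank0.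
  apply: (scalerI nzy); rewrite scaler0 -[RHS]oppr0 -e !scalerDr !scalerN scaleNr.
  rewrite scalerN scalerA scale_scalar_mx [y * (z / y)]mulrC [y * (x / y)]mulrC !divfK //.
  by rewrite !opprD; congr (_ - _); rewrite addrC.
move: e; rewrite y0 scale0r addr0 => e.
have z0 : z = 0.
  apply: contraNeq nzC => nzz; suff -> : C = (- x / z)%:M by rewrite disc_mx_scalar.
  apply: (scalerI nzz); rewrite scale_scalar_mx [z * _]mulrC divfK //.
  by rewrite raddfN /=; apply/eqP; rewrite -addr_eq0 e.
split=> //; move: e; rewrite z0 scale0r add0r => /matrixP/(_ 0 0).
by rewrite !mxE eqxx mulr1n.
Qed.

(** Linear forms dual to a basis of the kernel serve as x and y; conversely, [kvec M x] and
    [kvec M y] form a basis of the kernel. *)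
Lemma dim_lker_plucker (K : fieldType) (W : vectType K) f
    (crd : {linear W -> 'cV[K]_(f + 2)}) (uncrd : {linear 'cV[K]_(f + 2) -> W})
    (psi : 'Hom(W, 'cV[K]_f)) M :
  cancel crd uncrd -> cancel uncrd crd -> (forall S, psi S = M *m crd S) ->
  \dim (lker psi) = 2%N <-> exists x y, plucker M x y != 0.
Proof.
move=> crdK uncrdK psiE; split=> [dim2|[x [y nzw]]].
  have bs := vbasisP (lker psi); move: (vbasis _) bs; rewrite dim2 => b bs.
  pose A := \matrix_(i < 2, j < f + 2) crd b`_i j 0.
  have uA u : (u *m A)^T = crd (\sum_i u 0 i *: b`_i).
    rewrite linear_sum; apply/matrixP => i j; rewrite !mxE summxE ord1.
    by apply: eq_bigr => l _; rewrite linearZ !mxE.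
  have /row_freeP[L AL] : row_free A.
    apply: inj_row_free => u /(congr1 trmx); rewrite uA trmx0 => /(congr1 uncrd).
    rewrite crdK linear0 => /(vector.freeP (basis_free bs)) u0.
    by apply/rowP => i; rewrite u0 mxE.
  have bL i (u : 'rV_2) : (col i L)^T *m (u *m A)^T = (u 0 i)%:M.
    rewrite -trmx_mul (colE i L) mulmxA -(mulmxA u) AL mulmx1 -colE.
    by apply/matrixP => k l; rewrite !ord1 !mxE mulr1n.
  exists (col 0 L)^T, (col 1 L)^T; apply: plucker_neq0 => v Mv.
  have : uncrd v \in lker psi by rewrite memv_ker psiE uncrdK Mv.
  move=> /(coord_basis bs) vE.
  pose u := \row_i coord b i (uncrd v).
  have -> : v = (u *m A)^T.
    rewrite uA -[LHS]uncrdK {1}vE; congr (crd _); apply: eq_bigr => i _.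
    by rewrite mxE.
  rewrite !bL => /matrixP/(_ 0 0); rewrite [LHS]mxE [RHS]mxE mulr1n => u0.
  move=> /matrixP/(_ 0 0); rewrite [LHS]mxE [RHS]mxE mulr1n => u1.
  rewrite (_ : u = 0) ?mul0mx ?trmx0 //.
  apply/rowP => i; rewrite [RHS]mxE; case: i => [[|[|//]] lt].
    by apply: etrans u0; congr (u _ _); apply: val_inj.
  by apply: etrans u1; congr (u _ _); apply: val_inj.
have kin z : uncrd (kvec M z) \in lker psi by rewrite memv_ker psiE uncrdK kvec_ker.
pose X := [:: uncrd (kvec M x); uncrd (kvec M y)].
have comb p q : p *: kvec M x + q *: kvec M y = 0 -> p = 0 /\ q = 0.
  move=> e; split.
    have := congr1 (mulmx y) e; rewrite mulmxDr -!scalemxAr !kvecP plucker_xx mulmx0.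
    rewrite raddf0 scaler0 addr0 scale_scalar_mx => /matrixP/(_ 0 0).
    by rewrite !mxE mulr1n => /eqP; rewrite mulf_eq0 (negbTE nzw) orbF => /eqP.
  have := congr1 (mulmx x) e; rewrite mulmxDr -!scalemxAr !kvecP plucker_xx mulmx0.
  rewrite raddf0 scaler0 add0r scale_scalar_mx plucker_sym => /matrixP/(_ 0 0).
  by rewrite !mxE mulr1n => /eqP; rewrite mulf_eq0 oppr_eq0 (negbTE nzw) orbF => /eqP.
have frX : free X.
  apply/(@vector.freeP _ _ _ (in_tuple X)) => k; rewrite big_ord_recl big_ord1 /= => /(congr1 crd).
  rewrite linearD !linearZ_LR linear0 /= !uncrdK => /comb[k0 k1] i.
  by case: (unliftP 0 i) => [j|] ->; rewrite ?ord1.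
have -> : lker psi = <<X>>%VS.
  apply/eqP; rewrite eqEsubv; apply/andP; split; last first.
    by apply/span_subvP => S; rewrite !inE => /orP[] /eqP ->.
  apply/subvP => S; rewrite memv_ker psiE => /eqP MS.
  rewrite -[S]crdK (kvec_span nzw MS) linearB !linearZ_LR /=.
  by apply: memvD; apply: memvZ; rewrite ?memvN memv_span // !inE eqxx ?orbT.
by apply/eqP; rewrite -[_ == _]/(\dim <<X>>%VS == size X).
Qed.

(** * The equivariant class *)

(** The three vectors are placed at the positions [first], [penult] and [last] of the
    construction. *)
Lemma basis_extend (K : fieldType) (W : vectType K) (c b u : W) f' :
  \dim {:W} = f'.+3 -> free [:: c; b; u] ->
  exists bas : (f'.+1 + 2).-tuple W, [/\ basis_of {:W} bas,
    bas`_0 = c, bas`_f'.+1 = b & bas`_f'.+2 = u].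
Proof.
move=> dimW frX; pose X := [:: c; b; u]; pose Y := vbasis (<<X>>^C)%VS.
have dimX : \dim <<X>> = 3%N by apply/eqP; rewrite -[_ == _]/(\dim <<X>> == size X).
have XY : basis_of {:W} (X ++ Y).
  rewrite -(addv_complf <<X>>%VS); apply: cat_basis.
  - by apply/directv_addP; rewrite capv_compl.
  - by rewrite /basis_of eqxx frX.
  - exact: vbasisP.
have szY : size Y = f'.
  have : \dim <<X ++ Y>> = size (X ++ Y) by apply/eqP; apply: (basis_free XY).
  by rewrite (span_basis XY) dimW size_cat => -[].
pose L := c :: Y ++ [:: b; u].
have LX : perm_eq L (X ++ Y) by rewrite /L /X /= perm_cons perm_catC.
have szL : size L == (f'.+1 + 2)%N by rewrite /= size_cat szY addSn.
exists (Tuple szL); split=> //=.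
- by rewrite (perm_basis _ LX).
- by rewrite nth_cat szY ltnn subnn.
- by rewrite nth_cat szY ltnNge leqnSn subSnn.
Qed.

Lemma scalar_congr (R : comNzRingType) n (a : R) (S : 'M[R]_n) :
  a%:M *m S *m a%:M^T = a ^+ 2 *: S.
Proof. by rewrite tr_scalar_mx mul_scalar_mx mul_mx_scalar scalerA. Qed.

Section Weights.
Variables (R : realType) (e f : nat).
Local Notation C := (Complex R).

Lemma transports_scalar (a b : C) (psi : HomSym2 R e f) : a != 0 ->
  transports a%:M b%:M psi ((b / a ^+ 2) *: psi).
Proof.
move=> nza S S' E; have -> : S' = a ^+ 2 *: S.
  by apply: subvs_inj; rewrite E linearZ; apply: scalar_congr.
rewrite scale_lfunE linearZ scalerA divfK ?expf_neq0 //.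
by apply/esym/mul_scalar_mx.
Qed.

(** Two generators of the same ideal differ by a nonzero constant, so their characters agree, in
    particular on scalar matrices. *)
Lemma equivariant_weights (Z : set (HomSym2 R e f)) w w' (a b : C) :
  is_equivariant_class Z w -> is_equivariant_class Z w' -> a != 0 -> b != 0 ->
  (a ^+ e) ^ w.1 * (b ^+ f) ^ w.2 = (a ^+ e) ^ w'.1 * (b ^+ f) ^ w'.2.
Proof.
move=> [P [nzP idP charP]] [P' [nzP' idP' charP']] nza nzb.
have [S SE] : exists S, P' = S * P by apply/idP/idP'; exists 1; rewrite mul1r.
have [S' S'E] : exists S', P = S' * P' by apply/idP'/idP; exists 1; rewrite mul1r.
have SS : S' * S = 1 by apply: (mulIf nzP); rewrite mul1r -mulrA -SE -S'E.
have nzS : S != 0 by apply: contraNneq nzP' => S0; rewrite SE S0 mul0r.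
have nzS' : S' != 0 by apply: contraNneq nzP => S0; rewrite S'E S0 mul0r.
have /msize1_polyC Sc : (msize S <= 1)%N.
  have eqs : (msize S' + msize S).-1 = 1%N by rewrite -(msizeM nzS' nzS) SS msize1.
  have gt0 : (0 < msize S)%N by rewrite lt0n msize_poly_eq0.
  have gt0' : (0 < msize S')%N by rewrite lt0n msize_poly_eq0.
  move: (msize S) (msize S') gt0 gt0' eqs => i j; lia.
set c := mcoeff _ _ in Sc.
have nzc : c != 0 by apply: contraNneq nzS => c0; rewrite Sc c0 mpolyC0.
have P'E psi : peval P' psi = c * peval P psi.
  by rewrite SE Sc /peval mevalM mevalC.
have [psi nzpsi] : exists psi, peval P psi != 0.
  apply: contrapT => H; case/negP: nzP; apply/eqP/ev_ext => psi.
  rewrite rmorph0 evE; apply/eqP/negPn/negP => nz; apply: H; by exists psi.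
have ua : (a%:M : 'M[C]_e) \in unitmx by rewrite unitmxE det_scalar unitfE expf_neq0.
have ub : (b%:M : 'M[C]_f) \in unitmx by rewrite unitmxE det_scalar unitfE expf_neq0.
have tr := transports_scalar b psi nza.
have := charP' _ _ _ _ ua ub tr; rewrite !P'E (charP _ _ _ _ ua ub tr) !det_scalar.
by rewrite [RHS]mulrCA => /(mulfI nzc) /(mulIf nzpsi).
Qed.

End Weights.

Lemma exprz_nat_eq1 (K : numFieldType) m (k : int) : (1 < m)%N -> (m%:R : K) ^ k = 1 -> k = 0.
Proof.
move=> m1; have pw j : (m%:R : K) ^+ j = 1 -> j = 0%N.
  rewrite -natrX => /eqP; rewrite (eqr_nat _ _ 1) => /eqP e.
  by apply/eqP; move: e; case: j => // j e; move: (ltn_expl j.+1 m1); rewrite e ltnS.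
case: k => j; first by move/pw ->.
by rewrite NegzE -exprnN => /eqP; rewrite invr_eq1 => /eqP /pw.
Qed.

(** The scalar 2 has infinite multiplicative order, so the weights can be read from its action. This
    uniqueness determines the value of [xget]. *)
Lemma equivariant_class_unique (R : realType) e f (Z : set (HomSym2 R e f)) w w' :
  (0 < e)%N -> (0 < f)%N -> is_equivariant_class Z w -> is_equivariant_class Z w' -> w = w'.
Proof.
move=> e0 f0 cw cw'; have wts := equivariant_weights cw cw'.
have two_neq0 : (2 : Complex R) != 0 by rewrite pnatr_eq0.
have inj m i j : (0 < m)%N -> ((2 : Complex R) ^+ m) ^ i = (2 ^+ m) ^ j -> i = j.
  move=> m0 e2; apply/eqP; rewrite -subr_eq0; apply/eqP/(@exprz_nat_eq1 (Complex R) (2 ^ m)).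
    by rewrite -{1}(expn0 2) ltn_exp2l.
  by rewrite natrX expfzDr ?expf_neq0 // e2 -expfzDr ?expf_neq0 // subrr.
have := wts 2 1 two_neq0 (oner_neq0 _); have := wts 1 2 (oner_neq0 _) two_neq0.
rewrite !expr1n !exp1rz !mul1r !mulr1 => /(inj _ _ _ f0) e2 /(inj _ _ _ e0) e1.
by rewrite [LHS]surjective_pairing e1 e2 -surjective_pairing.
Qed.

Lemma bin2_doubled n : (2 * 'C(n.+3, 2) = n.+2 * n.+3)%N.
Proof. by have := bin_ffact n.+3 2; rewrite !ffactnS ffactn0 muln1 mulnC => -> /=; rewrite mulnC. Qed.

Lemma free_triple (K : fieldType) (W : vectType K) (a b c : W) :
  (forall x y z, x *: a + y *: b + z *: c = 0 -> [/\ x = 0, y = 0 & z = 0]) ->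
  free [:: a; b; c].
Proof.
move=> H; pose X := [:: a; b; c]; rewrite -/X; apply/(@vector.freeP _ _ _ (in_tuple X)) => k.
rewrite !big_ord_recl big_ord0 addr0 addrA /= => /H[k0 k1 k2] i.
case: (unliftP 0 i) => [j|] -> //; case: (unliftP 0 j) => [l|] -> //.
by rewrite ord1.
Qed.

Lemma exprz_weights (K : fieldType) (x y u : K) (p r s : nat) : x != 0 ->
  y ^+ p * x ^+ r * u = x ^ (r%:Z - s%:Z) * y ^ p%:Z * u * x ^+ s.
Proof.
move=> nzx; have -> : x ^+ r = x ^ (r%:Z - s%:Z) * x ^+ s.
  by rewrite -[x ^+ s]/(x ^ s%:Z) -expfzDr // subrK.
by rewrite -[y ^ p%:Z]/(y ^+ p); ring.
Qed.

Section Existence.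
Variables (R : realType) (n f' : nat).
Local Notation C := (Complex R).
Local Notation f := f'.+1.
Local Notation e := n.+2.
Hypothesis hN : (2 * (f + 2) = n.+2 * n.+3)%N.

Lemma dim_Sym2 : \dim {:Sym2 R e} = (f + 2)%N.
Proof.
have -> : \dim {:Sym2 R e} = \dim (sym_mx R e).
  by rewrite dimvf.
rewrite dim_sym_mx; apply/eqP.
by rewrite -(eqn_pmul2l (isT : 0 < 2)%N) bin2_doubled hN.
Qed.

Lemma sym2_basis : exists (B0 C0 : 'M[C]_e) (bas : (f + 2).-tuple (Sym2 R e)),
  [/\ basis_of {:Sym2 R e} bas, disc_mx B0 != 0, disc_mx C0 != 0,
     separable_poly (disc_mx (line_mx (- B0) C0)) &
     [/\ vsval bas`_0 = C0, vsval bas`_f = B0 & vsval bas`_f.+1 = 1%:M]].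
Proof.
have [B0 [C0 [BT CT nzB nzC sep]]] := separable_basis C n.
pose s2 (S : 'M[C]_e) : Sym2 R e := vsproj (sym_mx R e) S.
have s2K (S : 'M[C]_e) : S^T = S -> vsval (s2 S) = S.
  by move=> /sym_mxP ST; rewrite /s2 vsprojK.
have fr : free [:: s2 C0; s2 B0; s2 1%:M].
  apply: free_triple => x y z /(congr1 vsval).
  rewrite linear0 !linearD !linearZ /= !s2K ?trmx1 //.
  by move=> /(separable_basis_free nzC sep)[].
have dim3 : \dim {:Sym2 R e} = f'.+3 by rewrite dim_Sym2 addn2.
have [bas [hb h0 h1 h2]] := basis_extend dim3 fr.
exists B0, C0, bas; split=> //; rewrite h0 h1 h2 !s2K //.
by apply: trmx1.
Qed.

Lemma tangent_pencils_class :
  is_equivariant_class (zariski_closure (@tangent_pencils R e f))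
    ((4 * n.+1)%N%:Z - (n.+3 * (n.+2 * n.+1))%N%:Z, (n.+2 * n.+1)%N%:Z).
Proof.
have [B0 [C0 [bas [hb nzB nzC sep [h0 h1 h2]]]]] := sym2_basis.
pose mx : {linear HomSym2 R e f -> 'M[C]_(f, f + 2)} := mx_of bas.
pose hom : {linear 'M[C]_(f, f + 2) -> HomSym2 R e f} :=
  HB.pack (hom_of (f := f) bas) (GRing.isLinear.Build _ _ _ _ _ (hom_of_linear hb)).
pose sy : {linear 'cV[C]_(f + 2) -> 'M[C]_e} := sym_of bas.
pose cr (S : 'M[C]_e) := crd bas (vsproj (sym_mx R e) S).
pose crdL : {linear Sym2 R e -> 'cV[C]_(f + 2)} := crd bas.
pose uncrdL : {linear 'cV[C]_(f + 2) -> Sym2 R e} := uncrd bas.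
have crdLK : cancel crdL uncrdL by move=> S; apply: crdK.
have uncrdLK : cancel uncrdL crdL by move=> a; apply: uncrdK.
have mxE' (psi : HomSym2 R e f) S : psi S = mx psi *m crdL S by apply: mx_ofE.
have homK : cancel hom mx by move=> M; apply: hom_ofK.
have mxK : cancel mx hom by move=> psi; apply: mx_ofK.
have syT a : (sy a)^T = sy a by apply: sym_ofT.
have syK : cancel sy cr by move=> a; rewrite /cr /sy /= /sym_of vsvalK uncrdK.
have crK S : S^T = S -> sy (cr S) = S.
  by move=> /sym_mxP ST; rewrite /sy /cr /= sym_of_crd // vsprojK.
have syd (j : 'I_(f + 2)) : sy (delta_mx j 0) = vsval bas`_j.
  by rewrite -(sym_of_crd hb); congr sym_of; apply/esym/crd_delta.
have s0 : sy (delta_mx (lshift 2 0) 0) = C0 by rewrite syd.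
have s1 : sy (delta_mx (penult f) 0) = B0 by rewrite syd /= addn0.
have s2 : sy (delta_mx (last f) 0) = 1%:M by rewrite syd /= addn1.
have [P [nzP idP inv]] := tangent_ideal homK mxK syT syK crK hN s0 s1 s2 nzB nzC sep.
have tan psi : tangent_pencils psi <-> tangent mx sy psi.
  have lkP (S : Sym2 R e) : S \in lker psi <-> mx psi *m crdL S = 0.
    by rewrite memv_ker mxE'; split=> [/eqP|->].
  split=> [[/(dim_lker_plucker crdLK uncrdLK (mxE' psi)) pl [A [kA rA dA]]]|].
    split=> //; exists (crdL A); split; first exact/lkP.
      by rewrite /sy /= sym_of_crd.
    move=> b Mb; have kb : uncrdL b \in lker psi by apply/lkP; rewrite uncrdLK.
    by have := dA _ kb; rewrite deriv_det_pencil0 /sy /= sym_of_crd.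
  move=> [pl [a [Ma ra tra]]]; split; first exact/(dim_lker_plucker crdLK uncrdLK (mxE' psi)).
  exists (uncrdL a); split=> //; first by apply/lkP; rewrite uncrdLK.
  move=> B /lkP MB; rewrite deriv_det_pencil0.
  by have := tra _ MB; rewrite /sy /= sym_of_crd.
exists P; split=> //; first last.
  move=> g h psi psi' ug uh tr.
  have : mx psi' *m sym2_mx sy cr g = h *m mx psi.
    apply: mulmx_col_inj => a; rewrite -!mulmxA -!mx_of_uncrd //.
    apply: tr; exact: sym2_mxE syT crK _ _.
  move/(inv _ _ _ _ ug uh) => eP.
  have nzg : \det g != 0 by rewrite -unitfE -unitmxE.
  apply: (mulIf (expf_neq0 (n.+3 * (n.+2 * n.+1)) nzg)); rewrite eP.
  exact: exprz_weights.
(* A set and its Zariski closure are annihilated by the same polynomials. *)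
- move=> Q; rewrite -idP; split=> [Q0 psi /tan tpsi|Q0 psi].
    by apply: Q0 => p; apply.
  by apply => phi /tan; apply: Q0.
Qed.
End Existence.

(** * From the weights to the Chern classes *)

Lemma mulrz_weights (U : zmodType) (u v : U) (k m r s : nat) :
  u *~ (r%:Z - (r + m * k)%N%:Z) + v *~ (s * k)%N%:Z = (v *+ s - u *+ m) *+ k.
Proof.
rewrite PoszD opprD addrA subrr add0r mulrNz -!pmulrn mulrnBl -!mulrnA.
exact: addrC.
Qed.

Lemma virtual_class_weights (R : realType) n f (X : variety R) (E : vbundle X n.+2)
    (F : vbundle X f) (phi : sym2_morphism E F) : f = ('C(n.+3, 2) - 2)%N ->
  virtual_class phi = (c1 F *+ n.+2 - c1 E *+ (n.+2 ^ 2 + n.+2 - 4)) *+ (n.+2 - 1).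
Proof.
move=> hf; have bin := bin2_doubled n.
have bin_ge : (6 <= n.+2 * n.+3)%N by apply: (@leq_mul 2 3).
have hN : (2 * (f + 2) = n.+2 * n.+3)%N by move: hf bin bin_ge; move: (n.+2 * _)%N; lia.
have f_gt0 : (0 < f)%N by move: hN bin_ge; move: (n.+2 * _)%N; lia.
case: f => // f' in E F phi hf hN f_gt0 *.
have cls := tangent_pencils_class R hN.
have uniq w (cw : is_equivariant_class _ w) := @equivariant_class_unique R n.+2 f'.+1 _ _ _
  isT f_gt0 cw cls.
have := xget_unique (0, 0) cls uniq.
rewrite /virtual_class /equivariant_class => -> /=.
have -> : (n.+3 * (n.+2 * n.+1) = 4 * n.+1 + (n.+2 ^ 2 + n.+2 - 4) * n.+1)%N.
  have -> : (n.+2 ^ 2 + n.+2 = n * n + 5 * n + 2 + 4)%N by rewrite -(addn2 n); ring.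
  by rewrite addnK -(addn3 n) -(addn2 n) -(addn1 n); ring.
by rewrite subn1; apply: mulrz_weights.
Qed.

Theorem theorem1p2 (R : realType) (e f : nat) (he : (2 <= e)%N)
    (hf : f = ('C(e.+1, 2) - 2)%N) (X : variety R)
    (E : vbundle X e) (F : vbundle X f) (phi : sym2_morphism E F) :
  virtual_class phi = (c1 F *+ e - c1 E *+ (e ^ 2 + e - 4)) *+ (e - 1).
Proof.
by case: e he hf E phi => [|[|n]] // _ hf E phi; apply: virtual_class_weights.
Qed.
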